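(* Let $k\in\mathbb{N}$, $\alpha,\beta\in\mathbb{R}\setminus\mathbb{Z}$ and $x\in\mathbb{C}'=\mathbb{C}\setminus(-\infty,0]$. Writing $e(u)=e^{2\pi iu}$: (1) $\displaystyle\mathscr{F}_k(x;\alpha,\beta)+(-x)^{k-2}\mathscr{F}_k\!\left(\tfrac1x;\beta,\alpha\right)=\frac1x\mathrm{Li}_k(e(\alpha))-(-x)^{k-1}\mathrm{Li}_k(e(\beta))+\sum_{r=1}^{k-1}(-x)^{r-1}\mathrm{Li}_{k-r}(e(\alpha))\mathrm{Li}_r(e(\beta))$; (2) $\displaystyle\mathscr{F}_k(x;\alpha,\beta)-\mathscr{F}_k(x+1;\alpha+\beta,\beta)+(-x)^{k-2}\mathscr{F}_k\!\left(\tfrac{x+1}{x};\alpha+\beta,\alpha\right)=\frac1x\mathrm{Li}_k(e(\alpha))-\frac{(-x)^{k-1}}{x+1}\mathrm{Li}_k(e(\alpha+\beta))+\sum_{r=1}^{k-1}(-x)^{r-1}\mathrm{Li}_{r,k-r}(e(\beta),e(\alpha))$; (3) $\displaystyle\mathscr{F}_k(x;\alpha,\beta)+\mathscr{F}_k(x;-\alpha,-\beta)-\mathscr{F}_k(x+1;\alpha+\beta,\beta)-\mathscr{F}_k(x+1;-\alpha-\beta,-\beta)+(-x)^{k-2}\mathscr{F}_k\!\left(\tfrac{x+1}{x};\alpha+\beta,\alpha\right)+(-x)^{k-2}\mathscr{F}_k\!\left(\tfrac{x+1}{x};-\alpha-\beta,-\alpha\right)$ $\displaystyle=\frac1x\{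\mathrm{Li}_k(e(\alpha))+\mathrm{Li}_k(e(-\alpha))\}-\frac{(-x)^{k-1}}{x+1}\{\mathrm{Li}_k(e(\alpha+\beta))+\mathrm{Li}_k(e(-\alpha-\beta))\}+\sum_{r=1}^{k-1}(-x)^{r-1}\{\mathrm{Li}_{r,k-r}(e(\beta),e(\alpha))+\mathrm{Li}_{r,k-r}(e(-\beta),e(-\alpha))\}$.
   Context: $\mathrm{Li}_s(z)=\sum_{n\geq1}z^n/n^s$ and the double polylogarithm is $\mathrm{Li}_{a,b}(z_1,z_2)=\sum_{0<p<q}\frac{z_1^pz_2^q}{p^aq^b}$ (values on the unit circle understood as the corresponding sums/limits). For $\alpha\in\mathbb{R}$, $\beta\in\mathbb{R}\setminus\mathbb{Z}$, integer $k\geq1$, $\mathscr{F}_k(x;\alpha,\beta)=\int_0^\infty\frac{\mathrm{Li}_{k-1}(e^{-xt}e^{2\pi i\alpha})}{1-e^{-t}e^{2\pi i\beta}}dt$ for $\mathrm{Re}(x)>0$, extended to $x\in\mathbb{C}'$ by analytic continuation (given by the series $\sum_{p\geq1,q\geq0}\frac{e^{2\pi i(\alpha p+\beta q)}}{p^{k-1}(px+q)}$).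
   Formalization: In (2) and (3), when k=1 it is additionally assumed that α+β is not an integer, since otherwise Li_1(e(α+β)) and the F_1 terms with parameter α+β diverge and the formulas are undefined. *)

(* Defs.v *)
From Stdlib Require Import Reals ZArith.
From Coquelicot Require Import Coquelicot.

Open Scope C_scope.

Definition Cexp (z : C) : C :=
  RtoC (exp (Re z)) * (cos (Im z), sin (Im z)).

Definition e (u : R) : C := Cexp (RtoC (2 * PI * u) * Ci).

Definition Cpowz (z : C) (n : Z) : C :=
  match n with
  | Z0 => 1
  | Zpos p => z ^ Pos.to_nat p
  | Zneg p => / z ^ Pos.to_nat p
  end.

Definition non_integer (u : R) : Prop := forall n : Z, u <> IZR n.

Definition slit_plane (z : C) : Prop := ~ (Im z = 0%R /\ (Re z <= 0)%R).

(* Limit of the partial sums, so conditionally convergent series (such as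
   polylogarithms on the unit circle) are covered; meaningless if the series
   diverges. *)
Definition CSeries (a : nat -> C) : C :=
  iota (T := C_CompleteNormedModule)
    (fun l : C => is_series (V := C_NormedModule) a l).

(* Sum of a r over m <= r <= n, which is 0 if n < m. *)
Definition Csum (a : nat -> C) (m n : nat) : C :=
  sum_n_m (G := C_AbelianMonoid) a m n.

(* The summation index n >= 1 is shifted to start at 0. *)
Definition Li (s : nat) (z : C) : C :=
  CSeries (fun n => z ^ S n / RtoC (INR (S n)) ^ s).

(* The sum over 0 < p < q, as the limit for N -> oo of the sums over
   0 < p < q <= N; the outer index is q = S n. *)
Definition Li2 (a b : nat) (z1 z2 : C) : C :=
  CSeries (fun n =>
    Csum (fun p => z1 ^ p / RtoC (INR p) ^ a) 1 n
    * (z2 ^ S n / RtoC (INR (S n)) ^ b)).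

Definition scrF_integrand (k : nat) (alpha beta : R) (x : C) (t : R) : C :=
  Li (k - 1) (Cexp (- (x * RtoC t)) * e alpha)
  / (1 - RtoC (exp (- t)) * e beta).

Definition analytic_at (f : C -> C) (z0 : C) : Prop :=
  exists (r : R) (a : nat -> C),
    (0 < r)%R /\
    forall z : C, (Cmod (z - z0) < r)%R ->
      is_pseries (K := C_AbsRing) (V := C_NormedModule) a (z - z0) (f z).

(* f is an analytic continuation to the slit plane of the improper
   integral defined on the right half-plane. *)
Definition is_scrF (k : nat) (alpha beta : R) (f : C -> C) : Prop :=
  (forall z : C, slit_plane z -> analytic_at f z) /\
  (forall x : C, (0 < Re x)%R ->
     is_RInt_gen (V := C_R_NormedModule) (scrF_integrand k alpha beta x)
       (at_right 0) (Rbar_locally p_infty) (f x)).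

(* The value at x of the analytic continuation, which is unique on the slit
   plane. *)
Definition scrF (k : nat) (x : C) (alpha beta : R) : C :=
  iota (T := C_CompleteNormedModule)
    (fun y : C => exists f : C -> C, is_scrF k alpha beta f /\ f x = y).

(* Main.v *)
Require Import Defs.
From Stdlib Require Import Reals ZArith Lra Lia Psatz Classical.
From Coquelicot Require Import Coquelicot.

(** Write u = e(alpha), v = e(beta), and let S_N(x) be the sum of
    u^p v^q / (p^(k-1) (p x + q)) over 1 <= p <= N, 0 <= q <= N, and T_N(x) the same sum
    over p + q <= N.  The expansion of (P^(-n) - (-x)^n Q^(-n)) / (P x + Q) as a finite
    geometric sum turns both functional equations into exact identities between such finite
    sums and partial sums of polylogarithms, so everything reduces to the convergence of
    S_N and T_N.

    For x in the slit plane pick om with Re om > 0 and Re (x om) > 0.  Integrating geometric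
    sums along the ray through om gives S_N(x) as the integral over t > 0 of
    om (sum_(p <= N) z^p / p^(k-1)) (sum_(q <= N) w^q), with z = u exp(-x om t) and
    w = v exp(-om t), and this integrand differs from om Li_(k-1)(z) / (1 - w) by at most
    eps_N / (sqrt t (1 + sqrt t)^2) with eps_N -> 0 locally uniformly in x; likewise for
    T_N.  Taking om = 1 identifies the limit with the defining integral when Re x > 0.
    Locally uniform limits of power series are power series, by the Cauchy estimate, so the
    limit is the analytic continuation, which is unique by the identity theorem along the
    segment from 1 to x. *)

Open Scope R_scope.

(** * Limits and finite sums of complex numbers *)

(** The double series converges only conditionally, so each finite identity needs truncations
    adapted to it. Exchanging p and q in (1) preserves the square p, q <= N. In (2), p (x + 1) + q =
    p x + (p + q) sends the pairs with p + q <= N to the pairs p <= q' <= N of the square, so the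
    shifted functions must be summed over triangles, and square and triangle must be shown to give
    the same value. Both are therefore compared with one integral. The error of that comparison has
    two sources: the tail of Li_(k-1), and the last powers of w in the inner geometric sums. For k
    >= 2 the factor 1 / p^(k-1) helps with both; for k = 1 only cancellation does, which requires u
    <> 1 for the tail and the square, and u <> v for the triangle. Near t = 0 the exponential
    damping is lost, so no bound uniform in t tends to 0; bounding exp(-m t) by a multiple of 1 /
    sqrt(m t) gains a power of m at the price of an integrable singularity. The finite sums do not
    involve om, so turning the ray changes the integrand but not the limit. *)

Definition is_Clim (s : nat -> C) (l : C) : Prop :=
  is_lim_seq (fun n => Cmod (s n - l)) 0.

Lemma is_Clim_eps (s : nat -> C) (l : C) :
  is_Clim s l <->
  forall eps, 0 < eps -> exists N, forall n, (N <= n)%nat -> Cmod (s n - l) < eps.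
Proof.
  unfold is_Clim. rewrite is_lim_seq_Reals. unfold Un_cv, R_dist.
  split; intros H eps He; destruct (H eps He) as [N HN]; exists N; intros n Hn;
    specialize (HN n Hn); rewrite Rminus_0_r in *;
    rewrite Rabs_pos_eq in * by apply Cmod_ge_0; exact HN.
Qed.

Lemma is_Clim_filterlim (s : nat -> C) (l : C) :
  is_Clim s l <-> filterlim s eventually (locally (T := C_UniformSpace) l).
Proof.
  rewrite is_Clim_eps. split.
  - intros H. apply filterlim_locally. intros eps.
    destruct (H eps (cond_pos eps)) as [N HN]. exists N. intros n Hn.
    apply C_NormedModule_mixin_compat1. exact (HN n Hn).
  - intros H eps He.
    (* The balls of [C_UniformSpace] are squares rather than discs, which costs a factor [sqrt 2] in
       this direction. *)
    assert (H2 : 0 < sqrt 2) by (apply sqrt_lt_R0; lra).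
    assert (He2 : 0 < eps / sqrt 2) by (apply Rdiv_lt_0_compat; lra).
    destruct (proj1 (filterlim_locally (U := C_UniformSpace) s l) H (mkposreal _ He2)) as [N HN].
    exists N. intros n Hn. specialize (HN n Hn).
    apply C_NormedModule_mixin_compat2 in HN. simpl in HN.
    replace (sqrt 2 * (eps / sqrt 2)) with eps in HN by (field; lra). exact HN.
Qed.

Lemma is_Clim_ext (s t : nat -> C) (l : C) :
  (forall n, s n = t n) -> is_Clim s l -> is_Clim t l.
Proof.
  intros H. apply is_lim_seq_ext. intros n. now rewrite H.
Qed.

Lemma is_Clim_le (s : nat -> C) (l : C) (b : nat -> R) :
  (forall n, Cmod (s n - l) <= b n) -> is_lim_seq b 0 -> is_Clim s l.
Proof.
  intros H Hb. apply is_lim_seq_le_le with (u := fun _ => 0) (w := b).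
  - intros n. split; [apply Cmod_ge_0 | apply H].
  - apply is_lim_seq_const.
  - exact Hb.
Qed.

Lemma is_Clim_const (l : C) : is_Clim (fun _ => l) l.
Proof.
  apply is_Clim_le with (b := fun _ => 0); [|apply is_lim_seq_const].
  intros _. replace (l - l)%C with (RtoC 0) by ring. rewrite Cmod_0. lra.
Qed.

Lemma is_Clim_plus (s t : nat -> C) (l m : C) :
  is_Clim s l -> is_Clim t m -> is_Clim (fun n => s n + t n)%C (l + m)%C.
Proof.
  intros Hs Ht.
  apply is_Clim_le with (b := fun n => Cmod (s n - l) + Cmod (t n - m)).
  - intros n. replace (s n + t n - (l + m))%C with ((s n - l) + (t n - m))%C by ring.
    apply Cmod_triangle.
  - replace 0 with (0 + 0) by ring.
    now apply is_lim_seq_plus'.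
Qed.

Lemma is_Clim_mult_l (c : C) (s : nat -> C) (l : C) :
  is_Clim s l -> is_Clim (fun n => c * s n)%C (c * l)%C.
Proof.
  intros Hs.
  apply is_Clim_le with (b := fun n => Cmod c * Cmod (s n - l)).
  - intros n. replace (c * s n - c * l)%C with (c * (s n - l))%C by ring.
    rewrite Cmod_mult. lra.
  - replace 0 with (Cmod c * 0) by ring.
    apply is_lim_seq_mult'; [apply is_lim_seq_const | exact Hs].
Qed.

Lemma is_Clim_minus (s t : nat -> C) (l m : C) :
  is_Clim s l -> is_Clim t m -> is_Clim (fun n => s n - t n)%C (l - m)%C.
Proof.
  intros Hs Ht.
  apply is_Clim_ext with (fun n => s n + (- (1)) * t n)%C; [intros n; ring|].
  replace (l - m)%C with (l + (- (1)) * m)%C by ring.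
  apply is_Clim_plus; [exact Hs | now apply is_Clim_mult_l].
Qed.

Lemma is_Clim_mult (s t : nat -> C) (l m : C) :
  is_Clim s l -> is_Clim t m -> is_Clim (fun n => s n * t n)%C (l * m)%C.
Proof.
  intros Hs Ht.
  apply is_Clim_le with
    (b := fun n => Cmod (s n - l) * Cmod (t n - m)
                   + (Cmod l * Cmod (t n - m) + Cmod m * Cmod (s n - l))).
  - intros n.
    replace (s n * t n - l * m)%C with
      ((s n - l) * (t n - m) + (l * (t n - m) + m * (s n - l)))%C by ring.
    eapply Rle_trans; [apply Cmod_triangle|]. rewrite Cmod_mult.
    apply Rplus_le_compat_l. eapply Rle_trans; [apply Cmod_triangle|].
    rewrite !Cmod_mult. lra.
  - replace 0 with (0 * 0 + (Cmod l * 0 + Cmod m * 0)) by ring.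
    apply is_lim_seq_plus'; [now apply is_lim_seq_mult'|].
    apply is_lim_seq_plus'; apply is_lim_seq_mult';
      try apply is_lim_seq_const; assumption.
Qed.

Lemma is_Clim_unique (s : nat -> C) (l m : C) :
  is_Clim s l -> is_Clim s m -> l = m.
Proof.
  rewrite !is_Clim_eps. intros Hl Hm.
  destruct (Ceq_dec l m) as [|Hne]; [assumption|exfalso].
  assert (Hd : 0 < Cmod (l - m)).
  { apply Cmod_gt_0. intros E. apply Hne.
    replace l with (l - m + m)%C by ring. rewrite E. ring. }
  destruct (Hl (Cmod (l - m) / 2)) as [N1 H1]; [lra|].
  destruct (Hm (Cmod (l - m) / 2)) as [N2 H2]; [lra|].
  specialize (H1 (max N1 N2) ltac:(lia)). specialize (H2 (max N1 N2) ltac:(lia)).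
  set (z := s (max N1 N2)) in *.
  assert (Cmod (l - m) <= Cmod (l - z) + Cmod (z - m)).
  { replace (l - m)%C with ((l - z) + (z - m))%C by ring. apply Cmod_triangle. }
  replace (l - z)%C with (- (z - l))%C in H by ring. rewrite Cmod_opp in H. lra.
Qed.

Lemma is_Clim_incr (s : nat -> C) (l : C) :
  is_Clim s l <-> is_Clim (fun n => s (S n)) l.
Proof.
  unfold is_Clim. apply (is_lim_seq_incr_1 (fun n => Cmod (s n - l))).
Qed.

Lemma Cauchy_Clim (s : nat -> C) :
  (forall eps, 0 < eps -> exists N, forall n m,
     (N <= n)%nat -> (N <= m)%nat -> Cmod (s n - s m) < eps) ->
  exists l, is_Clim s l.
Proof.
  intros H.
  assert (Hre : ex_finite_lim_seq (fun n => fst (s n))).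
  { apply ex_lim_seq_cauchy_corr. intros eps.
    destruct (H eps (cond_pos eps)) as [N HN]. exists N. intros n m Hn Hm.
    eapply Rle_lt_trans; [|exact (HN n m Hn Hm)].
    eapply Rle_trans; [|apply Rmax_Cmod]. apply Rmax_l. }
  assert (Him : ex_finite_lim_seq (fun n => snd (s n))).
  { apply ex_lim_seq_cauchy_corr. intros eps.
    destruct (H eps (cond_pos eps)) as [N HN]. exists N. intros n m Hn Hm.
    eapply Rle_lt_trans; [|exact (HN n m Hn Hm)].
    eapply Rle_trans; [|apply Rmax_Cmod]. apply Rmax_r. }
  destruct Hre as [a Ha], Him as [b Hb]. exists (a, b).
  apply is_Clim_le with
    (b := fun n => Rabs (fst (s n) - a) + Rabs (snd (s n) - b)).
  - intros n.
    replace (s n - (a, b))%C with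
      (RtoC (fst (s n) - a) + Ci * RtoC (snd (s n) - b))%C
      by (apply injective_projections; simpl; ring).
    eapply Rle_trans; [apply Cmod_triangle|].
    rewrite Cmod_mult, Cmod_Ci, !Cmod_R. lra.
  - replace 0 with (Rabs (a - a) + Rabs (b - b))
      by (rewrite !Rminus_diag, Rabs_R0; ring).
    apply is_lim_seq_plus';
      apply (is_lim_seq_abs _ (Finite _));
      apply is_lim_seq_minus'; try apply is_lim_seq_const; assumption.
Qed.

Lemma Csum_S (f : nat -> C) (m n : nat) :
  (m <= S n)%nat -> Csum f m (S n) = (Csum f m n + f (S n))%C.
Proof. apply (sum_n_Sm (G := C_AbelianMonoid)). Qed.

Lemma Csum_empty (f : nat -> C) (m n : nat) : (n < m)%nat -> Csum f m n = 0.
Proof. apply (sum_n_m_zero (G := C_AbelianMonoid)). Qed.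

Lemma Csum_one (f : nat -> C) (n : nat) : Csum f n n = f n.
Proof. apply (sum_n_n (G := C_AbelianMonoid)). Qed.

Lemma Csum_ext (f g : nat -> C) (m n : nat) :
  (forall i, (m <= i <= n)%nat -> f i = g i) -> Csum f m n = Csum g m n.
Proof. apply (sum_n_m_ext_loc (G := C_AbelianMonoid)). Qed.

Lemma Csum_shift (f : nat -> C) (m n : nat) :
  Csum (fun i => f (S i)) m n = Csum f (S m) (S n).
Proof. apply (sum_n_m_S (G := C_AbelianMonoid)). Qed.

Lemma Csum_first (f : nat -> C) (m n : nat) :
  (m <= n)%nat -> Csum f m n = (f m + Csum f (S m) n)%C.
Proof. apply (sum_Sn_m (G := C_AbelianMonoid)). Qed.

Lemma Csum_plus (f g : nat -> C) (m n : nat) :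
  Csum (fun i => f i + g i)%C m n = (Csum f m n + Csum g m n)%C.
Proof. apply (sum_n_m_plus (G := C_AbelianMonoid)). Qed.

Lemma Csum_mult_l (c : C) (f : nat -> C) (m n : nat) :
  Csum (fun i => c * f i)%C m n = (c * Csum f m n)%C.
Proof. apply (sum_n_m_mult_l (K := C_Ring)). Qed.

Lemma Csum_mult_r (c : C) (f : nat -> C) (m n : nat) :
  Csum (fun i => f i * c)%C m n = (Csum f m n * c)%C.
Proof. apply (sum_n_m_mult_r (K := C_Ring)). Qed.

Lemma Csum_minus (f g : nat -> C) (m n : nat) :
  Csum (fun i => f i - g i)%C m n = (Csum f m n - Csum g m n)%C.
Proof.
  replace (Csum f m n - Csum g m n)%C with (Csum f m n + - (1) * Csum g m n)%C by ring.
  rewrite <- Csum_mult_l, <- Csum_plus. apply Csum_ext. intros; ring.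
Qed.

Lemma Csum_Chasles (f : nat -> C) (m n k : nat) :
  (m <= S n)%nat -> (n <= k)%nat ->
  Csum f m k = (Csum f m n + Csum f (S n) k)%C.
Proof. apply (sum_n_m_Chasles (G := C_AbelianMonoid)). Qed.

Lemma Csum_swap (f : nat -> nat -> C) (a b c d : nat) :
  Csum (fun i => Csum (fun j => f i j) c d) a b
  = Csum (fun j => Csum (fun i => f i j) a b) c d.
Proof.
  destruct (Compare_dec.le_lt_dec a b) as [Hab|Hab].
  2:{ rewrite Csum_empty by exact Hab.
      rewrite (Csum_ext _ (fun _ => RtoC 0 * 0)%C).
      - rewrite Csum_mult_l. ring.
      - intros j _. rewrite Csum_empty by exact Hab. ring. }
  revert Hab. induction b as [|b IH]; intros Hab.
  - replace a with 0%nat by lia. rewrite Csum_one. apply Csum_ext.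
    intros j _. now rewrite Csum_one.
  - destruct (Nat.eq_dec a (S b)) as [->|Hne].
    + rewrite Csum_one. apply Csum_ext. intros j _. now rewrite Csum_one.
    + rewrite Csum_S by lia. rewrite IH by lia. rewrite <- Csum_plus.
      apply Csum_ext. intros j _. rewrite Csum_S by lia. reflexivity.
Qed.

Lemma sum_n_m_S_r (f : nat -> R) (m n : nat) :
  (m <= S n)%nat -> sum_n_m f m (S n) = sum_n_m f m n + f (S n).
Proof. apply (sum_n_Sm (G := R_AbelianMonoid)). Qed.

Lemma sum_n_m_0_r (f : nat -> R) (m n : nat) :
  (n < m)%nat -> sum_n_m f m n = 0.
Proof. apply (sum_n_m_zero (G := R_AbelianMonoid)). Qed.

Lemma Cmod_Csum_bound (f : nat -> C) (g : nat -> R) (m n : nat) :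
  (forall i, (m <= i <= n)%nat -> Cmod (f i) <= g i) ->
  Cmod (Csum f m n) <= sum_n_m g m n.
Proof.
  intros H.
  destruct (Compare_dec.le_lt_dec m n) as [Hab|Hab].
  2:{ rewrite Csum_empty, sum_n_m_0_r, Cmod_0 by exact Hab. lra. }
  revert H Hab. induction n as [|n IH]; intros H Hab.
  - replace m with 0%nat in * by lia. rewrite Csum_one, sum_n_n. apply H. lia.
  - destruct (Nat.eq_dec m (S n)) as [->|Hne].
    + rewrite Csum_one, sum_n_n. apply H. lia.
    + rewrite Csum_S, sum_n_m_S_r by lia.
      eapply Rle_trans; [apply Cmod_triangle|].
      apply Rplus_le_compat; [apply IH; [intros; apply H; lia|lia] | apply H; lia].
Qed.

Lemma is_series_Clim (a : nat -> C) (l : C) :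
  is_series (V := C_NormedModule) a l <-> is_Clim (Csum a 0) l.
Proof. rewrite is_Clim_filterlim. reflexivity. Qed.

(** [CSeries] is a description operator, so a value can be read off only after convergence is
    proved; uniqueness of limits then determines it. *)
Lemma CSeries_unique (a : nat -> C) (l : C) :
  is_Clim (Csum a 0) l -> CSeries a = l.
Proof.
  intros H. unfold CSeries. apply (iota_unique (V := C_CompleteNormedModule)).
  - intros y Hy. apply is_series_Clim in Hy. exact (is_Clim_unique _ _ _ Hy H).
  - now apply is_series_Clim.
Qed.

Lemma CSeries_correct (a : nat -> C) :
  (exists l, is_Clim (Csum a 0) l) -> is_Clim (Csum a 0) (CSeries a).
Proof. intros [l Hl]. now rewrite (CSeries_unique _ _ Hl). Qed.

Lemma Cmod_minus_sym (a b : C) : Cmod (a - b) = Cmod (b - a).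
Proof. rewrite <- Cmod_opp. f_equal. ring. Qed.

Lemma Cmod_minus_le (a b : C) : Cmod (a - b) <= Cmod a + Cmod b.
Proof.
  rewrite <- (Cmod_opp b). apply (Cmod_triangle a (- b)).
Qed.

Lemma Cmod_minus_ge (a b : C) : Cmod a - Cmod b <= Cmod (a - b).
Proof.
  assert (H := Cmod_triangle (a - b) b).
  replace (a - b + b)%C with a in H by ring. lra.
Qed.

Lemma Csum_Cauchy_Clim (a : nat -> C) (g : nat -> R) :
  (forall n, Cmod (a n) <= g n) -> ex_series g ->
  exists l, is_Clim (Csum a 0) l.
Proof.
  intros H Hg.
  assert (ex_series (V := C_CompleteNormedModule) a) as [l Hl].
  { apply (ex_series_le (V := C_CompleteNormedModule) a g); assumption. }
  exists l. apply is_series_Clim. exact Hl.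
Qed.

Lemma Cmod_Clim_le (s : nat -> C) (l : C) (M : R) (N0 : nat) :
  is_Clim s l -> (forall n, (N0 <= n)%nat -> Cmod (s n) <= M) -> Cmod l <= M.
Proof.
  rewrite is_Clim_eps. intros H HM. apply Rle_plus_epsilon.
  intros eps He. destruct (H eps He) as [N HN]. specialize (HN (max N N0) ltac:(lia)).
  assert (Hm := Cmod_minus_ge l (s (max N N0))). rewrite Cmod_minus_sym in HN.
  specialize (HM (max N N0) ltac:(lia)). lra.
Qed.

(** * Power series and the identity theorem on the slit plane *)

Lemma Csum_geom (q : C) (m n : nat) :
  (m <= S n)%nat ->
  ((1 - q) * Csum (fun i => q ^ i) m n = q ^ m - q ^ S n)%C.
Proof.
  intros H. destruct (Nat.eq_dec m (S n)) as [->|Hne].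
  { rewrite Csum_empty by lia. ring. }
  assert (Hmn : (m <= n)%nat) by lia. clear H Hne.
  induction n as [|n IH].
  - replace m with 0%nat by lia. rewrite Csum_one. simpl. ring.
  - destruct (Nat.eq_dec m (S n)) as [->|Hne].
    + rewrite Csum_one. rewrite !Cpow_S. ring.
    + rewrite Csum_S by lia. rewrite Cmult_plus_distr_l, IH by lia.
      rewrite (Cpow_S q (S n)). ring.
Qed.

Lemma sum_geom_le (q : R) (m n : nat) :
  0 <= q < 1 -> sum_n_m (fun i => q ^ i) m n <= q ^ m / (1 - q).
Proof.
  intros Hq.
  assert (P : forall j, 0 <= q ^ j) by (intros; apply pow_le; lra).
  destruct (Compare_dec.le_lt_dec m n) as [H|H].
  2:{ rewrite sum_n_m_0_r by exact H. apply Rdiv_le_0_compat; [apply P|lra]. }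
  assert (E : sum_n_m (fun i => q ^ i) m n = (q ^ m - q ^ S n) / (1 - q)).
  { induction n as [|n IH].
    - replace m with 0%nat by lia. rewrite sum_n_n. simpl. field. lra.
    - destruct (Nat.eq_dec m (S n)) as [->|Hne].
      + rewrite sum_n_n. simpl. field. lra.
      + rewrite sum_n_m_S_r by lia. rewrite IH by lia. simpl. field. lra. }
  rewrite E. apply Rmult_le_compat_r; [left; apply Rinv_0_lt_compat; lra|].
  specialize (P (S n)). lra.
Qed.

Lemma is_pseries_Clim (a : nat -> C) (w l : C) :
  is_pseries (K := C_AbsRing) (V := C_NormedModule) a w l <->
  is_Clim (Csum (fun n => a n * w ^ n)%C 0) l.
Proof.
  unfold is_pseries. rewrite is_series_Clim.
  split; apply is_Clim_ext; intros n; apply Csum_ext; intros i _;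
    apply Cmult_comm.
Qed.

Lemma Clim_bounded (s : nat -> C) (l : C) :
  is_Clim s l -> exists M, forall n, Cmod (s n) <= M.
Proof.
  intros H. apply is_Clim_filterlim in H.
  destruct (filterlim_bounded (V := C_NormedModule) s) as [M HM].
  - exists l. exact H.
  - exists M. exact HM.
Qed.

Lemma Csum_terms_bounded (t : nat -> C) (l : C) :
  is_Clim (Csum t 0) l -> exists M, forall n, Cmod (t n) <= M.
Proof.
  intros H. destruct (Clim_bounded _ _ H) as [M HM]. exists (M + M).
  assert (0 <= M) by (eapply Rle_trans; [apply Cmod_ge_0|apply (HM 0%nat)]).
  intros [|n].
  - specialize (HM 0%nat). rewrite Csum_one in HM. lra.
  - replace (t (S n)) with (Csum t 0 (S n) - Csum t 0 n)%C
      by (rewrite Csum_S by lia; ring).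
    eapply Rle_trans; [apply Cmod_minus_le|]. apply Rplus_le_compat; apply HM.
Qed.

(** Strong induction on [n]: once the earlier coefficients vanish, at a small zero [w] the term
    [a n * w ^ n] is minus the tail, which is of order [w ^ S n]. Dividing by [w ^ n] and letting
    [w] tend to 0 gives [a n = 0]. *)
Lemma pseries_coeff_zero (a : nat -> C) (d : C -> C) (r : R) :
  0 < r ->
  (forall w, Cmod w < r -> is_Clim (Csum (fun n => a n * w ^ n)%C 0) (d w)) ->
  (forall eps, 0 < eps -> exists w, 0 < Cmod w < eps /\ d w = 0) ->
  forall n, a n = 0.
Proof.
  intros Hr Hd Hz.
  set (rho := r / 2). assert (Hrho : 0 < rho) by (unfold rho; lra).
  destruct (Csum_terms_bounded _ _ (Hd (RtoC rho)
    ltac:(rewrite Cmod_R, Rabs_pos_eq; unfold rho; lra))) as [M HM].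
  assert (HM' : forall n, Cmod (a n) <= M / rho ^ n).
  { intros n. specialize (HM n). rewrite Cmod_mult, Cmod_pow, Cmod_R in HM.
    rewrite Rabs_pos_eq in HM by lra.
    apply Rle_div_r; [apply Rlt_gt, pow_lt; lra|exact HM]. }
  assert (HM0 : 0 <= M) by (eapply Rle_trans; [apply Cmod_ge_0|apply (HM 0%nat)]).
  intros n. induction n as [n IH] using lt_wf_ind.
  apply Cmod_eq_0. apply Rle_antisym; [|apply Cmod_ge_0].
  assert (Key : forall eps, 0 < eps -> eps < rho / 2 ->
    Cmod (a n) <= 2 * M / rho ^ S n * eps).
  { intros eps He He2. destruct (Hz eps He) as [w [[Hw0 Hw1] Hdw]].
    (* Since [eps < rho / 2], the ratio [q] is at most 1/2, so the geometric tail from [S n] on is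
       at most [2 * q ^ S n]. *)
    set (q := Cmod w / rho).
    assert (Hq : 0 <= q <= 1 / 2).
    { unfold q. split; [apply Rdiv_le_0_compat; lra|].
      apply Rle_div_l; lra. }
    assert (B : Cmod (d w - a n * w ^ n) <= M * (q ^ S n * 2)).
    { apply Cmod_Clim_le with (s := fun N => (Csum (fun n => a n * w ^ n) 0 N - a n * w ^ n)%C)
        (N0 := S n).
      - apply is_Clim_minus; [apply Hd; unfold rho in *; lra|apply is_Clim_const].
      - intros N HN. rewrite (Csum_Chasles _ 0 n N) by lia.
        assert (E : Csum (fun n0 => a n0 * w ^ n0)%C 0 n = (a n * w ^ n)%C).
        { destruct n as [|n']; [apply Csum_one|]. rewrite Csum_S by lia.
          rewrite (Csum_ext _ (fun _ => RtoC 0 * 0)%C).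
          - rewrite Csum_mult_l. ring.
          - intros i Hi. rewrite (IH i) by lia. ring. }
        rewrite E.
        replace (a n * w ^ n + Csum (fun n0 => a n0 * w ^ n0) (S n) N - a n * w ^ n)%C
          with (Csum (fun n0 => a n0 * w ^ n0) (S n) N)%C by ring.
        eapply Rle_trans; [apply (Cmod_Csum_bound _ (fun i => M * q ^ i))|].
        + intros i _. rewrite Cmod_mult, Cmod_pow. unfold q, Rdiv.
          rewrite Rpow_mult_distr, pow_inv.
          specialize (HM' i).
          replace (M * (Cmod w ^ i * / rho ^ i)) with ((M / rho ^ i) * Cmod w ^ i)
            by (unfold Rdiv; ring).
          apply Rmult_le_compat_r; [apply pow_le, Cmod_ge_0|exact HM'].
        + rewrite (sum_n_m_mult_l (K := R_Ring) M (fun i => q ^ i)).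
          change (M * sum_n_m (fun i => q ^ i) (S n) N <= M * (q ^ S n * 2)).
          apply Rmult_le_compat_l; [exact HM0|].
          eapply Rle_trans; [apply sum_geom_le; lra|].
          apply Rmult_le_compat_l; [apply pow_le; lra|].
          replace 2 with (/ (1 / 2)) by field.
          apply Rinv_le_contravar; lra. }
    rewrite Hdw in B.
    replace (0 - a n * w ^ n)%C with (- (a n * w ^ n))%C in B by ring.
    rewrite Cmod_opp, Cmod_mult, Cmod_pow in B.
    unfold q, Rdiv in B. rewrite Rpow_mult_distr, pow_inv in B.
    assert (Hp : 0 < Cmod w ^ n) by (apply pow_lt; lra).
    assert (Hp2 : 0 < rho ^ S n) by (apply pow_lt; lra).
    apply Rmult_le_reg_r with (Cmod w ^ n); [exact Hp|].
    eapply Rle_trans; [exact B|]. simpl (Cmod w ^ S n).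
    replace (M * (Cmod w * Cmod w ^ n * / rho ^ S n * 2)) with
      (2 * M / rho ^ S n * Cmod w * Cmod w ^ n) by (field; lra).
    apply Rmult_le_compat_r; [lra|]. apply Rmult_le_compat_l; [|lra].
    apply Rdiv_le_0_compat; lra. }
  set (K := 2 * M / rho ^ S n) in *.
  assert (HK : 0 <= K).
  { unfold K. apply Rdiv_le_0_compat; [lra|apply pow_lt; lra]. }
  destruct (Rle_or_lt (Cmod (a n)) 0) as [|Hpos]; [assumption|exfalso].
  (* The second entry makes [K * eps] smaller than [Cmod (a n)], against [Key]; writing [K + 1]
     covers the case [K = 0]. *)
  set (eps := Rmin (rho / 4) (Cmod (a n) / (2 * (K + 1)))).
  assert (He : 0 < eps).
  { apply Rmin_glb_lt; [lra|]. apply Rdiv_lt_0_compat; lra. }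
  assert (He1 : eps <= rho / 4) by apply Rmin_l.
  assert (He2 : eps <= Cmod (a n) / (2 * (K + 1))) by apply Rmin_r.
  specialize (Key eps He ltac:(lra)).
  apply Rle_div_r in He2; [|lra]. nra.
Qed.

Lemma analytic_at_minus (f g : C -> C) (z0 : C) :
  analytic_at f z0 -> analytic_at g z0 -> analytic_at (fun z => f z - g z)%C z0.
Proof.
  intros [r [a [Hr Ha]]] [r' [b [Hr' Hb]]].
  exists (Rmin r r'), (fun n => a n - b n)%C. split; [now apply Rmin_glb_lt|].
  intros z Hz. apply is_pseries_Clim.
  apply is_Clim_ext with
    (fun N => Csum (fun n => a n * (z - z0) ^ n) 0 N
              - Csum (fun n => b n * (z - z0) ^ n) 0 N)%C.
  { intros N. rewrite <- Csum_minus. apply Csum_ext. intros; ring. }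
  apply is_Clim_minus; apply is_pseries_Clim; [apply Ha|apply Hb];
    (eapply Rlt_le_trans; [exact Hz|]); [apply Rmin_l|apply Rmin_r].
Qed.

Lemma analytic_zero_near (d : C -> C) (z0 : C) :
  analytic_at d z0 ->
  (forall eps, 0 < eps -> exists z, 0 < Cmod (z - z0) < eps /\ d z = 0) ->
  exists r, 0 < r /\ forall z, Cmod (z - z0) < r -> d z = 0.
Proof.
  intros [r [a [Hr Ha]]] Hz. exists r. split; [exact Hr|].
  assert (A0 : forall n, a n = 0).
  { apply pseries_coeff_zero with (d := fun w => d (w + z0)%C) (r := r); [exact Hr| |].
    - intros w Hw. apply is_pseries_Clim.
      replace w with (w + z0 - z0)%C at 1 by ring. apply Ha.
      now replace (w + z0 - z0)%C with w by ring.
    - intros eps He. destruct (Hz eps He) as [z [H1 H2]]. exists (z - z0)%C.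
      split; [exact H1|]. now replace (z - z0 + z0)%C with z by ring. }
  intros z Hlt. specialize (Ha z Hlt). apply is_pseries_Clim in Ha.
  apply (is_Clim_unique _ _ _ Ha).
  apply is_Clim_ext with (fun _ => RtoC 0); [|apply is_Clim_const].
  intros N. rewrite (Csum_ext _ (fun _ => RtoC 0 * 0)%C).
  - rewrite Csum_mult_l. ring.
  - intros i _. rewrite A0. ring.
Qed.

(* The zero set of [d] along the segment from 1 to [x] can have no last point: zeros
   accumulate there, so [d] vanishes in a neighbourhood. *)
Lemma slit_plane_identity (d : C -> C) (x : C) :
  (forall z, slit_plane z -> analytic_at d z) ->
  (forall z, 0 < Re z -> d z = 0) ->
  slit_plane x -> d x = 0.
Proof.
  intros Han Hd Hx.
  destruct (Ceq_dec x 1) as [->|Hx1]; [apply Hd; simpl; lra|].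
  set (g := fun s : R => (1 + RtoC s * (x - 1))%C).
  (* The slit plane is star-shaped about 1. *)
  assert (Hg : forall s, 0 <= s <= 1 -> slit_plane (g s)).
  { intros s Hs [H1 H2]. apply Hx. unfold g, Re, Im in *. simpl in *.
    destruct x as [x1 x2]; simpl in *.
    assert (s <> 0) by (intros ->; lra).
    assert (x2 = 0) by nra. subst x2. split; [reflexivity|nra]. }
  assert (Hx1' : 0 < Cmod (x - 1)).
  { apply Cmod_gt_0. intros E. apply Hx1. replace x with (x - 1 + 1)%C by ring.
    rewrite E. ring. }
  assert (Hgd : forall s t, Cmod (g s - g t) = Rabs (s - t) * Cmod (x - 1)).
  { intros s t. rewrite <- Cmod_R, <- Cmod_mult. f_equal. unfold g.
    rewrite RtoC_minus. ring. }
  set (E := fun s => 0 <= s <= 1 /\ forall s', 0 <= s' <= s -> d (g s') = 0).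
  assert (HE0 : exists s0, 0 < s0 /\ E s0).
  { exists (Rmin 1 (/ (2 * Cmod (x - 1)))).
    assert (P : 0 < Rmin 1 (/ (2 * Cmod (x - 1))))
      by (apply Rmin_glb_lt; [lra|apply Rinv_0_lt_compat; lra]).
    split; [exact P|]. split; [split; [lra|apply Rmin_l]|].
    intros s' [Hs1 Hs2]. apply Hd.
    assert (Hs3 : s' <= / (2 * Cmod (x - 1)))
      by (eapply Rle_trans; [exact Hs2|apply Rmin_r]).
    assert (Hm : s' * Cmod (x - 1) <= / 2).
    { replace (/2) with (/ (2 * Cmod (x - 1)) * Cmod (x - 1)) by (field; lra).
      apply Rmult_le_compat_r; lra. }
    assert (Hre := re_le_Cmod (g s' - 1)).
    replace (Cmod (g s' - 1)) with (s' * Cmod (x - 1)) in Hre.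
    - unfold g, Re in *. simpl in *. apply Rabs_le_between in Hre. lra.
    - replace (g s' - 1)%C with (RtoC s' * (x - 1))%C by (unfold g; ring).
      rewrite Cmod_mult, Cmod_R, Rabs_pos_eq; lra. }
  destruct HE0 as [s0 [Hs0 HEs0]].
  destruct (completeness E) as [sg [Hub Hlub]].
  { exists 1. intros s [Hs _]. lra. }
  { now exists s0. }
  assert (Hsg0 : s0 <= sg) by (apply Hub; exact HEs0).
  assert (Hsg1 : sg <= 1) by (apply Hlub; intros s [Hs _]; lra).
  assert (Hbelow : forall s, 0 <= s < sg -> d (g s) = 0).
  { intros s Hs. destruct (classic (exists t, E t /\ s < t)) as [[t [[Ht1 Ht2] Ht3]]|Hn].
    - apply Ht2. lra.
    - exfalso. apply (Rlt_not_le sg s); [lra|]. apply Hlub. intros t Ht.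
      apply Rnot_lt_le. intros Hlt. apply Hn. now exists t. }
  destruct (analytic_zero_near d (g sg)) as [r [Hr Hzero]].
  { apply Han, Hg. lra. }
  { intros eps He. set (h := Rmin sg (eps / (2 * Cmod (x - 1)))).
    assert (Hh : 0 < h) by (apply Rmin_glb_lt; [lra|apply Rdiv_lt_0_compat; lra]).
    assert (Hh1 : h <= sg) by apply Rmin_l.
    assert (Hh2 : h <= eps / (2 * Cmod (x - 1))) by apply Rmin_r.
    exists (g (sg - h)). split; [|apply Hbelow; lra].
    rewrite Hgd. replace (sg - h - sg) with (- h) by ring.
    rewrite Rabs_Ropp, Rabs_pos_eq by lra. split; [nra|].
    apply Rle_lt_trans with (eps / 2); [|lra].
    replace (eps / 2) with (eps / (2 * Cmod (x - 1)) * Cmod (x - 1)) by (field; lra).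
    apply Rmult_le_compat_r; lra. }
  assert (Hnear : forall s, Rabs (s - sg) < r / Cmod (x - 1) -> d (g s) = 0).
  { intros s Hs. apply Hzero. rewrite Hgd. apply Rlt_div_r in Hs; [exact Hs|lra]. }
  assert (Hd1 : 0 < r / Cmod (x - 1)) by (apply Rdiv_lt_0_compat; lra).
  destruct (Req_dec sg 1) as [Heq|Hne].
  - replace x with (g sg) by (rewrite Heq; unfold g; ring).
    apply Hnear. rewrite Rminus_diag, Rabs_R0. exact Hd1.
  - exfalso. set (t := Rmin 1 (sg + r / Cmod (x - 1) / 2)).
    assert (Ht : sg < t) by (apply Rmin_glb_lt; lra).
    apply (Rlt_not_le t sg Ht). apply Hub. split.
    + split; [lra|apply Rmin_l].
    + intros s' [H1 H2]. destruct (Rlt_or_le s' sg); [apply Hbelow; lra|].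
      apply Hnear. rewrite Rabs_pos_eq by lra.
      assert (t <= sg + r / Cmod (x - 1) / 2) by apply Rmin_r. lra.
Qed.

(** * Uniform limits of power series *)

Lemma Cexp_plus (a b : C) : Cexp (a + b) = (Cexp a * Cexp b)%C.
Proof.
  unfold Cexp, Re, Im. destruct a as [a1 a2], b as [b1 b2]. simpl.
  rewrite exp_plus, cos_plus, sin_plus.
  apply injective_projections; simpl; ring.
Qed.

Lemma Cexp_0 : Cexp 0 = 1.
Proof.
  unfold Cexp, Re, Im. simpl. rewrite exp_0, cos_0, sin_0.
  apply injective_projections; simpl; ring.
Qed.

Lemma Cexp_pow (a : C) (n : nat) : (Cexp a ^ n)%C = Cexp (RtoC (INR n) * a).
Proof.
  induction n as [|n IH].
  - simpl INR. replace (RtoC 0 * a)%C with (RtoC 0) by ring. now rewrite Cexp_0.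
  - rewrite Cpow_S, IH, <- Cexp_plus, S_INR, RtoC_plus. f_equal. ring.
Qed.

Lemma Cmod_cos_sin (t : R) : Cmod (cos t, sin t) = 1.
Proof.
  unfold Cmod. simpl. rewrite !Rmult_1_r.
  assert (H := sin2_cos2 t). unfold Rsqr in H.
  replace (cos t * cos t + sin t * sin t) with 1 by lra. apply sqrt_1.
Qed.

Lemma Cmod_Cexp (a : C) : Cmod (Cexp a) = exp (Re a).
Proof.
  unfold Cexp. rewrite Cmod_mult, Cmod_cos_sin, Cmod_R, Rabs_pos_eq.
  - ring.
  - left. apply exp_pos.
Qed.

Lemma e_plus (u v : R) : e (u + v) = (e u * e v)%C.
Proof.
  unfold e. rewrite <- Cexp_plus. f_equal.
  replace (2 * PI * (u + v)) with (2 * PI * u + 2 * PI * v) by ring.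
  rewrite RtoC_plus. ring.
Qed.

Lemma e_pow (u : R) (n : nat) : (e u ^ n)%C = e (INR n * u).
Proof.
  unfold e. rewrite Cexp_pow. f_equal.
  replace (2 * PI * (INR n * u)) with (INR n * (2 * PI * u)) by ring.
  rewrite (RtoC_mult (INR n)). ring.
Qed.

Lemma Cmod_e (u : R) : Cmod (e u) = 1.
Proof.
  unfold e. rewrite Cmod_Cexp. unfold Re. simpl.
  replace (2 * PI * u * 0 - 0 * 1) with 0 by ring. apply exp_0.
Qed.

Lemma e_cos_sin (u : R) : e u = (cos (2 * PI * u), sin (2 * PI * u)).
Proof.
  unfold e, Cexp, Re, Im. simpl.
  replace (2 * PI * u * 0 - 0 * 1) with 0 by ring.
  replace (2 * PI * u * 1 + 0 * 0) with (2 * PI * u) by ring.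
  rewrite exp_0. apply injective_projections; simpl; ring.
Qed.

Lemma e_IZR (n : Z) : e (IZR n) = 1.
Proof.
  rewrite e_cos_sin.
  assert (S0 : sin (IZR n * PI) = 0) by (apply sin_eq_0_1; now exists n).
  replace (2 * PI * IZR n) with (2 * (IZR n * PI)) by ring.
  rewrite sin_2a, cos_2a_sin, S0. apply injective_projections; simpl; ring.
Qed.

Lemma e_eq_1 (u : R) : e u = 1 -> exists n : Z, u = IZR n.
Proof.
  rewrite e_cos_sin. intros H. injection H as Hc _.
  replace (2 * PI * u) with (2 * (PI * u)) in Hc by ring.
  rewrite cos_2a_sin in Hc.
  assert (S0 : sin (PI * u) = 0) by nra.
  destruct (sin_eq_0_0 _ S0) as [n Hn]. exists n.
  assert (HP := PI_RGT_0).
  apply Rmult_eq_reg_l with PI; lra.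
Qed.

Lemma e_neq_1 (u : R) : non_integer u -> e u <> 1.
Proof. intros H E. destruct (e_eq_1 _ E) as [n Hn]. exact (H n Hn). Qed.

(** Convergence is uniform on the closed disc because [Cauchy_estimate] replaces [f] by a single
    partial sum at all its sample points on the boundary circle at once. *)
Definition unif_pseries (f : C -> C) (z0 : C) (r : R) (a : nat -> C) : Prop :=
  forall eps, 0 < eps -> exists K0, forall K z, (K0 <= K)%nat ->
    Cmod (z - z0) <= r ->
    Cmod (f z - Csum (fun n => a n * (z - z0) ^ n)%C 0 K) <= eps.

Lemma unif_pseries_plus f g z0 r a b :
  unif_pseries f z0 r a -> unif_pseries g z0 r b ->
  unif_pseries (fun z => f z + g z)%C z0 r (fun n => a n + b n)%C.
Proof.
  intros Hf Hg eps He.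
  destruct (Hf (eps / 2) ltac:(lra)) as [K1 H1].
  destruct (Hg (eps / 2) ltac:(lra)) as [K2 H2].
  exists (max K1 K2). intros K z HK Hz.
  rewrite (Csum_ext _ (fun n => a n * (z - z0) ^ n + b n * (z - z0) ^ n)%C)
    by (intros; ring).
  rewrite Csum_plus.
  set (A := Csum (fun n => a n * (z - z0) ^ n)%C 0 K).
  set (B := Csum (fun n => b n * (z - z0) ^ n)%C 0 K).
  replace (f z + g z - (A + B))%C with ((f z - A) + (g z - B))%C by ring.
  eapply Rle_trans; [apply Cmod_triangle|].
  specialize (H1 K z ltac:(lia) Hz). specialize (H2 K z ltac:(lia) Hz).
  fold A in H1. fold B in H2. lra.
Qed.

Lemma unif_pseries_scal c f z0 r a :
  unif_pseries f z0 r a ->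
  unif_pseries (fun z => c * f z)%C z0 r (fun n => c * a n)%C.
Proof.
  intros Hf eps He.
  assert (Hc := Cmod_ge_0 c).
  destruct (Hf (eps / (Cmod c + 1))) as [K0 HK0];
    [apply Rdiv_lt_0_compat; lra|].
  exists K0. intros K z HK Hz.
  rewrite (Csum_ext _ (fun n => c * (a n * (z - z0) ^ n))%C) by (intros; ring).
  rewrite Csum_mult_l.
  set (A := Csum (fun n => a n * (z - z0) ^ n)%C 0 K).
  replace (c * f z - c * A)%C with (c * (f z - A))%C by ring.
  rewrite Cmod_mult. specialize (HK0 K z HK Hz). fold A in HK0.
  apply Rle_trans with (Cmod c * (eps / (Cmod c + 1))).
  - apply Rmult_le_compat_l; assumption.
  - replace (Cmod c * (eps / (Cmod c + 1))) with (eps * (Cmod c / (Cmod c + 1)))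
      by (field; lra).
    rewrite <- (Rmult_1_r eps) at 2. apply Rmult_le_compat_l; [lra|].
    apply Rle_div_l; lra.
Qed.

Lemma unif_pseries_minus f g z0 r a b :
  unif_pseries f z0 r a -> unif_pseries g z0 r b ->
  unif_pseries (fun z => f z - g z)%C z0 r (fun n => a n - b n)%C.
Proof.
  intros Hf Hg eps He.
  destruct (unif_pseries_plus _ _ _ _ _ _ Hf (unif_pseries_scal (- (1)) _ _ _ _ Hg) eps He)
    as [K0 HK0].
  exists K0. intros K z HK Hz. specialize (HK0 K z HK Hz). simpl in HK0.
  rewrite (Csum_ext _ (fun n => (a n - b n) * (z - z0) ^ n)%C) in HK0
    by (intros; ring).
  now replace (f z + - (1) * g z)%C with (f z - g z)%C in HK0 by ring.
Qed.

Lemma unif_pseries_Csum (f : nat -> C -> C) z0 r (a : nat -> nat -> C) (m n : nat) :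
  (forall i, (m <= i <= n)%nat -> unif_pseries (f i) z0 r (a i)) ->
  unif_pseries (fun z => Csum (fun i => f i z) m n) z0 r
    (fun j => Csum (fun i => a i j) m n).
Proof.
  intros H eps He.
  destruct (Compare_dec.le_lt_dec m n) as [Hmn|Hmn].
  2:{ exists 0%nat. intros K z _ _. rewrite (Csum_empty (fun i => f i z)) by exact Hmn.
      rewrite (Csum_ext _ (fun _ => RtoC 0 * 0)%C).
      - rewrite Csum_mult_l. replace (0 - 0 * Csum (fun _ => RtoC 0) 0 K)%C with (RtoC 0) by ring.
        rewrite Cmod_0. lra.
      - intros j _. rewrite Csum_empty by exact Hmn. ring. }
  revert H eps He.
  induction n as [|n IH]; intros H.
  - replace m with 0%nat in * by lia. intros eps He.
    destruct (H 0%nat ltac:(lia) eps He) as [K0 HK0]. exists K0. intros K z HK Hz.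
    rewrite Csum_one. rewrite (Csum_ext _ (fun j => a 0%nat j * (z - z0) ^ j)%C).
    + now apply HK0.
    + intros j _. now rewrite Csum_one.
  - destruct (Nat.eq_dec m (S n)) as [->|Hne].
    + intros eps He. destruct (H (S n) ltac:(lia) eps He) as [K0 HK0].
      exists K0. intros K z HK Hz.
      rewrite Csum_one. rewrite (Csum_ext _ (fun j => a (S n) j * (z - z0) ^ j)%C).
      * now apply HK0.
      * intros j _. now rewrite Csum_one.
    + assert (IH' : unif_pseries (fun z => Csum (fun i => f i z) m n) z0 r
                      (fun j => Csum (fun i => a i j) m n)).
      { intros eps He. apply IH; [lia| |exact He]. intros i Hi. apply H. lia. }
      intros eps He.
      destruct (unif_pseries_plus _ _ _ _ _ _ IH' (H (S n) ltac:(lia)) eps He) as [K0 HK0].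
      exists K0. intros K z HK Hz. rewrite Csum_S by lia.
      rewrite (Csum_ext (fun j => Csum (fun i => a i j) m (S n) * (z - z0) ^ j)%C
                         (fun j => (Csum (fun i => a i j) m n + a (S n) j) * (z - z0) ^ j)%C).
      * now apply HK0.
      * intros j _. now rewrite Csum_S by lia.
Qed.

(** The truncated geometric expansion of [/ B] about [A], with its remainder, from
    [B / A = 1 - (A - B) / A]. *)
Lemma Cpow_minus_1_div (A B : C) (n : nat) :
  A <> 0 -> B <> 0 ->
  Csum (fun i => (/ A) * ((A - B) / A) ^ i)%C 0 n
  = ((1 - ((A - B) / A) ^ S n) / B)%C.
Proof.
  intros HA HB. rewrite Csum_mult_l.
  assert (G := Csum_geom ((A - B) / A) 0 n ltac:(lia)).
  replace (1 - (A - B) / A)%C with (B / A)%C in G by (field; exact HA).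
  change (B / A * Csum (fun i => ((A - B) / A) ^ i) 0 n
          = 1 - ((A - B) / A) ^ S n)%C in G.
  rewrite <- G.
  change (Csum (Cpow ((A - B) / A)) 0 n) with (Csum (fun i => ((A - B) / A) ^ i)%C 0 n).
  field. split; assumption.
Qed.

Lemma pow_lt_eps (q eps : R) :
  0 <= q < 1 -> 0 < eps -> exists N, forall n, (N <= n)%nat -> q ^ n < eps.
Proof.
  intros Hq He. destruct (pow_lt_1_zero q) with (y := eps) as [N HN].
  - rewrite Rabs_pos_eq; lra.
  - exact He.
  - exists N. intros n Hn. specialize (HN n Hn).
    rewrite Rabs_pos_eq in HN by (apply pow_le; lra). exact HN.
Qed.

(** The hypothesis keeps the pole off the closed disc. With [A] and [B] the denominators at [z0] and
    [z], the ratio of [A - B] to [A] has modulus at most [t < 1] and [B] has modulus at least [d],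
    so the remainder after [K] terms is at most [t ^ S K / d]. *)
Lemma unif_pseries_inv_linear (p q z0 : C) (r : R) :
  0 <= r -> Cmod p * r < Cmod (p * z0 + q) ->
  unif_pseries (fun z => / (p * z + q))%C z0 r
    (fun n => / (p * z0 + q) * ((- p) / (p * z0 + q)) ^ n)%C.
Proof.
  intros Hr H eps He.
  set (A := (p * z0 + q)%C) in *.
  assert (Hp := Cmod_ge_0 p).
  assert (HA : 0 < Cmod A) by nra.
  assert (HA0 : A <> 0) by now apply Cmod_gt_0.
  set (t := Cmod p * r / Cmod A).
  assert (Ht : 0 <= t < 1).
  { unfold t. split; [apply Rdiv_le_0_compat; nra|]. apply Rlt_div_l; lra. }
  set (d := Cmod A - Cmod p * r).
  assert (Hd : 0 < d) by (unfold d; lra).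
  destruct (pow_lt_eps t (eps * d) Ht ltac:(nra)) as [K0 HK0].
  exists K0. intros K z HK Hz.
  set (B := (p * z + q)%C).
  assert (HAB : (A - B = - p * (z - z0))%C) by (unfold A, B; ring).
  assert (HABm : Cmod (A - B) <= Cmod p * r).
  { rewrite HAB, Cmod_mult, Cmod_opp. apply Rmult_le_compat_l; assumption. }
  assert (HBm : d <= Cmod B).
  { unfold d. assert (Hg := Cmod_minus_ge A (A - B)).
    replace (A - (A - B))%C with B in Hg by ring. lra. }
  assert (HB0 : B <> 0) by (apply Cmod_gt_0; lra).
  rewrite (Csum_ext _ (fun i => (/ A) * ((A - B) / A) ^ i)%C).
  2:{ intros i _. rewrite HAB. rewrite <- Cmult_assoc, <- Cpow_mult_l. do 2 f_equal.
      field. exact HA0. }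
  rewrite Cpow_minus_1_div by assumption.
  replace (/ B - (1 - ((A - B) / A) ^ S K) / B)%C with (((A - B) / A) ^ S K / B)%C
    by (field; exact HB0).
  rewrite Cmod_div, Cmod_pow, Cmod_div by assumption.
  apply Rle_div_l; [lra|].
  apply Rle_trans with (t ^ S K).
  - apply pow_incr. split.
    + apply Rdiv_le_0_compat; [apply Cmod_ge_0|exact HA].
    + apply Rmult_le_compat_r; [left; now apply Rinv_0_lt_compat|exact HABm].
  - specialize (HK0 (S K) ltac:(lia)). nra.
Qed.

Lemma Csum_const (c : C) (n : nat) : Csum (fun _ => c) 0 n = (RtoC (INR (S n)) * c)%C.
Proof.
  induction n as [|n IH].
  - rewrite Csum_one. simpl. ring.
  - rewrite Csum_S, IH, (S_INR (S n)), RtoC_plus by lia. ring.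
Qed.

(** A geometric sum whose ratio is a root of unity of order dividing [S K]; the ratio is not 1
    because [i - n] is nonzero and smaller than [S K] in absolute value. *)
Lemma roots_of_unity_sum (K : nat) (i n : nat) :
  (i <= K)%nat -> (n <= K)%nat -> i <> n ->
  Csum (fun j => e ((INR i - INR n) / INR (S K) * INR j)) 0 K = 0.
Proof.
  intros Hi Hn Hne.
  set (q := e ((INR i - INR n) / INR (S K))).
  rewrite (Csum_ext _ (fun j => q ^ j)%C).
  2:{ intros j _. unfold q. rewrite e_pow. f_equal. ring. }
  assert (HS : 0 < INR (S K)) by (apply lt_0_INR; lia).
  assert (Hq1 : q <> 1).
  { intros E. apply e_eq_1 in E. destruct E as [l Hl].
    assert (E2 : INR i - INR n = IZR l * INR (S K)).
    { rewrite <- Hl. field. lra. }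
    rewrite !INR_IZR_INZ, <- minus_IZR, <- mult_IZR in E2. apply eq_IZR in E2.
    assert (l = 0)%Z by nia. subst l. lia. }
  assert (G := Csum_geom q 0 K ltac:(lia)).
  assert (Hq : (q ^ S K)%C = 1).
  { unfold q. rewrite e_pow.
    replace (INR (S K) * ((INR i - INR n) / INR (S K))) with (INR i - INR n) by (field; lra).
    rewrite !INR_IZR_INZ, <- minus_IZR. apply e_IZR. }
  rewrite Hq in G. change (q ^ 0)%C with (RtoC 1) in G.
  assert (H1q : (1 - q)%C <> 0).
  { intros E. apply Hq1. replace q with (1 - (1 - q))%C by ring. rewrite E. ring. }
  replace (Csum (fun j => q ^ j)%C 0 K) with ((1 - q) * Csum (fun j => q ^ j)%C 0 K / (1 - q))%C
    by (field; exact H1q).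
  rewrite G. field. exact H1q.
Qed.

(* Averaging over roots of unity of large order extracts the coefficients of a polynomial. *)
Lemma Cauchy_estimate (f : C -> C) (z0 : C) (r M : R) (a : nat -> C) :
  0 <= r -> unif_pseries f z0 r a ->
  (forall z, Cmod (z - z0) <= r -> Cmod (f z) <= M) ->
  forall n, Cmod (a n) * r ^ n <= M.
Proof.
  intros Hr Hf HM n. apply Rle_plus_epsilon. intros eps He.
  destruct (Hf eps He) as [K0 HK0].
  (* At least [K0], so that the partial sum is close to [f]; at least [n], so that the [S K] sample
     points separate [n] from the other exponents. *)
  set (K := max K0 n).
  set (z := fun j : nat => (z0 + RtoC r * e (INR j / INR (S K)))%C).
  assert (HS : 0 < INR (S K)) by (apply lt_0_INR; lia).
  assert (Hz : forall j, Cmod (z j - z0) <= r).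
  { intros j. unfold z.
    replace (z0 + RtoC r * e (INR j / INR (S K)) - z0)%C
      with (RtoC r * e (INR j / INR (S K)))%C by ring.
    rewrite Cmod_mult, Cmod_e, Cmod_R, Rabs_pos_eq; lra. }
  set (P := fun j => Csum (fun i => a i * (z j - z0) ^ i)%C 0 K).
  assert (HP : forall j, Cmod (P j) <= M + eps).
  { intros j. specialize (HM _ (Hz j)). specialize (HK0 K (z j) ltac:(lia) (Hz j)).
    fold (P j) in HK0. rewrite Cmod_minus_sym in HK0.
    assert (Hg := Cmod_minus_ge (P j) (f (z j))). lra. }
  assert (E : Csum (fun j => e (- (INR n / INR (S K) * INR j)) * P j)%C 0 K
              = (RtoC (INR (S K)) * (a n * RtoC r ^ n))%C).
  { rewrite (Csum_ext _ (fun j => Csum (fun i => (a i * RtoC r ^ i)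
        * e ((INR i - INR n) / INR (S K) * INR j))%C 0 K)).
    2:{ intros j _. unfold P. rewrite <- Csum_mult_l. apply Csum_ext. intros i _.
        unfold z.
        replace (z0 + RtoC r * e (INR j / INR (S K)) - z0)%C
          with (RtoC r * e (INR j / INR (S K)))%C by ring.
        rewrite Cpow_mult_l, e_pow.
        replace ((INR i - INR n) / INR (S K) * INR j)
          with (- (INR n / INR (S K) * INR j) + INR i * (INR j / INR (S K)))
          by (field; lra).
        rewrite e_plus. ring. }
    rewrite Csum_swap.
    rewrite (Csum_ext _ (fun i => if Nat.eq_dec i n
       then RtoC (INR (S K)) * (a n * RtoC r ^ n) else RtoC 0)%C).
    2:{ intros i Hi. rewrite Csum_mult_l. destruct (Nat.eq_dec i n) as [->|Hne].
        - rewrite (Csum_ext _ (fun _ => RtoC 1)).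
          + rewrite Csum_const. ring.
          + intros j _. rewrite Rminus_diag. unfold Rdiv. rewrite !Rmult_0_l.
            apply (e_IZR 0).
        - rewrite roots_of_unity_sum; [ring|lia|unfold K; lia|exact Hne]. }
    assert (G : forall c L, (n <= L)%nat ->
      Csum (fun i => if Nat.eq_dec i n then c else RtoC 0) 0 L = c).
    { intros c L HL.
      assert (G0 : forall L', (L' < n)%nat ->
        Csum (fun i => if Nat.eq_dec i n then c else RtoC 0) 0 L' = 0).
      { induction L' as [|L' IH]; intros HL'.
        - rewrite Csum_one. destruct (Nat.eq_dec 0 n); [lia|reflexivity].
        - rewrite Csum_S, IH by lia. destruct (Nat.eq_dec (S L') n); [lia|ring]. }
      induction L as [|L IH].
      - rewrite Csum_one. destruct (Nat.eq_dec 0 n); [reflexivity|lia].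
      - rewrite Csum_S by lia. destruct (Nat.eq_dec (S L) n).
        + rewrite G0 by lia. ring.
        + rewrite IH by lia. ring. }
    apply G. unfold K. lia. }
  assert (B : Cmod (RtoC (INR (S K)) * (a n * RtoC r ^ n)) <= INR (S K) * (M + eps)).
  { rewrite <- E.
    eapply Rle_trans; [apply (Cmod_Csum_bound _ (fun _ => M + eps))|].
    - intros j _. rewrite Cmod_mult, Cmod_e, Rmult_1_l. apply HP.
    - rewrite sum_n_m_const. right. f_equal. }
  rewrite !Cmod_mult, Cmod_pow, !Cmod_R, !Rabs_pos_eq in B by lra.
  now apply Rmult_le_reg_l in B.
Qed.

(** A total limit operator: the limit coefficients in [unif_lim_analytic] and the function [Fval]
    can be written down before convergence is known. *)
Definition Clim (s : nat -> C) : C :=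
  (real (Lim_seq (fun n => fst (s n))), real (Lim_seq (fun n => snd (s n)))).

Lemma Clim_correct (s : nat -> C) : (exists l, is_Clim s l) -> is_Clim s (Clim s).
Proof.
  intros [l Hl]. enough (Clim s = l) as -> by exact Hl.
  assert (H : forall g : C -> R, (forall z w : C, Rabs (g z - g w) <= Cmod (z - w)) ->
    real (Lim_seq (fun n => g (s n))) = g l).
  { intros g Hg. rewrite (is_lim_seq_unique _ (g l)); [reflexivity|].
    apply is_lim_seq_ext with (fun n => g l + (g (s n) - g l)); [intros; ring|].
    replace (Finite (g l)) with (Finite (g l + 0)) by (f_equal; ring).
    apply is_lim_seq_plus'; [apply is_lim_seq_const|].
    apply is_lim_seq_abs_0.
    apply is_lim_seq_le_le with (u := fun _ => 0) (w := fun n => Cmod (s n - l)).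
    - intros n. split; [apply Rabs_pos|apply Hg].
    - apply is_lim_seq_const.
    - exact Hl. }
  unfold Clim. rewrite (H fst), (H snd).
  - now destruct l.
  - intros z w. eapply Rle_trans; [|apply Rmax_Cmod]. apply Rmax_r.
  - intros z w. eapply Rle_trans; [|apply Rmax_Cmod]. apply Rmax_l.
Qed.

Lemma lim_seq_0_eps (u : nat -> R) (eps : R) :
  is_lim_seq u 0 -> 0 < eps -> exists N, forall n, (N <= n)%nat -> Rabs (u n) < eps.
Proof.
  intros H He. apply is_lim_seq_Reals in H. destruct (H eps He) as [N HN].
  exists N. intros n Hn. specialize (HN n Hn). unfold R_dist in HN.
  now rewrite Rminus_0_r in HN.
Qed.

(** The Cauchy estimate applied to [f N - f M] bounds the differences of the coefficients times
    [r ^ n] by [eta N + eta M], uniformly in [n]. Hence the coefficients converge, and the weighted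
    error [eta N] is the same for all of them, so it can be summed against a geometric series inside
    the disc. *)
Lemma unif_lim_analytic (f : nat -> C -> C) (g : C -> C) (z0 : C) (r : R)
    (a : nat -> nat -> C) (eta : nat -> R) :
  0 < r ->
  (forall N, unif_pseries (f N) z0 r (a N)) ->
  (forall N M z, Cmod (z - z0) <= r -> Cmod (f N z - f M z) <= eta N + eta M) ->
  is_lim_seq eta 0 ->
  (forall z, Cmod (z - z0) <= r -> is_Clim (fun N => f N z) (g z)) ->
  analytic_at g z0.
Proof.
  intros Hr Hf Hc Heta Hg.
  assert (Hrn : forall n, 0 < r ^ n) by (intros; now apply pow_lt).
  assert (HC : forall n N M, Cmod (a N n - a M n) * r ^ n <= eta N + eta M).
  { intros n N M.
    apply (Cauchy_estimate (fun z => f N z - f M z)%C z0 r _ (fun n => a N n - a M n)%C).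
    - lra.
    - now apply unif_pseries_minus.
    - intros z Hz. now apply Hc. }
  assert (Heps : forall eps, 0 < eps -> exists N0, forall N, (N0 <= N)%nat -> eta N < eps).
  { intros eps He. destruct (lim_seq_0_eps _ _ Heta He) as [N0 HN0].
    exists N0. intros N HN. specialize (HN0 N HN). apply Rabs_lt_between in HN0. lra. }
  set (b := fun n => Clim (fun N => a N n)).
  assert (Hb : forall n, is_Clim (fun N => a N n) (b n)).
  { intros n. apply Clim_correct. apply Cauchy_Clim. intros eps He.
    destruct (Heps (eps * r ^ n / 2)) as [N0 HN0]; [specialize (Hrn n); nra|].
    exists N0. intros N M HN HM. specialize (HC n N M).
    assert (H1 := HN0 N HN). assert (H2 := HN0 M HM).
    apply Rmult_lt_reg_r with (r ^ n); [apply Hrn|]. lra. }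
  assert (HbN : forall n N, Cmod (b n - a N n) * r ^ n <= eta N).
  { intros n N. apply Rle_plus_epsilon. intros eps He.
    destruct (Heps eps He) as [M0 HM0].
    apply Rle_div_r; [apply Rlt_gt, Hrn|].
    apply Cmod_Clim_le with (s := fun M => (a M n - a N n)%C) (N0 := M0).
    - apply is_Clim_minus; [apply Hb|apply is_Clim_const].
    - intros M HM. apply Rle_div_r; [apply Rlt_gt, Hrn|].
      specialize (HC n M N). specialize (HM0 M HM). lra. }
  exists r, b. split; [exact Hr|]. intros z Hz.
  apply is_pseries_Clim. apply is_Clim_eps. intros eps He.
  set (q := Cmod (z - z0) / r).
  assert (Hq : 0 <= q < 1).
  { unfold q. split; [apply Rdiv_le_0_compat; [apply Cmod_ge_0|exact Hr]|].
    apply Rlt_div_l; lra. }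
  (* The coefficient errors [eta N / r ^ n] add up to [eta N / (1 - q)] at [z]; the factor [1 - q]
     compensates for this in [HD2]. *)
  destruct (Heps (eps / 4 * (1 - q))) as [N1 HN1]; [nra|].
  destruct (proj1 (is_Clim_eps _ _) (Hg z ltac:(lra)) (eps / 4) ltac:(lra)) as [N2 HN2].
  set (N := max N1 N2).
  destruct (Hf N (eps / 4) ltac:(lra)) as [K0 HK0].
  exists K0. intros K HK.
  specialize (HN1 N ltac:(lia)). specialize (HN2 N ltac:(lia)). cbv beta in HN2.
  specialize (HK0 K z HK ltac:(lra)).
  set (w := (z - z0)%C) in *.
  assert (HD : Cmod (Csum (fun n => b n * w ^ n)%C 0 K - Csum (fun n => a N n * w ^ n)%C 0 K)
               <= eta N / (1 - q)).
  { rewrite <- Csum_minus.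
    eapply Rle_trans; [apply (Cmod_Csum_bound _ (fun n => eta N * q ^ n))|].
    - intros n _. replace (b n * w ^ n - a N n * w ^ n)%C with ((b n - a N n) * w ^ n)%C by ring.
      rewrite Cmod_mult, Cmod_pow. unfold q, Rdiv.
      rewrite Rpow_mult_distr, pow_inv.
      replace (eta N * (Cmod w ^ n * / r ^ n)) with (eta N / r ^ n * Cmod w ^ n)
        by (field; apply Rgt_not_eq, Hrn).
      apply Rmult_le_compat_r; [apply pow_le, Cmod_ge_0|].
      apply Rle_div_r; [apply Rlt_gt, Hrn|]. apply HbN.
    - rewrite (sum_n_m_mult_l (K := R_Ring) (eta N) (fun i => q ^ i)).
      change (eta N * sum_n_m (fun i => q ^ i) 0 K <= eta N / (1 - q)).
      assert (0 <= eta N).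
      { specialize (HbN 0%nat N). simpl in HbN.
        assert (Hm := Cmod_ge_0 (b 0%nat - a N 0%nat)). lra. }
      apply Rmult_le_compat_l; [assumption|].
      eapply Rle_trans; [apply sum_geom_le; exact Hq|]. simpl. lra. }
  assert (HD2 : eta N / (1 - q) < eps / 4) by (apply Rlt_div_l; lra).
  set (A := Csum (fun n => b n * w ^ n)%C 0 K) in *.
  set (B := Csum (fun n => a N n * w ^ n)%C 0 K) in *.
  replace (A - g z)%C with ((A - B) + ((B - f N z) + (f N z - g z)))%C by ring.
  eapply Rle_lt_trans; [apply Cmod_triangle|].
  assert (T := Cmod_triangle (B - f N z) (f N z - g z)).
  rewrite (Cmod_minus_sym B) in T. lra.
Qed.

(** * Improper integrals of complex exponentials *)

Definition is_improper_RInt (f : R -> C) (l : C) : Prop :=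
  is_RInt_gen (V := C_R_NormedModule) f (at_right 0) (Rbar_locally p_infty) l.

Lemma is_improper_RInt_intro (f : R -> C) (l : C) :
  (forall eps, 0 < eps -> exists d A, 0 < d /\ forall s T, 0 < s < d -> A < T ->
     exists I, is_RInt (V := C_R_NormedModule) f s T I /\ Cmod (I - l) < eps) ->
  is_improper_RInt f l.
Proof.
  intros H. unfold is_improper_RInt, is_RInt_gen.
  apply filterlimi_locally. intros eps.
  destruct (H eps (cond_pos eps)) as [d [A [Hd HI]]].
  apply Filter_prod with (fun s => 0 < s < d) (fun T => A < T).
  - exists (mkposreal d Hd). intros s Hs Hs0. split; [exact Hs0|].
    change (Rabs (s - 0) < d) in Hs. rewrite Rminus_0_r, Rabs_pos_eq in Hs; lra.
  - now exists A.
  - intros s T Hs HT. destruct (HI s T Hs HT) as [I [HI1 HI2]]. exists I.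
    split; [exact HI1|]. now apply C_NormedModule_mixin_compat1.
Qed.

(** Eventually [s < 1 < T]: this orders the endpoints and so resolves the [Rmin] and [Rmax] in
    statements about integrals. *)
Lemma improper_ordered (P : R -> R -> Prop) (A : R) :
  (forall s T, 0 < s < 1 -> Rmax 1 A < T -> P s T) ->
  filter_prod (at_right 0) (Rbar_locally p_infty) (fun ab => P (fst ab) (snd ab)).
Proof.
  intros H. apply Filter_prod with (fun s => 0 < s < 1) (fun T => Rmax 1 A < T).
  - exists (mkposreal 1 Rlt_0_1). intros s Hs Hs0. split; [exact Hs0|].
    change (Rabs (s - 0) < 1) in Hs. rewrite Rminus_0_r, Rabs_pos_eq in Hs; lra.
  - now exists (Rmax 1 A).
  - exact H.
Qed.

(** Integrals here take values in a module over the reals, so a complex factor has to be moved out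
    coordinate by coordinate. *)
Lemma is_RInt_C_scal (f : R -> C) (s T : R) (c l : C) :
  is_RInt (V := C_R_NormedModule) f s T l ->
  is_RInt (V := C_R_NormedModule) (fun t => c * f t)%C s T (c * l)%C.
Proof.
  intros H.
  assert (H1 := is_RInt_fct_extend_fst (U := R_NormedModule) (V := R_NormedModule) f s T l H).
  assert (H2 := is_RInt_fct_extend_snd (U := R_NormedModule) (V := R_NormedModule) f s T l H).
  destruct c as [c1 c2].
  apply (is_RInt_fct_extend_pair (U := R_NormedModule) (V := R_NormedModule)
           (fun t => ((c1, c2) * f t)%C) s T).
  - apply (is_RInt_minus (V := R_NormedModule) (fun t => c1 * fst (f t)) (fun t => c2 * snd (f t)));
      now apply (is_RInt_scal (V := R_NormedModule)).
  - apply (is_RInt_plus (V := R_NormedModule) (fun t => c1 * snd (f t)) (fun t => c2 * fst (f t)));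
      now apply (is_RInt_scal (V := R_NormedModule)).
Qed.

Lemma is_improper_RInt_scal (f : R -> C) (c l : C) :
  is_improper_RInt f l -> is_improper_RInt (fun t => c * f t)%C (c * l)%C.
Proof.
  intros H P HP.
  assert (HP' : locally (T := C_UniformSpace) l (fun z => P (c * z)%C)).
  { destruct HP as [eps HP].
    assert (H2 : 0 < sqrt 2) by (apply sqrt_lt_R0; lra).
    assert (Hc := Cmod_ge_0 c).
    assert (He : 0 < eps / ((Cmod c + 1) * sqrt 2)).
    { apply Rdiv_lt_0_compat; [apply cond_pos|apply Rmult_lt_0_compat; lra]. }
    exists (mkposreal _ He). intros z Hz. apply HP.
    apply C_NormedModule_mixin_compat1.
    apply C_NormedModule_mixin_compat2 in Hz. simpl in Hz.
    replace (sqrt 2 * (eps / ((Cmod c + 1) * sqrt 2))) with (eps / (Cmod c + 1)) in Hz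
      by (field; lra).
    change (Cmod (z - l) < eps / (Cmod c + 1)) in Hz.
    change (Cmod (c * z - c * l) < eps).
    replace (c * z - c * l)%C with (c * (z - l))%C by ring. rewrite Cmod_mult.
    apply Rlt_div_r in Hz; [|lra]. assert (Hm := Cmod_ge_0 (z - l)).
    nra. }
  specialize (H _ HP'). unfold filtermapi in *.
  revert H. apply filter_imp. intros ab [y [Hy1 Hy2]].
  exists (c * y)%C. split; [now apply is_RInt_C_scal|exact Hy2].
Qed.

Lemma is_improper_RInt_plus (f g : R -> C) (l m : C) :
  is_improper_RInt f l -> is_improper_RInt g m ->
  is_improper_RInt (fun t => f t + g t)%C (l + m)%C.
Proof.
  intros Hf Hg. unfold is_improper_RInt in *.
  exact (is_RInt_gen_plus (V := C_R_NormedModule) f g l m Hf Hg).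
Qed.

Lemma is_improper_RInt_ext (f g : R -> C) (l : C) :
  (forall t, 0 < t -> f t = g t) -> is_improper_RInt f l -> is_improper_RInt g l.
Proof.
  intros H Hf. unfold is_improper_RInt in *.
  refine (is_RInt_gen_ext (V := C_R_NormedModule) f g l _ Hf).
  apply (improper_ordered (fun s T => forall x, Rmin s T < x < Rmax s T -> f x = g x) 1).
  intros s T Hs HT x Hx. apply H. assert (1 <= Rmax 1 1) by apply Rmax_l.
  rewrite Rmin_left in Hx by lra. lra.
Qed.

Lemma is_improper_RInt_Csum (f : nat -> R -> C) (l : nat -> C) (m n : nat) :
  (m <= n)%nat ->
  (forall i, (m <= i <= n)%nat -> is_improper_RInt (f i) (l i)) ->
  is_improper_RInt (fun t => Csum (fun i => f i t) m n) (Csum l m n).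
Proof.
  intros Hmn H. induction n as [|n IH].
  - replace m with 0%nat in * by lia. rewrite Csum_one.
    apply is_improper_RInt_ext with (f 0%nat); [|apply H; lia].
    intros t _. now rewrite Csum_one.
  - destruct (Nat.eq_dec m (S n)) as [->|Hne].
    + rewrite Csum_one. apply is_improper_RInt_ext with (f (S n)); [|apply H; lia].
      intros t _. now rewrite Csum_one.
    + rewrite Csum_S by lia.
      apply is_improper_RInt_ext with (fun t => Csum (fun i => f i t) m n + f (S n) t)%C.
      * intros t _. now rewrite Csum_S by lia.
      * apply is_improper_RInt_plus; [|apply H; lia].
        apply IH; [lia|]. intros i Hi. apply H. lia.
Qed.

(** * Bounds for [Cexp] near 1, and its improper integral *)

Lemma Rabs_sin_le (y : R) : Rabs (sin y) <= Rabs y.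
Proof.
  assert (P : forall y, 0 <= y -> Rabs (sin y) <= y).
  { intros z Hz. destruct (Rle_or_lt 1 z) as [H|H].
    - assert (B := SIN_bound z). apply Rabs_le. lra.
    - destruct (Req_dec z 0) as [->|Hne]; [rewrite sin_0, Rabs_R0; lra|].
      assert (B := sin_lt_x z ltac:(lra)).
      assert (0 <= sin z) by (apply sin_ge_0; assert (HPI := PI2_1); lra).
      rewrite Rabs_pos_eq; lra. }
  destruct (Rle_or_lt 0 y) as [H|H].
  - rewrite (Rabs_pos_eq y) by lra. now apply P.
  - rewrite (Rabs_left y) by lra. rewrite <- Rabs_Ropp, <- sin_neg. apply P. lra.
Qed.

(** From 1 - exp(i b) = -2 i sin(b/2) exp(i b/2). *)
Lemma Cmod_1_minus_cis (b : R) : Cmod (1 - (cos b, sin b)) <= Rabs b.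
Proof.
  assert (H := Rabs_sin_le (b / 2)).
  replace (Rabs b) with (2 * Rabs (b / 2)).
  2:{ unfold Rdiv. rewrite Rabs_mult, (Rabs_pos_eq (/ 2)) by lra. field. }
  replace (1 - (cos b, sin b))%C
    with (RtoC (2 * sin (b / 2)) * (- (Ci * (cos (b / 2), sin (b / 2)))))%C.
  - rewrite Cmod_mult, Cmod_opp, Cmod_mult, Cmod_Ci, Cmod_cos_sin, Cmod_R, Rabs_mult.
    rewrite (Rabs_pos_eq 2) by lra. lra.
  - replace b with (2 * (b / 2)) at 4 5 by field.
    rewrite cos_2a_sin, sin_2a. apply injective_projections; simpl; ring.
Qed.

Lemma exp_le (a b : R) : a <= b -> exp a <= exp b.
Proof. intros [H | ->]; [left; now apply exp_increasing|right; reflexivity]. Qed.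

Lemma exp_neg_ge (a : R) : 1 - exp (- a) <= a.
Proof. assert (H := exp_ineq1_le (- a)). lra. Qed.

Lemma Cexp_neg_near_1 (y : C) :
  0 <= Re y -> Cmod (1 - Cexp (- y)) <= Re y + Rabs (Im y).
Proof.
  intros Hy. destruct y as [a b]. unfold Re, Im in *. simpl in *.
  unfold Cexp. simpl. rewrite cos_neg, sin_neg.
  assert (He : exp (- a) <= 1) by (rewrite <- exp_0; apply exp_le; lra).
  assert (He0 := exp_pos (- a)).
  replace (1 - RtoC (exp (- a)) * (cos b, Ropp (sin b)))%C
    with (RtoC (1 - exp (- a)) + RtoC (exp (- a)) * (1 - (cos (Ropp b), sin (Ropp b))))%C.
  2:{ rewrite cos_neg, sin_neg. apply injective_projections; simpl; ring. }
  eapply Rle_trans; [apply Cmod_triangle|].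
  rewrite Cmod_mult, !Cmod_R, !Rabs_pos_eq by lra.
  apply Rplus_le_compat; [apply exp_neg_ge|].
  assert (H := Cmod_1_minus_cis (- b)). rewrite Rabs_Ropp in H.
  assert (H0 := Cmod_ge_0 (1 - (cos (Ropp b), sin (Ropp b)))). nra.
Qed.

Lemma Im_le_Cmod (c : C) : Rabs (Im c) <= Cmod c.
Proof. eapply Rle_trans; [|apply Rmax_Cmod]. apply Rmax_r. Qed.

Lemma Cexp_neg_near_1' (y : C) :
  0 <= Re y -> Cmod (1 - Cexp (- y)) <= 2 * Cmod y.
Proof.
  intros Hy. eapply Rle_trans; [now apply Cexp_neg_near_1|].
  assert (H1 := re_le_Cmod y). assert (H2 := Im_le_Cmod y).
  rewrite Rabs_pos_eq in H1 by exact Hy. lra.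
Qed.

Lemma Re_mult_R (X : C) (t : R) : Re (X * RtoC t) = Re X * t.
Proof. destruct X. unfold Re. simpl. ring. Qed.

Lemma Cmod_Cexp_neg_mult (X : C) (t : R) : Cmod (Cexp (- (X * RtoC t))) = exp (- (Re X * t)).
Proof.
  rewrite Cmod_Cexp. f_equal. rewrite <- Re_mult_R. destruct (X * RtoC t)%C. reflexivity.
Qed.

(** For small [t] the damped point is still near [u], which is away from 1; for larger [t] its
    modulus is bounded by some number below 1. Both bounds depend on [X] only through [a] and
    [B]. *)
Lemma one_minus_Cexp_lower (u : C) (a B : R) :
  Cmod u = 1 -> u <> 1 -> 0 < a -> 0 < B ->
  exists c, 0 < c /\ forall X t, a <= Re X -> Cmod X <= B -> 0 < t ->
    c <= Cmod (1 - Cexp (- (X * RtoC t)) * u).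
Proof.
  intros Hu Hu1 Ha HB.
  set (d := Cmod (1 - u)).
  assert (Hd : 0 < d).
  { apply Cmod_gt_0. intros E. apply Hu1. replace u with (1 - (1 - u))%C by ring.
    rewrite E. ring. }
  (* Up to time [t0] the factor [Cexp (- (X * RtoC t))] differs from 1 by at most
     [2 * B * t0 = d / 2], leaving half of the distance [d]. *)
  set (t0 := d / (4 * B)).
  assert (Ht0 : 0 < t0) by (apply Rdiv_lt_0_compat; lra).
  assert (He : exp (- (a * t0)) < 1).
  { rewrite <- exp_0. apply exp_increasing. nra. }
  exists (Rmin (d / 2) (1 - exp (- (a * t0)))). split; [apply Rmin_glb_lt; lra|].
  intros X t HX HXB Ht. destruct (Rle_or_lt t t0) as [Htt|Htt].
  - eapply Rle_trans; [apply Rmin_l|].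
    replace (1 - Cexp (- (X * RtoC t)) * u)%C
      with ((1 - u) - (- (1 - Cexp (- (X * RtoC t))) * u))%C by ring.
    eapply Rle_trans; [|apply Cmod_minus_ge]. fold d.
    rewrite Cmod_mult, Cmod_opp, Hu, Rmult_1_r.
    assert (N := Cexp_neg_near_1' (X * RtoC t) ltac:(rewrite Re_mult_R; nra)).
    rewrite Cmod_mult, Cmod_R, Rabs_pos_eq in N by lra.
    assert (Cmod X * t <= B * t0) by (apply Rmult_le_compat; try lra; apply Cmod_ge_0).
    assert (B * t0 = d / 4) by (unfold t0; field; lra). lra.
  - eapply Rle_trans; [apply Rmin_r|].
    eapply Rle_trans; [|apply Cmod_minus_ge].
    rewrite Cmod_1, Cmod_mult, Hu, Rmult_1_r, Cmod_Cexp_neg_mult.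
    apply Rplus_le_compat_l, Ropp_le_contravar, exp_le. nra.
Qed.

Lemma is_RInt_Cexp (lam : C) (s T : R) :
  lam <> 0 ->
  is_RInt (V := C_R_NormedModule) (fun t => Cexp (- (lam * RtoC t))) s T
    ((Cexp (- (lam * RtoC s)) - Cexp (- (lam * RtoC T))) / lam)%C.
Proof.
  intros Hl. destruct lam as [a b].
  assert (Hn : a ^ 2 + b ^ 2 <> 0).
  { intros E. apply Hl. assert (a = 0) by nra. assert (b = 0) by nra. now subst. }
  assert (HC : forall t, Cexp (- ((a, b) * RtoC t))
     = (exp (- (a * t)) * cos (b * t), - (exp (- (a * t)) * sin (b * t)))).
  { intros t. unfold Cexp, Re, Im. simpl.
    replace (- (a * t - b * 0)) with (- (a * t)) by ring.
    replace (- (a * 0 + b * t)) with (- (b * t)) by ring.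
    rewrite cos_neg, sin_neg. apply injective_projections; simpl; ring. }
  rewrite !HC.
  (* [F1] and [F2] are the real and imaginary parts of the antiderivative
     [- Cexp (- (lam * RtoC t)) / lam]. *)
  set (F1 := fun t => exp (- (a * t)) * (- a * cos (b * t) + b * sin (b * t)) / (a ^ 2 + b ^ 2)).
  set (F2 := fun t => exp (- (a * t)) * (a * sin (b * t) + b * cos (b * t)) / (a ^ 2 + b ^ 2)).
  match goal with |- is_RInt _ _ _ ?v =>
    replace v with ((F1 T - F1 s, F2 T - F2 s)) end.
  2:{ unfold F1, F2. apply injective_projections; unfold Cdiv; simpl; field;
      simpl in Hn; lra. }
  apply is_RInt_ext with
    (fun t => (exp (- (a * t)) * cos (b * t), - (exp (- (a * t)) * sin (b * t)))).
  { intros t _. now rewrite HC. }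
  apply (is_RInt_fct_extend_pair (U := R_NormedModule) (V := R_NormedModule)); simpl.
  - apply (is_RInt_derive (V := R_CompleteNormedModule) F1).
    + intros t _. unfold F1. auto_derive; [trivial|]. field. simpl in Hn; lra.
    + intros t _. apply (ex_derive_continuous (V := R_NormedModule)).
      auto_derive; trivial.
  - apply (is_RInt_derive (V := R_CompleteNormedModule) F2).
    + intros t _. unfold F2. auto_derive; [trivial|]. field. simpl in Hn; lra.
    + intros t _. apply (ex_derive_continuous (V := R_NormedModule)).
      auto_derive; trivial.
Qed.

Lemma is_improper_RInt_Cexp (lam : C) :
  0 < Re lam -> is_improper_RInt (fun t => Cexp (- (lam * RtoC t))) (/ lam)%C.
Proof.
  intros Hl.
  assert (Hl0 : lam <> 0) by (intros ->; simpl in Hl; lra).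
  assert (Hm : 0 < Cmod lam) by now apply Cmod_gt_0.
  apply is_improper_RInt_intro. intros eps He.
  (* Each endpoint contributes less than [eps * Cmod lam / 2] before the division by [lam]: the
     lower one by [Cexp_neg_near_1'], the upper one because exp y >= 1 + y. *)
  exists (eps / 4), (2 / (eps * Cmod lam) / Re lam). split; [lra|].
  intros s T Hs HT. eexists. split; [apply is_RInt_Cexp; exact Hl0|].
  match goal with |- Cmod ?v < _ =>
    replace v with (- ((1 - Cexp (- (lam * RtoC s))) + Cexp (- (lam * RtoC T))) / lam)%C
      by (field; exact Hl0) end.
  rewrite Cmod_div, Cmod_opp by exact Hl0.
  apply Rlt_div_l; [exact Hm|].
  eapply Rle_lt_trans; [apply Cmod_triangle|].
  assert (N := Cexp_neg_near_1' (lam * RtoC s) ltac:(rewrite Re_mult_R; nra)).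
  rewrite Cmod_mult, Cmod_R, Rabs_pos_eq in N by lra.
  rewrite Cmod_Cexp_neg_mult.
  assert (HA : 0 < 2 / (eps * Cmod lam)) by (apply Rdiv_lt_0_compat; nra).
  apply Rlt_div_l in HT; [|exact Hl].
  assert (HE : exp (- (Re lam * T)) < eps * Cmod lam / 2).
  { rewrite exp_Ropp.
    replace (eps * Cmod lam / 2) with (/ (2 / (eps * Cmod lam))) by (field; nra).
    apply Rinv_lt_contravar.
    - apply Rmult_lt_0_compat; [exact HA|apply exp_pos].
    - assert (I := exp_ineq1_le (Re lam * T)). lra. }
  nra.
Qed.

(** The common majorant of all truncation errors. It is the derivative of -2 / (1 + sqrt t), so its
    integral over any interval is at most 2; its singularity at 0 is what allows small constants in
    [exp_le_sqrt_weight]. *)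
Definition sqrt_weight (t : R) : R := / (sqrt t * (1 + sqrt t) ^ 2).

Lemma sqrt_weight_pos (t : R) : 0 < t -> 0 < sqrt_weight t.
Proof.
  intros Ht. assert (H := sqrt_lt_R0 t Ht). apply Rinv_0_lt_compat.
  apply Rmult_lt_0_compat; [exact H|]. apply pow_lt. lra.
Qed.

(** Put Y = sqrt (m t). Then exp (a Y^2) >= 1 + a^2 Y^4 / 4, while m >= 1 gives sqrt t <= Y and so Y
    (1 + sqrt t)^2 <= 4 (1 + Y^4). The constant [K] is chosen so that 4 (1 + Y^4) <= K (1 + a^2 Y^4
    / 4). *)
Lemma exp_le_sqrt_weight (a : R) :
  0 < a -> exists K, 0 < K /\ forall m t, 1 <= m -> 0 < t ->
    exp (- (a * m * t)) <= K / sqrt m * sqrt_weight t.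
Proof.
  intros Ha. set (K := 4 * (1 + 4 / a ^ 2)).
  assert (Ha2 : 0 < a ^ 2) by (apply pow_lt; exact Ha).
  assert (H4 : 0 < 4 / a ^ 2) by (apply Rdiv_lt_0_compat; lra).
  exists K. split; [unfold K; lra|]. intros m t Hm Ht.
  assert (Hsm : 1 <= sqrt m) by (rewrite <- sqrt_1; apply sqrt_le_1; lra).
  assert (Hst := sqrt_lt_R0 t Ht).
  assert (Em : sqrt m * sqrt m = m) by (apply sqrt_sqrt; lra).
  assert (Et : sqrt t * sqrt t = t) by (apply sqrt_sqrt; lra).
  unfold sqrt_weight. set (p := sqrt m) in *. set (q := sqrt t) in *.
  set (Y := p * q).
  assert (HY : q <= Y) by (unfold Y; nra).
  assert (EY : m * t = Y * Y) by (rewrite <- Em, <- Et; unfold Y; ring).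
  assert (Hexp : 1 + a ^ 2 * Y ^ 4 / 4 <= exp (a * m * t)).
  { replace (a * m * t) with (a * Y * Y / 2 + a * Y * Y / 2) by (rewrite (Rmult_assoc a m t), EY; field).
    rewrite exp_plus. assert (I := exp_ineq1_le (a * Y * Y / 2)).
    set (x := a * Y * Y / 2) in *.
    replace (a ^ 2 * Y ^ 4 / 4) with (x * x) by (unfold x; field).
    assert (0 <= x) by (unfold x; assert (0 <= a * Y * Y) by (apply Rmult_le_pos; [apply Rmult_le_pos|]; lra); lra).
    nra. }
  assert (Hpos : 0 < Y ^ 4) by (apply pow_lt; lra).
  rewrite exp_Ropp.
  replace (K / p * / (q * (1 + q) ^ 2)) with (K * / (Y * (1 + q) ^ 2))
    by (unfold Y; field; split; lra).
  assert (Hden : 0 < Y * (1 + q) ^ 2) by (apply Rmult_lt_0_compat; [lra|apply pow_lt; lra]).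
  apply Rle_div_r; [exact Hden|].
  rewrite Rmult_comm. apply Rle_div_l; [apply exp_pos|].
  assert (H1 : Y * (1 + q) ^ 2 <= 4 * (1 + Y ^ 4)).
  { apply Rle_trans with (Y * (1 + Y) ^ 2).
    - apply Rmult_le_compat_l; [lra|]. apply pow_incr. lra.
    - assert (Y <= 1 \/ 1 <= Y) as [H|H] by lra.
      + assert ((1 + Y) ^ 2 <= 4) by nra. nra.
      + assert ((1 + Y) ^ 2 <= 4 * Y ^ 2) by nra.
        assert (Y ^ 3 <= Y ^ 4) by (apply Rle_pow; [lra|lia]). nra. }
  assert (H2 : 4 * (1 + Y ^ 4) <= K * (1 + a ^ 2 * Y ^ 4 / 4)).
  { unfold K.
    replace (4 * (1 + 4 / a ^ 2) * (1 + a ^ 2 * Y ^ 4 / 4))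
      with (4 * (1 + Y ^ 4) + 16 / a ^ 2 + a ^ 2 * Y ^ 4) by (field; lra).
    assert (0 < 16 / a ^ 2) by (apply Rdiv_lt_0_compat; lra). nra. }
  assert (HK : 0 < K) by (unfold K; lra).
  eapply Rle_trans; [exact H1|]. eapply Rle_trans; [exact H2|].
  apply Rmult_le_compat_l; lra.
Qed.

Lemma RInt_sqrt_weight (s T : R) :
  0 < s <= T -> exists v, is_RInt sqrt_weight s T v /\ v <= 2.
Proof.
  intros Hs. exists (- 2 / (1 + sqrt T) - - 2 / (1 + sqrt s)). split.
  - apply (is_RInt_derive (V := R_CompleteNormedModule) (fun t => - 2 / (1 + sqrt t))).
    + intros t Ht. rewrite Rmin_left in Ht by lra.
      assert (H := sqrt_lt_R0 t ltac:(lra)).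
      unfold sqrt_weight. auto_derive; [split; lra|]. field. lra.
    + intros t Ht. rewrite Rmin_left in Ht by lra.
      assert (H := sqrt_lt_R0 t ltac:(lra)).
      apply (ex_derive_continuous (V := R_NormedModule)). unfold sqrt_weight.
      auto_derive. repeat split; try lra.
      apply Rgt_not_eq, Rmult_lt_0_compat; nra.
  - assert (HT := sqrt_lt_R0 T ltac:(lra)). assert (H := sqrt_lt_R0 s ltac:(lra)).
    assert (0 < 2 / (1 + sqrt T)) by (apply Rdiv_lt_0_compat; lra).
    assert (2 / (1 + sqrt s) <= 2) by (apply Rle_div_l; nra).
    unfold Rdiv in *. lra.
Qed.

Lemma RInt_weight_bound (f : R -> C) (I : C) (s T c : R) :
  0 < s <= T -> 0 <= c -> is_RInt (V := C_R_NormedModule) f s T I ->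
  (forall t, 0 < t -> Cmod (f t) <= c * sqrt_weight t) ->
  Cmod I <= 2 * c.
Proof.
  intros Hs Hc HI Hf. destruct (RInt_sqrt_weight s T Hs) as [v [Hv Hv2]].
  apply Rle_trans with (c * v); [|nra].
  rewrite Cmod_norm.
  apply (norm_RInt_le (V := C_R_NormedModule) f (fun t => c * sqrt_weight t) s T); [lra| |exact HI|].
  - intros t Ht. assert (N := Cmod_norm (f t)).
    change (@norm R_AbsRing C_R_NormedModule (f t) <= c * sqrt_weight t).
    apply Rle_trans with (Cmod (f t)); [right; symmetry; exact N|]. apply Hf. lra.
  - now apply (is_RInt_scal (V := R_NormedModule)).
Qed.

Lemma is_improper_RInt_elim (f : R -> C) (l : C) (eps A : R) :
  is_improper_RInt f l -> 0 < eps ->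
  exists s T I, 0 < s < 1 /\ Rmax 1 A < T /\
    is_RInt (V := C_R_NormedModule) f s T I /\ Cmod (I - l) < eps.
Proof.
  intros H He.
  assert (H2 : 0 < sqrt 2) by (apply sqrt_lt_R0; lra).
  assert (He2 : 0 < eps / sqrt 2) by (apply Rdiv_lt_0_compat; lra).
  assert (H' := proj1 (filterlimi_locally (U := C_R_NormedModule) _ _) H (mkposreal _ He2)).
  assert (HO := improper_ordered (fun s T => 0 < s < 1 /\ Rmax 1 A < T) A
    (fun s T a b => conj a b)).
  destruct (filter_ex _ (filter_and _ _ H' HO)) as [[s T] [[I [HI HB]] [Hs HT]]].
  simpl in *. exists s, T, I. repeat split; try lra; [exact HI|].
  assert (HC := C_NormedModule_mixin_compat2 l I (mkposreal _ He2) HB).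
  change (Cmod (I - l) < sqrt 2 * (eps / sqrt 2)) in HC.
  replace (sqrt 2 * (eps / sqrt 2)) with eps in HC by (field; lra). exact HC.
Qed.

Lemma improper_weight_bound (f : R -> C) (l : C) (c : R) :
  0 <= c -> is_improper_RInt f l ->
  (forall t, 0 < t -> Cmod (f t) <= c * sqrt_weight t) ->
  Cmod l <= 2 * c.
Proof.
  intros Hc H Hf. apply Rle_plus_epsilon. intros eps He.
  destruct (is_improper_RInt_elim f l eps 1 H He) as [s [T [I [Hs [HT [HI HB]]]]]].
  assert (1 <= Rmax 1 1) by apply Rmax_l.
  assert (B := RInt_weight_bound f I s T c ltac:(lra) Hc HI Hf).
  rewrite Cmod_minus_sym in HB.
  assert (G := Cmod_minus_ge l I). lra.
Qed.

Lemma is_improper_RInt_minus (f g : R -> C) (l m : C) :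
  is_improper_RInt f l -> is_improper_RInt g m ->
  is_improper_RInt (fun t => f t - g t)%C (l - m)%C.
Proof.
  intros Hf Hg. unfold is_improper_RInt in *.
  exact (is_RInt_gen_minus (V := C_R_NormedModule) f g l m Hf Hg).
Qed.

(** On [s, T] the weight is bounded, so the convergence is uniform there. [filterlim_RInt] asks for
    uniformity on the whole line, so all functions are first set to 0 outside [s, T] by [cut]. *)
Lemma RInt_uniform_limit (D : nat -> R -> C) (J : R -> C) (eps : nat -> R) (s T : R) :
  0 < s <= T ->
  (forall N, exists I, is_RInt (V := C_R_NormedModule) (D N) s T I) ->
  (forall N t, 0 < t -> Cmod (J t - D N t) <= eps N * sqrt_weight t) ->
  is_lim_seq eps 0 ->
  exists I, is_RInt (V := C_R_NormedModule) J s T I.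
Proof.
  intros Hs HD HJ Heps.
  set (cut := fun (f : R -> C) t => if Rle_dec s t then if Rle_dec t T then f t else RtoC 0 else RtoC 0).
  assert (Hcut : forall f t, Rmin s T < t < Rmax s T -> f t = cut f t).
  { intros f t Ht. rewrite Rmin_left, Rmax_right in Ht by lra. unfold cut.
    destruct (Rle_dec s t); [|lra]. destruct (Rle_dec t T); [reflexivity|lra]. }
  assert (HW : exists W, 0 < W /\ forall t, s <= t <= T -> sqrt_weight t <= W).
  { exists (sqrt_weight s). split; [apply sqrt_weight_pos; lra|].
    intros t Ht. unfold sqrt_weight.
    assert (H := sqrt_lt_R0 s ltac:(lra)).
    assert (Hl : sqrt s <= sqrt t) by (apply sqrt_le_1; lra).
    apply Rinv_le_contravar.
    - apply Rmult_lt_0_compat; [lra|apply pow_lt; lra].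
    - apply Rmult_le_compat; [lra|apply pow_le; lra|lra|]. apply pow_incr. lra. }
  destruct HW as [W [HW0 HW]].
  assert (Hint : forall N, exists I, is_RInt (V := C_R_NormedModule) (cut (D N)) s T I).
  { intros N. destruct (HD N) as [I HI]. exists I.
    apply (is_RInt_ext (V := C_R_NormedModule) (D N)); [|exact HI].
    intros t Ht. now apply Hcut. }
  destruct (filterlim_RInt (V := C_R_CompleteNormedModule)
    (fun N => cut (D N)) s T eventually _ (cut J)
    (fun N => RInt (V := C_R_CompleteNormedModule) (cut (D N)) s T)) as [I [_ HI]].
  - intros N. apply (RInt_correct (V := C_R_CompleteNormedModule)).
    destruct (Hint N) as [I HI]. now exists I.
  - apply filterlim_locally. intros e1.
    destruct (lim_seq_0_eps eps (e1 / W) Heps) as [N0 HN0].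
    { apply Rdiv_lt_0_compat; [apply cond_pos|exact HW0]. }
    exists N0. intros N HN t. specialize (HN0 N HN).
    apply C_NormedModule_mixin_compat1.
    change (Cmod (cut (D N) t - cut J t) < e1).
    unfold cut. destruct (Rle_dec s t) as [H1|H1]; [destruct (Rle_dec t T) as [H2|H2]|];
      try (replace (0 - 0)%C with (RtoC 0) by ring; rewrite Cmod_0; apply cond_pos).
    rewrite Cmod_minus_sym. eapply Rle_lt_trans; [apply HJ; lra|].
    apply Rle_lt_trans with (Rabs (eps N) * W).
    + apply Rmult_le_compat; [|left; apply sqrt_weight_pos; lra|apply Rle_abs|apply HW; lra].
      assert (B := HJ N t ltac:(lra)). assert (M := Cmod_ge_0 (J t - D N t)).
      assert (P := sqrt_weight_pos t ltac:(lra)). nra.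
    + apply Rlt_div_r in HN0; [exact HN0|exact HW0].
  - exists I. apply (is_RInt_ext (V := C_R_NormedModule) (cut J)); [|exact HI].
    intros t Ht. symmetry. now apply Hcut.
Qed.

(** This plays the part of dominated convergence: the error is [eps N] times a weight of total
    integral at most 2, so the integrals [S N] form a Cauchy sequence, and on every interval the
    integral of [J] stays within [2 * eps N] of that of [D N]. *)
Lemma improper_limit (D : nat -> R -> C) (S : nat -> C) (J : R -> C) (eps : nat -> R) :
  (forall N, is_improper_RInt (D N) (S N)) ->
  (forall N t, 0 < t -> Cmod (J t - D N t) <= eps N * sqrt_weight t) ->
  is_lim_seq eps 0 ->
  exists L, is_improper_RInt J L /\ forall N, Cmod (S N - L) <= 2 * eps N.
Proof.
  intros HD HJ Heps.
  assert (Hpos : forall N, 0 <= eps N).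
  { intros N. assert (B := HJ N 1 Rlt_0_1). assert (M := Cmod_ge_0 (J 1 - D N 1)).
    assert (P := sqrt_weight_pos 1 Rlt_0_1). nra. }
  assert (HSS : forall N M, Cmod (S N - S M) <= 2 * (eps N + eps M)).
  { intros N M. apply (improper_weight_bound (fun t => D N t - D M t)%C).
    - specialize (Hpos N) as H1. specialize (Hpos M). lra.
    - now apply is_improper_RInt_minus.
    - intros t Ht. replace (D N t - D M t)%C with ((J t - D M t) - (J t - D N t))%C by ring.
      eapply Rle_trans; [apply Cmod_minus_le|].
      specialize (HJ N t Ht) as H1. specialize (HJ M t Ht). lra. }
  assert (Hev : forall e1, 0 < e1 -> exists N0, forall N, (N0 <= N)%nat -> eps N < e1).
  { intros e1 He. destruct (lim_seq_0_eps _ _ Heps He) as [N0 HN0].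
    exists N0. intros N HN. specialize (HN0 N HN). apply Rabs_lt_between in HN0. lra. }
  destruct (Cauchy_Clim S) as [L HL].
  { intros e1 He. destruct (Hev (e1 / 4) ltac:(lra)) as [N0 HN0].
    exists N0. intros n m Hn Hm. specialize (HSS n m).
    assert (A := HN0 n Hn). assert (B := HN0 m Hm). lra. }
  assert (HSL : forall N, Cmod (S N - L) <= 2 * eps N).
  { intros N. apply Rle_plus_epsilon. intros e1 He.
    destruct (Hev (e1 / 2) ltac:(lra)) as [N0 HN0].
    apply Cmod_Clim_le with (s := fun M => (S N - S M)%C) (N0 := N0).
    - apply is_Clim_minus; [apply is_Clim_const|exact HL].
    - intros M HM. specialize (HSS N M). specialize (HN0 M HM). lra. }
  exists L. split; [|exact HSL].
  unfold is_improper_RInt, is_RInt_gen. apply filterlimi_locally. intros e1.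
  (* One fixed [N] suffices: [I - z] and [S N - L] are bounded by [2 * eps N < e1 / 4], and
     [z - S N] by [e1 / 4] for suitable endpoints. *)
  destruct (Hev (e1 / 8)) as [N HN]; [assert (Q := cond_pos e1); lra|].
  specialize (HN N (le_n _)).
  assert (H2 : 0 < sqrt 2) by (apply sqrt_lt_R0; lra).
  assert (He2 : 0 < e1 / 4 / sqrt 2).
  { apply Rdiv_lt_0_compat; [|lra]. assert (Q := cond_pos e1). lra. }
  assert (H' := proj1 (filterlimi_locally (U := C_R_NormedModule) _ _) (HD N) (mkposreal _ He2)).
  assert (HI : filter_prod (at_right 0) (Rbar_locally p_infty)
     (fun ab => (exists I, is_RInt (V := C_R_NormedModule) J (fst ab) (snd ab) I)
                /\ 0 < fst ab <= snd ab)).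
  { assert (HO : forall N, filter_prod (at_right 0) (Rbar_locally p_infty)
       (fun ab => forall M, M = N -> exists I, is_RInt (V := C_R_NormedModule) (D M) (fst ab) (snd ab) I)).
    { intros M. specialize (HD M).
      assert (H'' := proj1 (filterlimi_locally (U := C_R_NormedModule) _ _) HD (mkposreal _ He2)).
      revert H''. apply filter_imp. intros ab [z [Hz _]] M' ->. now exists z. }
    (* How small [s] and how large [T] must be depends on [M], whereas [RInt_uniform_limit] needs
       every [D M] on the same interval. So integrability is taken on a larger interval [s', T'] and
       restricted by Chasles. *)
    assert (HD' : forall M s T, 0 < s <= T -> exists I, is_RInt (V := C_R_NormedModule) (D M) s T I).
    { intros M s T Hs. 
      destruct (HO M) as [Q R HQ HR HQR].
      assert (HQ' := HQ). assert (HR' := HR).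
      destruct HQ' as [d Hd]. destruct HR' as [A HA].
      set (s' := Rmin (d / 2) s). set (T' := Rmax (A + 1) T).
      assert (Hd0 := cond_pos d).
      assert (Hs' : 0 < s' <= s) by (unfold s'; split; [apply Rmin_glb_lt; lra|apply Rmin_r]).
      assert (Hs'' : s' <= d / 2) by apply Rmin_l.
      assert (HT' : T <= T') by apply Rmax_r.
      assert (HT'' : A + 1 <= T') by apply Rmax_l.
      destruct (HQR s' T' ltac:(apply Hd; [change (Rabs (s' - 0) < d); rewrite Rminus_0_r, Rabs_pos_eq; lra|lra])
                 ltac:(apply HA; lra) M eq_refl) as [I HI]. simpl in HI.
      assert (E : ex_RInt (V := C_R_CompleteNormedModule) (D M) s' T') by (now exists I).
      assert (E2 : ex_RInt (V := C_R_CompleteNormedModule) (D M) s' T).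
      { apply (ex_RInt_Chasles_1 (V := C_R_CompleteNormedModule)) with (c := T'); [lra|exact E]. }
      apply (ex_RInt_Chasles_2 (V := C_R_CompleteNormedModule)) with (b := s) in E2; [|lra].
      destruct E2 as [I2 HI2]. now exists I2. }
    apply (improper_ordered (fun s T => (exists I, is_RInt (V := C_R_NormedModule) J s T I) /\ 0 < s <= T) 1).
    intros s T Hs HT. assert (1 <= Rmax 1 1) by apply Rmax_l.
    split; [|lra]. apply (RInt_uniform_limit D J eps); try assumption; [lra|].
    intros M. apply HD'. lra. }
  generalize (filter_and _ _ H' HI). apply filter_imp.
  intros [s T] [[z [Hz1 Hz2]] [[I HI1] Hs]]. simpl in *.
  exists I. split; [exact HI1|]. apply C_NormedModule_mixin_compat1.
  change (Cmod (I - L) < e1).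
  assert (Hz3 := C_NormedModule_mixin_compat2 (S N) z (mkposreal _ He2) Hz2).
  change (Cmod (z - S N) < sqrt 2 * (e1 / 4 / sqrt 2)) in Hz3.
  replace (sqrt 2 * (e1 / 4 / sqrt 2)) with (e1 / 4) in Hz3 by (field; lra).
  assert (B : Cmod (I - z) <= 2 * eps N).
  { apply (RInt_weight_bound (fun t => J t - D N t)%C _ s T); [exact Hs|apply Hpos| |apply HJ].
    now apply (is_RInt_minus (V := C_R_NormedModule)). }
  specialize (HSL N).
  replace (I - L)%C with ((I - z) + ((z - S N) + (S N - L)))%C by ring.
  eapply Rle_lt_trans; [apply Cmod_triangle|].
  assert (T2 := Cmod_triangle (z - S N) (S N - L)).
  assert (Q := cond_pos e1). lra.
Qed.

(** * Uniform estimates for truncated polylogarithms *)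

Definition LiN (s : nat) (z : C) (N : nat) : C :=
  Csum (fun p => z ^ p / RtoC (INR p) ^ s)%C 1 N.

Lemma LiN_partial (s : nat) (z : C) (N : nat) :
  Csum (fun n => z ^ S n / RtoC (INR (S n)) ^ s)%C 0 N = LiN s z (S N).
Proof. unfold LiN. now rewrite <- Csum_shift. Qed.

Lemma is_Clim_LiN (s : nat) (z : C) (l : C) :
  is_Clim (Csum (fun n => z ^ S n / RtoC (INR (S n)) ^ s)%C 0) l <->
  is_Clim (LiN s z) l.
Proof.
  rewrite (is_Clim_incr (LiN s z)).
  split; apply is_Clim_ext; intros n; [|symmetry]; apply LiN_partial.
Qed.

Lemma INR_S_pos (p : nat) : 0 < INR (S p).
Proof. apply lt_0_INR. lia. Qed.

Lemma RtoC_INR_S_neq_0 (p : nat) : RtoC (INR (S p)) <> 0.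
Proof. intros E. apply RtoC_inj in E. assert (H := INR_S_pos p). lra. Qed.

Lemma Cdiv_1 (z : C) : (z / 1 = z)%C.
Proof. unfold Cdiv. rewrite <- (Cmult_1_r z) at 2. f_equal. apply injective_projections; simpl; field. Qed.

Lemma Cmod_LiN_term (s : nat) (z : C) (p : nat) :
  (1 <= p)%nat -> Cmod (z ^ p / RtoC (INR p) ^ s) = Cmod z ^ p / INR p ^ s.
Proof.
  intros Hp. destruct p as [|p]; [lia|]. assert (H := INR_S_pos p).
  rewrite Cmod_div by (apply Cpow_nz, RtoC_INR_S_neq_0).
  rewrite !Cmod_pow, Cmod_R, Rabs_pos_eq by lra. reflexivity.
Qed.

Lemma INR_pow_ge_1 (s p : nat) : (1 <= p)%nat -> 1 <= INR p ^ s.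
Proof. intros Hp. apply pow_R1_Rle. change 1 with (INR 1). now apply le_INR. Qed.

Lemma INR_pow_ge (s p : nat) : (1 <= p)%nat -> (1 <= s)%nat -> INR p <= INR p ^ s.
Proof.
  intros Hp Hs. destruct s as [|s]; [lia|]. simpl.
  assert (H := INR_pow_ge_1 s p Hp). assert (H2 := le_INR 1 p Hp). simpl in H2. nra.
Qed.

Lemma Li_disc (s : nat) (z : C) : Cmod z < 1 -> is_Clim (LiN s z) (Li s z).
Proof.
  intros Hz. apply is_Clim_LiN. unfold Li. apply CSeries_correct.
  apply Csum_Cauchy_Clim with (fun n => Cmod z ^ n).
  - intros n. rewrite Cmod_LiN_term by lia.
    assert (H1 := INR_pow_ge_1 s (S n) ltac:(lia)).
    assert (H2 := pow_le (Cmod z) n (Cmod_ge_0 z)). assert (H3 := Cmod_ge_0 z).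
    apply Rle_div_l; [lra|]. simpl (Cmod z ^ S n). nra.
  - exists (/ (1 - Cmod z)). apply is_series_geom.
    rewrite Rabs_pos_eq; [exact Hz|apply Cmod_ge_0].
Qed.

(** Comparison with a telescoping sum: for y = sqrt p and x = sqrt (p + 1), 4/y - 4/x = 4 / (x y (x
    + y)), and x <= 3y/2 gives x (x + y) <= 4 y^2. *)
Lemma sqrt_inv_tail (N M : nat) :
  sum_n_m (fun p => / (INR p * sqrt (INR p))) (S N) M <= 4 / sqrt (INR (S N)).
Proof.
  assert (HS := INR_S_pos N). assert (H0 := sqrt_lt_R0 _ HS).
  destruct (Compare_dec.le_lt_dec (S N) M) as [H|H].
  2:{ rewrite sum_n_m_0_r by exact H. apply Rdiv_le_0_compat; lra. }
  enough (E : sum_n_m (fun p => / (INR p * sqrt (INR p))) (S N) M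
            <= 4 / sqrt (INR (S N)) - 4 / sqrt (INR (S M))).
  { assert (0 <= 4 / sqrt (INR (S M))).
    { apply Rdiv_le_0_compat; [lra|]. apply sqrt_lt_R0, INR_S_pos. }
    lra. }
  assert (Step : forall p, (1 <= p)%nat ->
    / (INR p * sqrt (INR p)) <= 4 / sqrt (INR p) - 4 / sqrt (INR (S p))).
  { intros p Hp. apply le_INR in Hp. change (INR 1) with 1 in Hp.
    rewrite S_INR. set (P := INR p) in *.
    assert (Ey : sqrt P * sqrt P = P) by (apply sqrt_sqrt; lra).
    assert (Ex : sqrt (P + 1) * sqrt (P + 1) = P + 1) by (apply sqrt_sqrt; lra).
    assert (Hx : 0 < sqrt (P + 1)) by (apply sqrt_lt_R0; lra).
    assert (Hy : 0 < sqrt P) by (apply sqrt_lt_R0; lra).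
    set (x := sqrt (P + 1)) in *. set (y := sqrt P) in *.
    assert (Hxy : x <= 3 / 2 * y) by nra.
    assert (Hyx : y <= x) by nra.
    replace (4 / y - 4 / x) with (4 * ((x - y) * (x + y)) / (x * y * (x + y)))
      by (field; lra).
    replace ((x - y) * (x + y)) with 1 by nra.
    rewrite <- Ey. apply Rle_div_r.
    - apply Rmult_lt_0_compat; [apply Rmult_lt_0_compat|]; lra.
    - rewrite Rmult_comm. apply Rle_div_l; [apply Rmult_lt_0_compat; nra|].
      assert (x * (x + y) <= 4 * (y * y)) by nra. nra. }
  induction M as [|M IH]; [lia|].
  destruct (Nat.eq_dec N M) as [->|Hne].
  - rewrite sum_n_n. apply Step. lia.
  - rewrite sum_n_m_S_r by lia.
    assert (Q := Step (S M) ltac:(lia)). specialize (IH ltac:(lia)). lra.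
Qed.

(** A fourth root is far from the true logarithm, but it is proved by telescoping and is still
    beaten by the factor [/ sqrt (INR (S N))] of [exp_le_sqrt_weight]. *)
Lemma harmonic_le (N : nat) :
  sum_n_m (fun p => / INR p) 1 N <= 8 * sqrt (sqrt (INR (S N))).
Proof.
  induction N as [|N IH].
  - rewrite sum_n_m_0_r by lia. simpl. rewrite !sqrt_1. lra.
  - rewrite sum_n_m_S_r by lia.
    enough (/ INR (S N) <= 8 * sqrt (sqrt (INR (S (S N)))) - 8 * sqrt (sqrt (INR (S N)))) by lra.
    rewrite (S_INR (S N)). assert (H := le_INR 1 (S N) ltac:(lia)).
    change (INR 1) with 1 in H. set (P := INR (S N)) in *.
    assert (Ex : sqrt (P + 1) * sqrt (P + 1) = P + 1) by (apply sqrt_sqrt; lra).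
    assert (Ey : sqrt P * sqrt P = P) by (apply sqrt_sqrt; lra).
    assert (Hx : 0 < sqrt (P + 1)) by (apply sqrt_lt_R0; lra).
    assert (Hy : 0 < sqrt P) by (apply sqrt_lt_R0; lra).
    set (x2 := sqrt (P + 1)) in *. set (y2 := sqrt P) in *.
    assert (Ex2 : sqrt x2 * sqrt x2 = x2) by (apply sqrt_sqrt; lra).
    assert (Ey2 : sqrt y2 * sqrt y2 = y2) by (apply sqrt_sqrt; lra).
    assert (Hx2 : 0 < sqrt x2) by (apply sqrt_lt_R0; lra).
    assert (Hy2 : 0 < sqrt y2) by (apply sqrt_lt_R0; lra).
    set (x := sqrt x2) in *. set (y := sqrt y2) in *.
    assert (Hy1 : 1 <= y2) by nra.
    assert (Hy1' : 1 <= y) by nra.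
    assert (A1 : x2 <= 3 / 2 * y2) by nra.
    assert (A2 : x <= 3 / 2 * y) by nra.
    apply Rmult_le_reg_r with (P * ((x + y) * (x2 + y2))).
    { repeat apply Rmult_lt_0_compat; lra. }
    replace (/ P * (P * ((x + y) * (x2 + y2)))) with ((x + y) * (x2 + y2)) by (field; lra).
    replace ((8 * x - 8 * y) * (P * ((x + y) * (x2 + y2))))
      with (8 * P * ((x * x - y * y) * (x2 + y2))) by ring.
    rewrite Ex2, Ey2. replace ((x2 - y2) * (x2 + y2)) with 1 by nra.
    assert (B1 : (x + y) * (x2 + y2) <= (5 / 2 * y) * (5 / 2 * y2))
      by (apply Rmult_le_compat; lra).
    assert (B2 : y * y2 <= y2 * y2) by (apply Rmult_le_compat_r; nra).
    nra.
Qed.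

Lemma is_lim_seq_inv_sqrt (c : R) : is_lim_seq (fun N => c / sqrt (INR (S N))) 0.
Proof.
  replace 0 with (c * 0) by ring.
  apply (is_lim_seq_scal_l (fun N => / sqrt (INR (S N))) c 0).
  apply (is_lim_seq_incr_1 (fun N => / sqrt (INR N))).
  change (Finite 0) with (Rbar_inv p_infty).
  apply is_lim_seq_inv; [|discriminate].
  apply filterlim_comp with (2 := filterlim_sqrt_p).
  apply is_lim_seq_INR.
Qed.

Lemma is_lim_seq_inv_sqrt_sqrt (c : R) :
  is_lim_seq (fun N => c / sqrt (sqrt (INR (S N)))) 0.
Proof.
  replace 0 with (c * 0) by ring.
  apply (is_lim_seq_scal_l (fun N => / sqrt (sqrt (INR (S N)))) c 0).
  apply (is_lim_seq_incr_1 (fun N => / sqrt (sqrt (INR N)))).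
  change (Finite 0) with (Rbar_inv p_infty).
  apply is_lim_seq_inv; [|discriminate].
  apply filterlim_comp with (2 := filterlim_sqrt_p).
  apply filterlim_comp with (2 := filterlim_sqrt_p).
  apply is_lim_seq_INR.
Qed.

(* The estimates below are uniform over such [X]; this gives analyticity in [x]. *)
Definition sector (a B : R) (X : C) : Prop := a <= Re X /\ Cmod X <= B.

Definition damp (u X : C) (t : R) : C := (Cexp (- (X * RtoC t)) * u)%C.

Lemma Cmod_damp (u X : C) (t : R) : Cmod u = 1 -> Cmod (damp u X t) = exp (- (Re X * t)).
Proof. intros Hu. unfold damp. now rewrite Cmod_mult, Hu, Rmult_1_r, Cmod_Cexp_neg_mult. Qed.

Lemma exp_pow (x : R) (n : nat) : exp x ^ n = exp (INR n * x).
Proof.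
  induction n as [|n IH].
  - simpl. now rewrite Rmult_0_l, exp_0.
  - rewrite S_INR. simpl. rewrite IH, <- exp_plus. f_equal. ring.
Qed.

Lemma Cmod_damp_pow (u X : C) (t a B : R) (n : nat) :
  Cmod u = 1 -> sector a B X -> 0 < t ->
  Cmod (damp u X t) ^ n <= exp (- (a * INR n * t)).
Proof.
  intros Hu [HX _] Ht. rewrite Cmod_damp, exp_pow by exact Hu. apply exp_le.
  assert (H := pos_INR n). assert (INR n * t * a <= INR n * t * Re X).
  { apply Rmult_le_compat_l; [nra|exact HX]. }
  lra.
Qed.

Lemma Cmod_damp_lt_1 (u X : C) (t a B : R) :
  Cmod u = 1 -> sector a B X -> 0 < a -> 0 < t -> Cmod (damp u X t) < 1.
Proof.
  intros Hu [HX _] Ha Ht. rewrite Cmod_damp by exact Hu.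
  rewrite <- exp_0. apply exp_increasing. nra.
Qed.

Lemma LiN_diff (s : nat) (z : C) (N M : nat) :
  (N <= M)%nat ->
  (LiN s z M - LiN s z N = Csum (fun p => z ^ p / RtoC (INR p) ^ s) (S N) M)%C.
Proof.
  intros H. unfold LiN. rewrite (Csum_Chasles _ 1 N M) by lia. ring.
Qed.

Lemma Csum_geom_bound (z : C) (c : R) (m n : nat) :
  Cmod z <= 1 -> 0 < c <= Cmod (1 - z) ->
  Cmod (Csum (fun p => z ^ p)%C m n) <= 2 / c * Cmod z ^ m.
Proof.
  intros Hz Hc. assert (P := pow_le (Cmod z) m (Cmod_ge_0 z)).
  assert (P2 := Cmod_ge_0 z).
  assert (0 < 2 / c) by (apply Rdiv_lt_0_compat; lra).
  destruct (Compare_dec.le_lt_dec m n) as [H1|H1].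
  2:{ rewrite Csum_empty, Cmod_0 by exact H1. nra. }
  assert (G := Csum_geom z m n ltac:(lia)).
  apply (f_equal Cmod) in G. rewrite Cmod_mult in G.
  assert (G2 : Cmod (z ^ m - z ^ S n) <= 2 * Cmod z ^ m).
  { eapply Rle_trans; [apply Cmod_minus_le|]. rewrite !Cmod_pow.
    assert (Cmod z ^ S n <= Cmod z ^ m).
    { replace (S n) with (m + (S n - m))%nat by lia. rewrite pow_add.
      assert (Cmod z ^ (S n - m) <= 1 ^ (S n - m)) by (apply pow_incr; lra).
      rewrite pow1 in H0. nra. }
    lra. }
  rewrite <- G in G2.
  assert (S0 := Cmod_ge_0 (Csum (fun p => z ^ p)%C m n)).
  replace (2 / c * Cmod z ^ m) with (2 * Cmod z ^ m / c) by (field; lra).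
  apply Rle_div_r; [lra|]. nra.
Qed.

(** For [s = 0] the coefficients do not decay, and cancellation in the geometric sum is used, which
    needs [u <> 1]. For [s >= 1] the coefficient is at most 1/p and the damping contributes 1/sqrt
    p, so the tail is that of the sum of p^(-3/2). *)
Lemma LiN_tail (s : nat) (u : C) (a B : R) :
  Cmod u = 1 -> (s = 0%nat -> u <> 1) -> 0 < a -> 0 < B ->
  exists K, 0 < K /\ forall X t N M, sector a B X -> 0 < t -> (N <= M)%nat ->
    Cmod (LiN s (damp u X t) M - LiN s (damp u X t) N)
    <= K / sqrt (INR (S N)) * sqrt_weight t.
Proof.
  intros Hu Hs Ha HB.
  destruct (exp_le_sqrt_weight a Ha) as [K [HK HE]].
  assert (HE' : forall n t, 0 < t -> exp (- (a * INR (S n) * t))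
                <= K / sqrt (INR (S n)) * sqrt_weight t).
  { intros n t Ht. apply HE; [|exact Ht]. apply (le_INR 1). lia. }
  destruct s as [|s].
  - destruct (one_minus_Cexp_lower u a B Hu (Hs eq_refl) Ha HB) as [c [Hc Hlow]].
    exists (2 / c * K). split.
    { apply Rmult_lt_0_compat; [apply Rdiv_lt_0_compat|]; lra. }
    intros X t N M HX Ht HNM. rewrite LiN_diff by exact HNM.
    set (z := damp u X t).
    rewrite (Csum_ext _ (fun p => z ^ p)%C).
    2:{ intros p _. change (RtoC (INR p) ^ 0)%C with (RtoC 1). now rewrite Cdiv_1. }
    eapply Rle_trans; [apply (Csum_geom_bound z c)|].
    + left. apply (Cmod_damp_lt_1 u X t a B); assumption.
    + split; [exact Hc|]. apply Hlow; [apply HX|apply HX|exact Ht].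
    + assert (P := Cmod_damp_pow u X t a B (S N) Hu HX Ht). fold z in P.
      specialize (HE' N t Ht).
      replace (2 / c * K / sqrt (INR (S N)) * sqrt_weight t)
        with (2 / c * (K / sqrt (INR (S N)) * sqrt_weight t)) by (unfold Rdiv; ring).
      apply Rmult_le_compat_l; [left; apply Rdiv_lt_0_compat; lra|lra].
  - exists (4 * K). split; [lra|].
    intros X t N M HX Ht HNM. rewrite LiN_diff by exact HNM.
    set (z := damp u X t).
    eapply Rle_trans; [apply (Cmod_Csum_bound _
      (fun p => K * sqrt_weight t * / (INR p * sqrt (INR p))))|].
    + intros p Hp. rewrite Cmod_LiN_term by lia.
      destruct p as [|p]; [lia|].
      assert (H1 := INR_pow_ge (S s) (S p) ltac:(lia) ltac:(lia)).
      assert (H2 := INR_S_pos p). assert (H3 := sqrt_lt_R0 _ H2).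
      assert (P := Cmod_damp_pow u X t a B (S p) Hu HX Ht). fold z in P.
      specialize (HE' p t Ht).
      apply Rle_trans with (K / sqrt (INR (S p)) * sqrt_weight t / INR (S p)).
      * unfold Rdiv at 1. apply Rmult_le_compat.
        -- apply pow_le, Cmod_ge_0.
        -- left. apply Rinv_0_lt_compat. lra.
        -- lra.
        -- apply Rinv_le_contravar; lra.
      * right. field. lra.
    + rewrite (sum_n_m_mult_l (K := R_Ring) (K * sqrt_weight t)).
      change (K * sqrt_weight t * sum_n_m (fun p => / (INR p * sqrt (INR p))) (S N) M
        <= 4 * K / sqrt (INR (S N)) * sqrt_weight t).
      assert (T := sqrt_inv_tail N M). assert (W := sqrt_weight_pos t Ht).
      replace (4 * K / sqrt (INR (S N)) * sqrt_weight t)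
        with (K * sqrt_weight t * (4 / sqrt (INR (S N)))) by (unfold Rdiv; ring).
      apply Rmult_le_compat_l; [nra|exact T].
Qed.

Lemma Li_tail (s : nat) (u : C) (a B : R) :
  Cmod u = 1 -> (s = 0%nat -> u <> 1) -> 0 < a -> 0 < B ->
  exists K, 0 < K /\ forall X t N, sector a B X -> 0 < t ->
    Cmod (Li s (damp u X t) - LiN s (damp u X t) N)
    <= K / sqrt (INR (S N)) * sqrt_weight t.
Proof.
  intros Hu Hs Ha HB. destruct (LiN_tail s u a B Hu Hs Ha HB) as [K [HK H]].
  exists K. split; [exact HK|]. intros X t N HX Ht.
  apply Cmod_Clim_le with
    (s := fun M => (LiN s (damp u X t) M - LiN s (damp u X t) N)%C) (N0 := N).
  - apply is_Clim_minus; [|apply is_Clim_const].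
    apply Li_disc. now apply (Cmod_damp_lt_1 u X t a B).
  - intros M HM. now apply H.
Qed.

(* [M N p] is the largest [q] in row [p] of the [N]-th truncation. *)
Definition boundary_sum (s : nat) (M : nat -> nat -> nat) (z w : C) (N : nat) : C :=
  Csum (fun p => z ^ p / RtoC (INR p) ^ s * w ^ S (M N p))%C 1 N.

Definition box_rows (N p : nat) : nat := N.
Definition tri_rows (N p : nat) : nat := (N - p)%nat.

(** The boundary sum collects the end terms left by the inner geometric sums in [w]. The first
    hypothesis says that each carries at least [S N] damping factors in total, so exp(-a (N + 1) t)
    comes out and a harmonic sum remains. *)
Lemma boundary_sum_positive_weight (s : nat) (M : nat -> nat -> nat) (u v : C) (a B : R) :
  (forall N p, (1 <= p <= N)%nat -> (S N <= p + S (M N p))%nat) ->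
  (1 <= s)%nat -> Cmod u = 1 -> Cmod v = 1 -> 0 < a -> 0 < B ->
  exists eps, is_lim_seq eps 0 /\ forall X Y t N, sector a B X -> sector a B Y -> 0 < t ->
    Cmod (boundary_sum s M (damp u X t) (damp v Y t) N) <= eps N * sqrt_weight t.
Proof.
  intros HM Hs Hu Hv Ha HB.
  destruct (exp_le_sqrt_weight a Ha) as [K [HK HE]].
  exists (fun N => 8 * K / sqrt (sqrt (INR (S N)))). split; [apply is_lim_seq_inv_sqrt_sqrt|].
  intros X Y t N HX HY Ht. unfold boundary_sum.
  set (z := damp u X t). set (w := damp v Y t).
  assert (HN := INR_S_pos N). assert (H1 := sqrt_lt_R0 _ HN). assert (H2 := sqrt_lt_R0 _ H1).
  eapply Rle_trans; [apply (Cmod_Csum_bound _ (fun p => exp (- (a * INR (S N) * t)) * / INR p))|].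
  - intros p Hp. rewrite Cmod_mult, Cmod_LiN_term, Cmod_pow by lia.
    destruct p as [|p]; [lia|].
    assert (G1 := INR_pow_ge s (S p) ltac:(lia) Hs). assert (G2 := INR_S_pos p).
    assert (P := Cmod_damp_pow u X t a B (S p) Hu HX Ht). fold z in P.
    assert (Q := Cmod_damp_pow v Y t a B (S (M N (S p))) Hv HY Ht). fold w in Q.
    assert (R : Cmod z ^ S p * Cmod w ^ S (M N (S p)) <= exp (- (a * INR (S N) * t))).
    { eapply Rle_trans; [apply Rmult_le_compat; [| |exact P|exact Q]; apply pow_le, Cmod_ge_0|].
      rewrite <- exp_plus. apply exp_le.
      assert (L := le_INR _ _ (HM N (S p) ltac:(lia))). rewrite plus_INR in L.
      assert (a * t * INR (S N) <= a * t * (INR (S p) + INR (S (M N (S p))))).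
      { apply Rmult_le_compat_l; [nra|exact L]. }
      lra. }
    replace (Cmod z ^ S p / INR (S p) ^ s * Cmod w ^ S (M N (S p)))
      with (Cmod z ^ S p * Cmod w ^ S (M N (S p)) * / INR (S p) ^ s) by (unfold Rdiv; ring).
    apply Rmult_le_compat; [|left; apply Rinv_0_lt_compat; lra|exact R|].
    + apply Rmult_le_pos; apply pow_le, Cmod_ge_0.
    + apply Rinv_le_contravar; lra.
  - rewrite (sum_n_m_mult_l (K := R_Ring) (exp (- (a * INR (S N) * t)))).
    change (exp (- (a * INR (S N) * t)) * sum_n_m (fun p => / INR p) 1 N
       <= 8 * K / sqrt (sqrt (INR (S N))) * sqrt_weight t).
    specialize (HE (INR (S N)) t ltac:(apply (le_INR 1); lia) Ht).
    assert (HH := harmonic_le N). assert (EP := exp_pos (- (a * INR (S N) * t))).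
    eapply Rle_trans; [apply Rmult_le_compat_l; [lra|exact HH]|].
    eapply Rle_trans; [apply Rmult_le_compat_r; [lra|exact HE]|].
    assert (E : sqrt (sqrt (INR (S N))) * sqrt (sqrt (INR (S N))) = sqrt (INR (S N)))
      by (apply sqrt_sqrt; lra).
    set (r := sqrt (sqrt (INR (S N)))) in *. rewrite <- E. right. field. lra.
Qed.

(** In the square the power of [w] is the same in every row and factors out; the remaining geometric
    sum in [z] is bounded because [u <> 1]. *)
Lemma boundary_sum_box_0 (u v : C) (a B : R) :
  Cmod u = 1 -> Cmod v = 1 -> u <> 1 -> 0 < a -> 0 < B ->
  exists eps, is_lim_seq eps 0 /\ forall X Y t N, sector a B X -> sector a B Y -> 0 < t ->
    Cmod (boundary_sum 0 box_rows (damp u X t) (damp v Y t) N) <= eps N * sqrt_weight t.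
Proof.
  intros Hu Hv Hu1 Ha HB.
  destruct (exp_le_sqrt_weight a Ha) as [K [HK HE]].
  destruct (one_minus_Cexp_lower u a B Hu Hu1 Ha HB) as [c [Hc Hlow]].
  exists (fun N => (2 / c * K) / sqrt (INR (S N))). split; [apply is_lim_seq_inv_sqrt|].
  intros X Y t N HX HY Ht. unfold boundary_sum, box_rows.
  set (z := damp u X t). set (w := damp v Y t).
  rewrite (Csum_ext _ (fun p => z ^ p * w ^ S N)%C).
  2:{ intros p _. change (RtoC (INR p) ^ 0)%C with (RtoC 1). now rewrite Cdiv_1. }
  rewrite Csum_mult_r, Cmod_mult, Cmod_pow.
  assert (G : Cmod (Csum (fun p => z ^ p)%C 1 N) <= 2 / c * Cmod z ^ 1).
  { apply Csum_geom_bound.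
    - left. apply (Cmod_damp_lt_1 u X t a B); assumption.
    - split; [exact Hc|]. apply Hlow; [apply HX|apply HX|exact Ht]. }
  assert (Z1 : Cmod z < 1) by (apply (Cmod_damp_lt_1 u X t a B); assumption).
  assert (Q := Cmod_damp_pow v Y t a B (S N) Hv HY Ht). fold w in Q.
  specialize (HE (INR (S N)) t ltac:(apply (le_INR 1); lia) Ht).
  assert (C2 : 0 < 2 / c) by (apply Rdiv_lt_0_compat; lra).
  replace (2 / c * K / sqrt (INR (S N)) * sqrt_weight t)
    with (2 / c * (K / sqrt (INR (S N)) * sqrt_weight t)) by (unfold Rdiv; ring).
  apply Rmult_le_compat.
  - apply Cmod_ge_0.
  - apply pow_le, Cmod_ge_0.
  - eapply Rle_trans; [exact G|]. simpl. nra.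
  - lra.
Qed.

(** A geometric sum of ratio z/w along an antidiagonal, cleared of denominators. *)
Lemma Csum_geom_mixed (z w : C) (N : nat) :
  ((w - z) * Csum (fun p => z ^ p * w ^ S (N - p)) 1 N = z * w ^ S N - w * z ^ S N)%C.
Proof.
  induction N as [|N IH].
  - rewrite Csum_empty by lia. simpl. ring.
  - rewrite Csum_S by lia.
    rewrite (Csum_ext _ (fun p => w * (z ^ p * w ^ S (N - p)))%C).
    + rewrite Csum_mult_l.
      replace ((w - z) * (w * Csum (fun p => z ^ p * w ^ S (N - p)) 1 N
                 + z ^ S N * w ^ S (S N - S N)))%C
        with (w * ((w - z) * Csum (fun p => z ^ p * w ^ S (N - p)) 1 N)
              + (w - z) * (z ^ S N * w ^ S (S N - S N)))%C by ring.
      rewrite IH. replace (S N - S N)%nat with 0%nat by lia.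
      rewrite !Cpow_S. change (w ^ 0)%C with (RtoC 1). ring.
    + intros p Hp. replace (S N - p)%nat with (S (N - p)) by lia.
      rewrite (Cpow_S w (S (N - p))). ring.
Qed.

(** For small [t] the damped points are still apart because [u <> v], and [Csum_geom_mixed] applies.
    Later they may meet, since [X] and [Y] differ; there the [N] terms are bounded one by one, and
    half of the exponential decay absorbs the factor [N]. Hence the rate [a / 2]. *)
Lemma boundary_sum_triangle_0 (u v : C) (a B : R) :
  Cmod u = 1 -> Cmod v = 1 -> u <> v -> 0 < a -> 0 < B ->
  exists eps, is_lim_seq eps 0 /\ forall X Y t N, sector a B X -> sector a B Y -> 0 < t ->
    Cmod (boundary_sum 0 tri_rows (damp u X t) (damp v Y t) N) <= eps N * sqrt_weight t.
Proof.
  intros Hu Hv Huv Ha HB.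
  destruct (exp_le_sqrt_weight (a / 2) ltac:(lra)) as [K [HK HE]].
  set (d := Cmod (v - u)).
  assert (Hd : 0 < d).
  { apply Cmod_gt_0. intros E. apply Huv. replace u with (v - (v - u))%C by ring.
    rewrite E. ring. }
  (* Up to [t0] each of the two points has moved by at most [2 * B * t0 = d / 4], so they remain
     [d / 2] apart. *)
  set (t0 := d / (8 * B)).
  assert (Ht0 : 0 < t0) by (apply Rdiv_lt_0_compat; lra).
  (* The entries serve [t <= t0] and [t > t0]: the first is 2 divided by the separation [d / 2], the
     second comes from N <= (N + 1) t / t0 and y <= exp y with y = a (N + 1) t / 2. *)
  set (C0 := Rmax (4 / d) (2 / (a * t0))).
  assert (HC0 : 0 < C0).
  { eapply Rlt_le_trans; [|apply Rmax_l]. apply Rdiv_lt_0_compat; lra. }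
  exists (fun N => (C0 * K) / sqrt (INR (S N))). split; [apply is_lim_seq_inv_sqrt|].
  intros X Y t N HX HY Ht. unfold boundary_sum, tri_rows.
  set (z := damp u X t). set (w := damp v Y t).
  rewrite (Csum_ext _ (fun p => z ^ p * w ^ S (N - p))%C).
  2:{ intros p _. change (RtoC (INR p) ^ 0)%C with (RtoC 1). now rewrite Cdiv_1. }
  specialize (HE (INR (S N)) t ltac:(apply (le_INR 1); lia) Ht).
  replace (C0 * K / sqrt (INR (S N)) * sqrt_weight t)
    with (C0 * (K / sqrt (INR (S N)) * sqrt_weight t)) by (unfold Rdiv; ring).
  assert (HSN := INR_S_pos N).
  enough (Main : Cmod (Csum (fun p => z ^ p * w ^ S (N - p))%C 1 N)
                 <= C0 * exp (- (a / 2 * INR (S N) * t))).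
  { eapply Rle_trans; [exact Main|]. apply Rmult_le_compat_l; lra. }
  assert (Pz : forall n, Cmod z ^ n <= exp (- (a * INR n * t)))
    by (intros n; apply (Cmod_damp_pow u X t a B); assumption).
  assert (Pw : forall n, Cmod w ^ n <= exp (- (a * INR n * t)))
    by (intros n; apply (Cmod_damp_pow v Y t a B); assumption).
  assert (HaNt : 0 < a * INR (S N) * t) by (repeat apply Rmult_lt_0_compat; lra).
  destruct (Rle_or_lt t t0) as [Htt|Htt].
  - assert (Hwz : d / 2 <= Cmod (w - z)).
    { replace (w - z)%C with ((v - u) - ((1 - Cexp (- (Y * RtoC t))) * v
                  - (1 - Cexp (- (X * RtoC t))) * u))%C by (unfold w, z, damp; ring).
      eapply Rle_trans; [|apply Cmod_minus_ge]. fold d.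
      assert (HN : forall X', sector a B X' -> Cmod (1 - Cexp (- (X' * RtoC t))) <= d / 4).
      { intros X' [H1 H2].
        eapply Rle_trans; [apply Cexp_neg_near_1'; rewrite Re_mult_R; nra|].
        rewrite Cmod_mult, Cmod_R, Rabs_pos_eq by lra.
        assert (Cmod X' * t <= B * t0) by (apply Rmult_le_compat; try lra; apply Cmod_ge_0).
        assert (B * t0 = d / 8) by (unfold t0; field; lra). lra. }
      assert (S2 := Cmod_minus_le ((1 - Cexp (- (Y * RtoC t))) * v)
                  ((1 - Cexp (- (X * RtoC t))) * u)).
      rewrite !Cmod_mult, Hu, Hv in S2.
      specialize (HN X HX) as N1. specialize (HN Y HY). lra. }
    assert (G := f_equal Cmod (Csum_geom_mixed z w N)). rewrite Cmod_mult in G.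
    assert (G2 : Cmod (z * w ^ S N - w * z ^ S N) <= 2 * exp (- (a * INR (S N) * t))).
    { eapply Rle_trans; [apply Cmod_minus_le|]. rewrite !Cmod_mult, !Cmod_pow.
      assert (Z1 : Cmod z < 1) by (apply (Cmod_damp_lt_1 u X t a B); assumption).
      assert (W1 : Cmod w < 1) by (apply (Cmod_damp_lt_1 v Y t a B); assumption).
      assert (Z0 := Cmod_ge_0 z). assert (W0 := Cmod_ge_0 w).
      specialize (Pz (S N)). specialize (Pw (S N)).
      assert (Z2 := pow_le (Cmod z) (S N) Z0). assert (W2 := pow_le (Cmod w) (S N) W0).
      nra. }
    rewrite <- G in G2.
    assert (S0 := Cmod_ge_0 (Csum (fun p => z ^ p * w ^ S (N - p))%C 1 N)).
    assert (E1 : exp (- (a * INR (S N) * t)) <= exp (- (a / 2 * INR (S N) * t)))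
      by (apply exp_le; lra).
    assert (E0 := exp_pos (- (a / 2 * INR (S N) * t))).
    apply Rle_trans with (4 / d * exp (- (a / 2 * INR (S N) * t))).
    + replace (4 / d * exp (- (a / 2 * INR (S N) * t)))
        with (2 * exp (- (a / 2 * INR (S N) * t)) / (d / 2)) by (field; lra).
      apply Rle_div_r; [lra|]. nra.
    + apply Rmult_le_compat_r; [lra|apply Rmax_l].
  - eapply Rle_trans; [apply (Cmod_Csum_bound _ (fun _ => exp (- (a * INR (S N) * t))))|].
    + intros p Hp. rewrite Cmod_mult, !Cmod_pow.
      eapply Rle_trans; [apply Rmult_le_compat; [| |apply Pz|apply Pw]; apply pow_le, Cmod_ge_0|].
      rewrite <- exp_plus. apply exp_le. right.
      replace (S N) with (p + S (N - p))%nat by lia. rewrite plus_INR. ring.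
    + rewrite sum_n_m_const. replace (S N - 1)%nat with N by lia.
      replace (- (a * INR (S N) * t))
        with (- (a / 2 * INR (S N) * t) + - (a / 2 * INR (S N) * t)) by field.
      rewrite exp_plus, <- Rmult_assoc.
      apply Rmult_le_compat_r; [left; apply exp_pos|].
      apply Rle_trans with (2 / (a * t0)); [|apply Rmax_r].
      rewrite exp_Ropp. apply Rle_div_l; [apply exp_pos|].
      assert (I := exp_ineq1_le (a / 2 * INR (S N) * t)).
      assert (0 < a * t0) by nra.
      apply Rle_trans with (2 / (a * t0) * (a / 2 * INR (S N) * t)).
      * replace (2 / (a * t0) * (a / 2 * INR (S N) * t)) with (INR (S N) * (t / t0))
          by (field; lra).
        assert (1 <= t / t0) by (apply Rle_div_r; lra).
        rewrite S_INR in *. assert (0 <= INR N) by apply pos_INR. nra.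
      * apply Rmult_le_compat_l; [left; apply Rdiv_lt_0_compat; lra|lra].
Qed.

(** * The analytic continuation as a limit of double sums *)

Definition Fterm (k : nat) (u v x : C) (p q : nat) : C :=
  (u ^ p * v ^ q / (RtoC (INR p) ^ (k - 1) * (RtoC (INR p) * x + RtoC (INR q))))%C.

Definition Fsum (k : nat) (M : nat -> nat -> nat) (u v x : C) (N : nat) : C :=
  Csum (fun p => Csum (fun q => Fterm k u v x p q) 0 (M N p)) 1 N.

Lemma damp_pow (u X : C) (t : R) (n : nat) :
  (damp u X t ^ n = u ^ n * Cexp (- (RtoC (INR n) * X * RtoC t)))%C.
Proof.
  unfold damp. rewrite Cpow_mult_l, Cexp_pow, Cmult_comm. f_equal. f_equal. ring.
Qed.

(** Each denominator is written as om / lam with lam = (p x + q) om. Since p >= 1, the two sign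
    conditions give lam a positive real part, and 1 / lam is the integral of exp(-lam t). The value
    does not depend on [om]. *)
Lemma Fsum_integral (k : nat) (M : nat -> nat -> nat) (u v x om : C) (N : nat) :
  0 < Re om -> 0 < Re (x * om) ->
  is_improper_RInt
    (fun t => om * Csum (fun p => damp u (x * om) t ^ p / RtoC (INR p) ^ (k - 1)
                        * Csum (fun q => damp v om t ^ q) 0 (M N p)) 1 N)%C
    (Fsum k M u v x N).
Proof.
  intros H1 H2.
  assert (Hom : om <> 0) by (intros ->; simpl in H1; lra).
  destruct N as [|N].
  (* [is_improper_RInt_Csum] needs a nonempty range, so the empty sum is integrated separately, as 0
     times a decaying exponential. *)
  { unfold Fsum. rewrite Csum_empty by lia.
    apply is_improper_RInt_ext with (fun t => 0 * Cexp (- (1 * RtoC t)))%C.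
    - intros t _. rewrite Csum_empty by lia. ring.
    - assert (H := is_improper_RInt_scal _ 0 _ (is_improper_RInt_Cexp 1 Rlt_0_1)).
      now rewrite Cmult_0_l in H. }
  unfold Fsum.
  apply is_improper_RInt_ext with (fun t => Csum (fun p => Csum (fun q =>
     (om * u ^ p * v ^ q / RtoC (INR p) ^ (k - 1))
      * Cexp (- ((RtoC (INR p) * (x * om) + RtoC (INR q) * om) * RtoC t)))%C 0 (M (S N) p)) 1 (S N)).
  { intros t _. rewrite <- Csum_mult_l. apply Csum_ext. intros p Hp.
    rewrite <- !Csum_mult_l. apply Csum_ext. intros q _.
    rewrite !damp_pow.
    replace (- ((RtoC (INR p) * (x * om) + RtoC (INR q) * om) * RtoC t))%C
      with (- (RtoC (INR p) * (x * om) * RtoC t) + - (RtoC (INR q) * om * RtoC t))%C by ring.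
    rewrite Cexp_plus. unfold Cdiv. ring. }
  apply (is_improper_RInt_Csum (fun p t => Csum (fun q =>
     (om * u ^ p * v ^ q / RtoC (INR p) ^ (k - 1))
      * Cexp (- ((RtoC (INR p) * (x * om) + RtoC (INR q) * om) * RtoC t)))%C 0 (M (S N) p))
    (fun p => Csum (fun q => Fterm k u v x p q) 0 (M (S N) p))); [lia|].
  intros p Hp. destruct p as [|p]; [lia|].
  apply (is_improper_RInt_Csum (fun q t =>
     (om * u ^ S p * v ^ q / RtoC (INR (S p)) ^ (k - 1))
      * Cexp (- ((RtoC (INR (S p)) * (x * om) + RtoC (INR q) * om) * RtoC t)))%C
    (fun q => Fterm k u v x (S p) q)); [lia|].
  intros q _.
  assert (HP := INR_S_pos p). assert (HQ := pos_INR q).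
  set (lam := (RtoC (INR (S p)) * (x * om) + RtoC (INR q) * om)%C).
  assert (Hl : 0 < Re lam).
  { unfold lam. destruct (x * om)%C as [r1 r2], om as [o1 o2]. unfold Re in *.
    cbn - [INR] in *. nra. }
  assert (Hl0 : lam <> 0) by (intros E; rewrite E in Hl; simpl in Hl; lra).
  assert (E : lam = ((RtoC (INR (S p)) * x + RtoC (INR q)) * om)%C) by (unfold lam; ring).
  replace (Fterm k u v x (S p) q)
    with (om * u ^ S p * v ^ q / RtoC (INR (S p)) ^ (k - 1) * / lam)%C.
  - exact (is_improper_RInt_scal _ _ _ (is_improper_RInt_Cexp lam Hl)).
  - unfold Fterm. rewrite E in *. field. repeat split; try exact Hom; try apply Cpow_nz, RtoC_INR_S_neq_0.
    intros E0. apply Hl0. rewrite E0. ring.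
Qed.

Definition F_integrand (k : nat) (u v x om : C) (t : R) : C :=
  (om * (Li (k - 1) (damp u (x * om) t) / (1 - damp v om t)))%C.

(** What [Fsum_limit] asks of the truncation shape, so that square and triangle share one proof. *)
Definition boundary_small (s : nat) (M : nat -> nat -> nat) (u v : C) (a B : R) : Prop :=
  exists eps, is_lim_seq eps 0 /\ forall X Y t N, sector a B X -> sector a B Y -> 0 < t ->
    Cmod (boundary_sum s M (damp u X t) (damp v Y t) N) <= eps N * sqrt_weight t.

Lemma boundary_small_box (s : nat) (u v : C) (a B : R) :
  Cmod u = 1 -> Cmod v = 1 -> (s = 0%nat -> u <> 1) -> 0 < a -> 0 < B ->
  boundary_small s box_rows u v a B.
Proof.
  intros Hu Hv Hs Ha HB. destruct s as [|s].
  - apply boundary_sum_box_0; auto.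
  - apply boundary_sum_positive_weight; auto; [|lia]. unfold box_rows. intros; lia.
Qed.

Lemma boundary_small_triangle (s : nat) (u v : C) (a B : R) :
  Cmod u = 1 -> Cmod v = 1 -> (s = 0%nat -> u <> v) -> 0 < a -> 0 < B ->
  boundary_small s tri_rows u v a B.
Proof.
  intros Hu Hv Hs Ha HB. destruct s as [|s].
  - apply boundary_sum_triangle_0; auto.
  - apply boundary_sum_positive_weight; auto; [|lia]. unfold tri_rows. intros; lia.
Qed.

(** The order of quantifiers matters: [eta] depends only on the sector, so the convergence is
    uniform over the [x] with [x * om] in it, as [Fval_analytic] requires. *)
Lemma Fsum_limit (k : nat) (M : nat -> nat -> nat) (u v : C) (a B : R) :
  (1 <= k)%nat -> Cmod u = 1 -> Cmod v = 1 -> v <> 1 -> (k = 1%nat -> u <> 1) ->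
  0 < a -> 0 < B -> boundary_small (k - 1) M u v a B ->
  exists eta, is_lim_seq eta 0 /\ forall x om, sector a B om -> sector a B (x * om) ->
    exists L, is_improper_RInt (F_integrand k u v x om) L /\
      forall N, Cmod (Fsum k M u v x N - L) <= eta N.
Proof.
  intros Hk1 Hu Hv Hv1 Hk Ha HB [eps [Heps Hbd]].
  destruct (Li_tail (k - 1) u a B Hu ltac:(intros; apply Hk; lia) Ha HB) as [K [HK Htail]].
  destruct (one_minus_Cexp_lower v a B Hv Hv1 Ha HB) as [c [Hc Hlow]].
  (* [B] bounds [om], [c] bounds [1 - w] from below, and the two summands are the tail of the
     polylogarithm and the boundary sum. *)
  set (mu := fun N => B / c * (K / sqrt (INR (S N)) + eps N)).
  assert (Hmu : is_lim_seq mu 0).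
  { unfold mu. replace 0 with (B / c * (0 + 0)) by ring.
    apply (is_lim_seq_scal_l (fun N => K / sqrt (INR (S N)) + eps N) (B / c) (0 + 0)).
    apply is_lim_seq_plus'; [apply is_lim_seq_inv_sqrt|exact Heps]. }
  exists (fun N => 2 * mu N). split.
  { replace 0 with (2 * 0) by ring. now apply (is_lim_seq_scal_l mu 2 0). }
  intros x om Hom Hx.
  apply (improper_limit (fun N t =>
     om * Csum (fun p => damp u (x * om) t ^ p / RtoC (INR p) ^ (k - 1)
                        * Csum (fun q => damp v om t ^ q) 0 (M N p)) 1 N)%C); [| |exact Hmu].
  { intros N. apply Fsum_integral; [destruct Hom|destruct Hx]; lra. }
  intros N t Ht. unfold F_integrand.
  set (z := damp u (x * om) t). set (w := damp v om t).
  assert (Hcw : c <= Cmod (1 - w)) by (apply Hlow; [apply Hom|apply Hom|exact Ht]).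
  assert (Hw0 : (1 - w)%C <> 0) by (apply Cmod_gt_0; lra).
  (* Summing the inner geometric series to (1 - w^(M+1)) / (1 - w) separates the truncated
     polylogarithm from the boundary sum. *)
  assert (E : (Csum (fun p => z ^ p / RtoC (INR p) ^ (k - 1)
                        * Csum (fun q => w ^ q) 0 (M N p)) 1 N
     = (LiN (k - 1) z N - boundary_sum (k - 1) M z w N) / (1 - w))%C).
  { unfold LiN, boundary_sum. rewrite <- Csum_minus.
    match goal with |- _ = (?A / ?B)%C => change (A / B)%C with (A * / B)%C end.
    rewrite <- Csum_mult_r. apply Csum_ext. intros p _.
    assert (G := Csum_geom w 0 (M N p) ltac:(lia)). change (w ^ 0)%C with (RtoC 1) in G.
    set (g := Csum (fun q => w ^ q)%C 0 (M N p)).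
    change (Csum (fun i : nat => (w ^ i)%C) 0 (M N p)) with g in G.
    replace g with ((1 - w) * g / (1 - w))%C by (field; exact Hw0).
    rewrite G. unfold Cdiv. ring. }
  rewrite E.
  replace (om * (Li (k - 1) z / (1 - w))
    - om * ((LiN (k - 1) z N - boundary_sum (k - 1) M z w N) / (1 - w)))%C
    with (om * (((Li (k - 1) z - LiN (k - 1) z N) + boundary_sum (k - 1) M z w N) / (1 - w)))%C
    by (field; exact Hw0).
  rewrite Cmod_mult, Cmod_div by exact Hw0.
  assert (T1 := Htail (x * om)%C t N Hx Ht). assert (T2 := Hbd (x * om)%C om t N Hx Hom Ht).
  fold z in T1, T2. fold w in T2.
  assert (T3 := Cmod_triangle (Li (k - 1) z - LiN (k - 1) z N) (boundary_sum (k - 1) M z w N)).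
  unfold mu.
  set (A := Cmod (Li (k - 1) z - LiN (k - 1) z N + boundary_sum (k - 1) M z w N)) in *.
  assert (A0 : 0 <= A) by apply Cmod_ge_0.
  replace (B / c * (K / sqrt (INR (S N)) + eps N) * sqrt_weight t)
    with (B * ((K / sqrt (INR (S N)) * sqrt_weight t + eps N * sqrt_weight t) / c))
    by (field; split; [apply Rgt_not_eq, sqrt_lt_R0, INR_S_pos|lra]).
  apply Rmult_le_compat; [apply Cmod_ge_0| |apply Hom|].
  - apply Rdiv_le_0_compat; lra.
  - unfold Rdiv. apply Rmult_le_compat; [exact A0| |lra|].
    + left. apply Rinv_0_lt_compat. lra.
    + apply Rinv_le_contravar; lra.
Qed.

Lemma is_improper_RInt_unique (f : R -> C) (l m : C) :
  is_improper_RInt f l -> is_improper_RInt f m -> l = m.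
Proof.
  intros Hl Hm. unfold is_improper_RInt in *.
  rewrite <- (is_RInt_gen_unique (V := C_R_CompleteNormedModule) f l Hl).
  exact (is_RInt_gen_unique (V := C_R_CompleteNormedModule) f m Hm).
Qed.

(* [om] has half the argument of [conj x]. *)
Lemma slit_plane_direction (x : C) :
  slit_plane x -> exists om, 0 < Re om /\ 0 < Re (x * om).
Proof.
  intros Hx. exists (RtoC (Cmod x) + Cconj x)%C.
  (* [Cmod x + Re x] vanishes only on the excluded ray; both [Re om] and [Re (x * om)] are governed
     by it. *)
  assert (Hm : 0 < Cmod x + Re x).
  { destruct (Rle_or_lt (Cmod x + Re x) 0) as [H|H]; [exfalso|exact H].
    apply Hx. assert (H0 := Cmod_ge_0 x). assert (H2 := Cmod2_alt x).
    assert (HI : Cmod x ^ 2 <= Re x ^ 2) by nra.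
    split; [|lra]. assert (Im x ^ 2 <= 0) by lra. nra. }
  assert (Hx0 : 0 < Cmod x).
  { apply Cmod_gt_0. intros ->. rewrite Cmod_0 in Hm. simpl in Hm. lra. }
  split.
  - destruct x as [a b]. unfold Re in *. simpl in *. lra.
  - replace (Re (x * (RtoC (Cmod x) + Cconj x))) with (Cmod x * (Cmod x + Re x)).
    + now apply Rmult_lt_0_compat.
    + assert (H2 := Cmod2_alt x). destruct x as [a b]. unfold Re, Im in *. simpl in *. nra.
Qed.

(** The halves and the extra [a] leave a margin: [Y] can be moved by up to [a] without leaving the
    sector, which provides the disc in [Fval_analytic]. *)
Lemma common_sector (X Y : C) :
  0 < Re X -> 0 < Re Y -> exists a B, 0 < a /\ 0 < B /\ a <= Re X / 2 /\ a <= Re Y / 2 /\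
    Cmod X <= B /\ Cmod Y + a <= B.
Proof.
  intros HX HY. exists (Rmin (Re X / 2) (Re Y / 2)), (Cmod X + (Cmod Y + Re X)).
  assert (H1 := Rmin_l (Re X / 2) (Re Y / 2)). assert (H2 := Rmin_r (Re X / 2) (Re Y / 2)).
  assert (H3 := Cmod_ge_0 X). assert (H4 := Cmod_ge_0 Y).
  assert (0 < Rmin (Re X / 2) (Re Y / 2)) by (apply Rmin_glb_lt; lra).
  repeat split; lra.
Qed.

Definition Fval (k : nat) (u v x : C) : C := Clim (Fsum k box_rows u v x).

Lemma Fsum_improper (k : nat) (M : nat -> nat -> nat) (u v x om : C) :
  (1 <= k)%nat -> Cmod u = 1 -> Cmod v = 1 -> v <> 1 -> (k = 1%nat -> u <> 1) ->
  (forall a B, 0 < a -> 0 < B -> boundary_small (k - 1) M u v a B) ->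
  0 < Re om -> 0 < Re (x * om) ->
  exists L, is_improper_RInt (F_integrand k u v x om) L /\ is_Clim (Fsum k M u v x) L.
Proof.
  intros Hk1 Hu Hv Hv1 Hk HM Hom Hx.
  destruct (common_sector om (x * om) Hom Hx) as [a [B [Ha [HB [H1 [H2 [H3 H4]]]]]]].
  destruct (Fsum_limit k M u v a B Hk1 Hu Hv Hv1 Hk Ha HB (HM a B Ha HB)) as [eta [Heta H]].
  destruct (H x om) as [L [HL1 HL2]]; [split; lra|split; lra|].
  exists L. split; [exact HL1|]. now apply is_Clim_le with eta.
Qed.

Lemma Fval_improper (k : nat) (u v : C) (x om : C) :
  (1 <= k)%nat -> Cmod u = 1 -> Cmod v = 1 -> v <> 1 -> (k = 1%nat -> u <> 1) ->
  0 < Re om -> 0 < Re (x * om) -> is_improper_RInt (F_integrand k u v x om) (Fval k u v x).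
Proof.
  intros Hk1 Hu Hv Hv1 Hk.
  intros Hom Hx. destruct (Fsum_improper k box_rows u v x om) as [L [HL1 HL2]]; auto.
  { intros. apply boundary_small_box; auto. intros; apply Hk; lia. }
  replace (Fval k u v x) with L; [exact HL1|].
  apply (is_Clim_unique _ _ _ HL2). apply Clim_correct. now exists L.
Qed.

Lemma Fsum_box_Clim (k : nat) (u v : C) (x : C) :
  (1 <= k)%nat -> Cmod u = 1 -> Cmod v = 1 -> v <> 1 -> (k = 1%nat -> u <> 1) ->
  slit_plane x -> is_Clim (Fsum k box_rows u v x) (Fval k u v x).
Proof.
  intros Hk1 Hu Hv Hv1 Hk.
  intros Hx. destruct (slit_plane_direction x Hx) as [om [H1 H2]].
  destruct (Fsum_improper k box_rows u v x om) as [L [HL1 HL2]]; auto.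
  { intros. apply boundary_small_box; auto. intros; apply Hk; lia. }
  apply Clim_correct. now exists L.
Qed.

(** Both truncations converge to the same improper integral, hence to the same value. *)
Lemma Fsum_tri_Clim (k : nat) (u v : C) (x : C) :
  (1 <= k)%nat -> Cmod u = 1 -> Cmod v = 1 -> v <> 1 -> (k = 1%nat -> u <> 1) ->
  (k = 1%nat -> u <> v) -> slit_plane x ->
  is_Clim (Fsum k tri_rows u v x) (Fval k u v x).
Proof.
  intros Hk1 Hu Hv Hv1 Hk.
  intros Huv Hx. destruct (slit_plane_direction x Hx) as [om [H1 H2]].
  destruct (Fsum_improper k tri_rows u v x om) as [L [HL1 HL2]]; auto.
  { intros. apply boundary_small_triangle; auto. intros; apply Huv; lia. }
  now rewrite (is_improper_RInt_unique _ _ _ (Fval_improper k u v x om Hk1 Hu Hv Hv1 Hk H1 H2) HL1).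
Qed.

Lemma Fval_analytic (k : nat) (u v : C) (z0 : C) :
  (1 <= k)%nat -> Cmod u = 1 -> Cmod v = 1 -> v <> 1 -> (k = 1%nat -> u <> 1) ->
  slit_plane z0 -> analytic_at (Fval k u v) z0.
Proof.
  intros Hk1 Hu Hv Hv1 Hk.
  intros Hz0. destruct (slit_plane_direction z0 Hz0) as [om [H1 H2]].
  destruct (common_sector om (z0 * om) H1 H2) as [a [B [Ha [HB [S1 [S2 [S3 S4]]]]]]].
  destruct (Fsum_limit k box_rows u v a B Hk1 Hu Hv Hv1 Hk Ha HB) as [eta [Heta Hlim]].
  { apply boundary_small_box; auto. intros; apply Hk; lia. }
  assert (Hom : 0 < Cmod om).
  { eapply Rlt_le_trans; [exact H1|]. eapply Rle_trans; [apply Rle_abs|apply re_le_Cmod]. }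
  (* Moving [z] by at most [r] moves [z * om] by at most [a], the margin of [common_sector]. *)
  set (r := a / Cmod om). assert (Hr : 0 < r) by (apply Rdiv_lt_0_compat; lra).
  assert (Hrom : r * Cmod om = a) by (unfold r; field; lra).
  assert (Hsec : forall z, Cmod (z - z0) <= r -> sector a B (z * om)).
  { intros z Hz.
    assert (D : Cmod (z * om - z0 * om) <= a).
    { replace (z * om - z0 * om)%C with ((z - z0) * om)%C by ring.
      rewrite Cmod_mult, <- Hrom. apply Rmult_le_compat_r; lra. }
    split.
    - assert (R := re_le_Cmod (z * om - z0 * om)).
      replace (Re (z * om - z0 * om)) with (Re (z * om) - Re (z0 * om)) in R
        by (unfold Re; simpl; ring).
      apply Rabs_le_between in R. lra.
    - assert (G := Cmod_minus_ge (z * om) (z0 * om)). lra. }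
  assert (HL : forall z, Cmod (z - z0) <= r ->
    forall N, Cmod (Fsum k box_rows u v z N - Fval k u v z) <= eta N).
  { intros z Hz. destruct (Hlim z om) as [L [HL1 HL2]]; [split; lra|now apply Hsec|].
    replace (Fval k u v z) with L; [exact HL2|].
    apply (is_improper_RInt_unique _ _ _ HL1). apply Fval_improper; auto.
    destruct (Hsec z Hz). lra. }
  (* The coefficients are those of the geometric expansion of each [Fterm] about [z0]. *)
  apply (unif_lim_analytic (fun N z => Fsum k box_rows u v z N) _ z0 r
    (fun N n => Csum (fun p => Csum (fun q =>
       (u ^ p * v ^ q / RtoC (INR p) ^ (k - 1))
       * (/ (RtoC (INR p) * z0 + RtoC (INR q))
          * ((- RtoC (INR p)) / (RtoC (INR p) * z0 + RtoC (INR q))) ^ n))%C 0 (box_rows N p)) 1 N)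
    eta Hr); [| |exact Heta|].
  - intros N. unfold Fsum.
    apply (unif_pseries_Csum (fun p z => Csum (fun q => Fterm k u v z p q) 0 (box_rows N p)) z0 r
      (fun p n => Csum (fun q =>
       (u ^ p * v ^ q / RtoC (INR p) ^ (k - 1))
       * (/ (RtoC (INR p) * z0 + RtoC (INR q))
          * ((- RtoC (INR p)) / (RtoC (INR p) * z0 + RtoC (INR q))) ^ n))%C 0 (box_rows N p))).
    intros p Hp. destruct p as [|p]; [lia|].
    apply (unif_pseries_Csum (fun q z => Fterm k u v z (S p) q) z0 r
      (fun q n => 
       (u ^ S p * v ^ q / RtoC (INR (S p)) ^ (k - 1))
       * (/ (RtoC (INR (S p)) * z0 + RtoC (INR q))
          * ((- RtoC (INR (S p))) / (RtoC (INR (S p)) * z0 + RtoC (INR q))) ^ n))%C).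
    intros q _. assert (HP := INR_S_pos p). assert (HQ := pos_INR q).
    assert (Hnz : forall z, Cmod (z - z0) <= r ->
       INR (S p) * a <= Cmod om * Cmod (RtoC (INR (S p)) * z + RtoC (INR q))).
    { intros z Hz. rewrite <- Cmod_mult.
      eapply Rle_trans; [|apply re_le_Cmod]. eapply Rle_trans; [|apply Rle_abs].
      destruct (Hsec z Hz) as [Hs _].
      replace (Re (om * (RtoC (INR (S p)) * z + RtoC (INR q))))
        with (INR (S p) * Re (z * om) + INR q * Re om)
        by (destruct z, om; unfold Re; cbn - [INR]; ring).
      assert (0 <= INR q * Re om) by (apply Rmult_le_pos; lra).
      assert (INR (S p) * a <= INR (S p) * Re (z * om)) by (apply Rmult_le_compat_l; lra).
      lra. }
    (* After multiplication by [Cmod om] the left side is p a, while the real part at [z0] is at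
       least 2 p a, by the halves in [common_sector]. *)
    assert (Hlt : Cmod (RtoC (INR (S p))) * r < Cmod (RtoC (INR (S p)) * z0 + RtoC (INR q))).
    { rewrite Cmod_R, Rabs_pos_eq by lra.
      assert (R2 : 2 * (INR (S p) * a) <= Cmod om * Cmod (RtoC (INR (S p)) * z0 + RtoC (INR q))).
      { rewrite <- Cmod_mult.
        eapply Rle_trans; [|apply re_le_Cmod]. eapply Rle_trans; [|apply Rle_abs].
        replace (Re (om * (RtoC (INR (S p)) * z0 + RtoC (INR q))))
          with (INR (S p) * Re (z0 * om) + INR q * Re om)
          by (destruct z0, om; unfold Re; cbn - [INR]; ring).
        assert (0 <= INR q * Re om) by (apply Rmult_le_pos; lra).
        assert (INR (S p) * (2 * a) <= INR (S p) * Re (z0 * om))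
          by (apply Rmult_le_compat_l; lra).
        lra. }
      apply Rmult_lt_reg_l with (Cmod om); [exact Hom|].
      replace (Cmod om * (INR (S p) * r)) with (INR (S p) * a) by (rewrite <- Hrom; ring).
      assert (0 < INR (S p) * a) by (apply Rmult_lt_0_compat; lra). lra. }
    intros eps He.
    destruct (unif_pseries_scal (u ^ S p * v ^ q / RtoC (INR (S p)) ^ (k - 1))%C _ _ _ _
      (unif_pseries_inv_linear (RtoC (INR (S p))) (RtoC (INR q)) z0 r ltac:(lra) Hlt)
      eps He) as [K0 HK0].
    exists K0. intros K z HK Hz. specialize (HK0 K z HK Hz).
    unfold Fterm.
    replace (u ^ S p * v ^ q / (RtoC (INR (S p)) ^ (k - 1)
               * (RtoC (INR (S p)) * z + RtoC (INR q))))%C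
      with (u ^ S p * v ^ q / RtoC (INR (S p)) ^ (k - 1)
            * / (RtoC (INR (S p)) * z + RtoC (INR q)))%C; [exact HK0|].
    field. split; [|apply Cpow_nz, RtoC_INR_S_neq_0].
    apply Cmod_gt_0. specialize (Hnz z Hz).
    assert (0 < INR (S p) * a) by (apply Rmult_lt_0_compat; lra). nra.
  - intros N N' z Hz.
    replace (Fsum k box_rows u v z N - Fsum k box_rows u v z N')%C
      with ((Fsum k box_rows u v z N - Fval k u v z) - (Fsum k box_rows u v z N' - Fval k u v z))%C by ring.
    eapply Rle_trans; [apply Cmod_minus_le|].
    apply Rplus_le_compat; now apply HL.
  - intros z Hz. apply is_Clim_le with eta; [now apply HL|exact Heta].
Qed.

(** * Identification of [Fval] with the analytic continuation *)

Lemma scrF_unique (k : nat) (alpha beta : R) (f g : C -> C) (x : C) :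
  is_scrF k alpha beta f -> is_scrF k alpha beta g -> slit_plane x -> f x = g x.
Proof.
  intros [Hf1 Hf2] [Hg1 Hg2] Hx.
  assert (E : (f x - g x)%C = 0).
  { apply (slit_plane_identity (fun z => f z - g z)%C); [| |exact Hx].
    - intros z Hz. apply analytic_at_minus; auto.
    - intros z Hz. rewrite (is_improper_RInt_unique _ _ _ (Hf2 z Hz) (Hg2 z Hz)). ring. }
  replace (f x) with (f x - g x + g x)%C by ring. rewrite E. ring.
Qed.

Lemma scrF_value (k : nat) (alpha beta : R) (x : C) :
  non_integer beta -> (k = 1%nat -> non_integer alpha) -> (1 <= k)%nat -> slit_plane x ->
  scrF k x alpha beta = Fval k (e alpha) (e beta) x.
Proof.
  intros Hb Ha Hk Hx.
  assert (Hu1 : (k = 1%nat -> e alpha <> 1)) by (intros; now apply e_neq_1, Ha).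
  assert (HF : is_scrF k alpha beta (Fval k (e alpha) (e beta))).
  { split.
    - intros z Hz. apply Fval_analytic; auto using Cmod_e, e_neq_1.
    - intros z Hz.
      apply (is_improper_RInt_ext (F_integrand k (e alpha) (e beta) z 1)).
      + intros t _. unfold F_integrand, scrF_integrand, damp.
        replace (Cexp (- (1 * RtoC t))) with (RtoC (exp (- t))).
        * rewrite !Cmult_1_r, Cmult_1_l. reflexivity.
        * unfold Cexp, Re, Im. simpl.
          replace (- (1 * t - 0 * 0)) with (- t) by ring.
          replace (- (1 * 0 + 0 * t)) with 0 by ring. rewrite cos_0, sin_0.
          apply injective_projections; simpl; ring.
      + apply Fval_improper; auto using Cmod_e, e_neq_1; simpl; [lra|].
        unfold Re in Hz. lra. }
  unfold scrF. apply (iota_unique (V := C_CompleteNormedModule)).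
  - intros y [f [Hf <-]]. exact (scrF_unique k alpha beta _ _ x Hf HF Hx).
  - exists (Fval k (e alpha) (e beta)). now split.
Qed.

(** * Convergence on the unit circle and the finite identities *)

Lemma ex_series_telescope (d : nat -> R) :
  is_lim_seq d 0 -> ex_series (fun n => d n - d (S n)).
Proof.
  intros Hd. exists (d 0%nat - 0).
  change (is_lim_seq (sum_n (fun n => d n - d (S n))) (d 0%nat - 0)).
  apply (is_lim_seq_ext (fun n => d 0%nat - d (S n))).
  - intros n. induction n as [|n IH].
    + now rewrite sum_O.
    + rewrite sum_Sn, <- IH. unfold plus; simpl. ring.
  - apply is_lim_seq_minus'; [apply is_lim_seq_const|]. now apply is_lim_seq_incr_1 in Hd.
Qed.

(** Summation by parts: (1 - u) times the partial sum is b_0 plus an absolutely convergent sum of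
    (b_(n+1) - b_n) u^(n+1), minus an end term that tends to 0. Bounded variation replaces
    monotonicity because the coefficients for [Li2] contain complex partial sums. *)
Lemma Dirichlet_test (u : C) (b : nat -> C) :
  Cmod u = 1 -> u <> 1 -> is_Clim b 0 ->
  ex_series (fun n => Cmod (b (S n) - b n)) ->
  exists l, is_Clim (Csum (fun n => b n * u ^ n)%C 0) l.
Proof.
  intros Hu Hu1 Hb Hs.
  assert (H1u : (1 - u)%C <> 0).
  { intros E. apply Hu1. replace u with (1 - (1 - u))%C by ring. rewrite E. ring. }
  destruct (Csum_Cauchy_Clim (fun n => (b (S n) - b n) * u ^ S n)%C
    (fun n => Cmod (b (S n) - b n))) as [l Hl]; [|exact Hs|].
  { intros n. rewrite Cmod_mult, Cmod_pow, Hu, pow1. lra. }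
  exists ((b 0%nat + l - 0) / (1 - u))%C. apply is_Clim_incr.
  apply is_Clim_ext with (fun N => / (1 - u) *
    (b 0%nat + Csum (fun n => (b (S n) - b n) * u ^ S n) 0 N - b (S N) * u ^ S (S N)))%C.
  - intros N.
    assert (E : ((1 - u) * Csum (fun n => b n * u ^ n) 0 (S N)
      = b 0%nat + Csum (fun n => (b (S n) - b n) * u ^ S n) 0 N - b (S N) * u ^ S (S N))%C).
    { induction N as [|N IH].
      - rewrite Csum_S, !Csum_one, !Cpow_S by lia. change (u ^ 0)%C with (RtoC 1). ring.
      - rewrite Csum_S, Cmult_plus_distr_l, IH by lia.
        rewrite (Csum_S (fun n => (b (S n) - b n) * u ^ S n)%C) by lia.
        rewrite (Cpow_S u (S (S N))). ring. }
    rewrite <- E. field. exact H1u.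
  - replace ((b 0%nat + l - 0) / (1 - u))%C with (/ (1 - u) * (b 0%nat + l - 0))%C
      by (unfold Cdiv; ring).
    apply is_Clim_mult_l, is_Clim_minus.
    + apply is_Clim_plus; [apply is_Clim_const|exact Hl].
    + apply is_Clim_incr in Hb.
      apply is_Clim_le with (fun N => Cmod (b (S N) - 0)); [|exact Hb].
      intros N. replace (b (S N) * u ^ S (S N) - 0)%C with (b (S N) * u ^ S (S N))%C by ring.
      rewrite Cmod_mult, Cmod_pow, Hu, pow1, Rmult_1_r.
      replace (b (S N) - 0)%C with (b (S N)) by ring. lra.
Qed.

Lemma is_lim_seq_inv_S : is_lim_seq (fun n => / INR (S n)) 0.
Proof.
  apply (is_lim_seq_incr_1 (fun n => / INR n)).
  change (Finite 0) with (Rbar_inv p_infty).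
  apply is_lim_seq_inv; [apply is_lim_seq_INR|discriminate].
Qed.

Lemma inv_pow_S_le (s n : nat) : (1 <= s)%nat -> 0 < / INR (S n) ^ s <= / INR (S n).
Proof.
  intros Hs. assert (H := INR_pow_ge s (S n) ltac:(lia) Hs). assert (H0 := INR_S_pos n).
  split; [apply Rinv_0_lt_compat; lra|apply Rinv_le_contravar; lra].
Qed.

(** Used with [A = 1] for [Li 1], and with the partial sums of the inner series as [A] for [Li2]. *)
Lemma weighted_Li_converges (u : C) (A : nat -> C) (s : nat) (Mx : R) :
  Cmod u = 1 -> u <> 1 -> (1 <= s)%nat ->
  (forall n, Cmod (A n) <= Mx) -> (forall n, Cmod (A (S n) - A n) <= / INR (S n)) ->
  exists l, is_Clim (Csum (fun n => A n * (u ^ S n / RtoC (INR (S n)) ^ s))%C 0) l.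
Proof.
  intros Hu Hu1 Hs HM HA.
  assert (HM0 : 0 <= Mx) by (eapply Rle_trans; [apply Cmod_ge_0|apply (HM 0%nat)]).
  set (c := fun n => / INR (S n) ^ s).
  assert (Hc : forall n, 0 < c n <= / INR (S n)) by (intros; now apply inv_pow_S_le).
  assert (Hcd : forall n, c (S n) <= c n).
  { intros n. unfold c. assert (H := INR_S_pos n).
    apply Rinv_le_contravar; [now apply pow_lt|]. apply pow_incr.
    rewrite (S_INR (S n)). lra. }
  assert (HRc : forall n, (/ RtoC (INR (S n)) ^ s)%C = RtoC (c n)).
  { intros n. unfold c. rewrite RtoC_inv.
    - now rewrite RtoC_pow.
    - apply pow_nonzero. assert (H := INR_S_pos n). lra. }
  destruct (Dirichlet_test u (fun n => A n * (u * RtoC (c n)))%C Hu Hu1) as [l Hl].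
  - apply is_Clim_le with (fun n => Mx * / INR (S n)).
    + intros n. replace (A n * (u * RtoC (c n)) - 0)%C with (A n * (u * RtoC (c n)))%C by ring.
      destruct (Hc n) as [Hc1 Hc2].
      rewrite !Cmod_mult, Hu, Cmod_R, Rabs_pos_eq, Rmult_1_l by lra.
      apply Rmult_le_compat; [apply Cmod_ge_0|lra|apply HM|exact Hc2].
    + replace 0 with (Mx * 0) by ring.
      apply (is_lim_seq_scal_l (fun n => / INR (S n)) Mx 0), is_lim_seq_inv_S.
  - set (d := fun n => / INR (S n) + Mx * c n).
    apply (ex_series_le (V := R_CompleteNormedModule) _ (fun n => d n - d (S n))).
    + intros n. change (Rabs (Cmod (A (S n) * (u * RtoC (c (S n))) - A n * (u * RtoC (c n))))
        <= d n - d (S n)).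
      rewrite Rabs_pos_eq by apply Cmod_ge_0.
      replace (A (S n) * (u * RtoC (c (S n))) - A n * (u * RtoC (c n)))%C
        with (u * ((A (S n) - A n) * RtoC (c (S n)) - A n * RtoC (c n - c (S n))))%C
        by (rewrite RtoC_minus; ring).
      rewrite Cmod_mult, Hu, Rmult_1_l.
      eapply Rle_trans; [apply Cmod_minus_le|].
      destruct (Hc (S n)) as [H1 H2]. specialize (Hcd n).
      rewrite !Cmod_mult, !Cmod_R, !Rabs_pos_eq by lra.
      unfold d. assert (P := INR_S_pos n). assert (Q := INR_S_pos (S n)).
      assert (B1 : Cmod (A (S n) - A n) * c (S n) <= / INR (S n) - / INR (S (S n))).
      { apply Rle_trans with (/ INR (S n) * / INR (S (S n))).
        - apply Rmult_le_compat; [apply Cmod_ge_0|lra|apply HA|exact H2].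
        - right. rewrite (S_INR (S n)) in *. field. split; lra. }
      assert (B2 : Cmod (A n) * (c n - c (S n)) <= Mx * (c n - c (S n)))
        by (apply Rmult_le_compat_r; [lra|apply HM]).
      lra.
    + apply ex_series_telescope. unfold d. replace 0 with (0 + Mx * 0) by ring.
      apply is_lim_seq_plus'; [apply is_lim_seq_inv_S|].
      apply (is_lim_seq_scal_l c Mx 0).
      apply is_lim_seq_le_le with (u := fun _ => 0) (w := fun n => / INR (S n)).
      * intros n. destruct (Hc n). lra.
      * apply is_lim_seq_const.
      * apply is_lim_seq_inv_S.
  - exists l. revert Hl. apply is_Clim_ext. intros N. apply Csum_ext. intros n _.
    rewrite <- HRc, Cpow_S. unfold Cdiv. ring.
Qed.

Lemma Li_circle (s : nat) (u : C) :
  (1 <= s)%nat -> Cmod u = 1 -> (s = 1%nat -> u <> 1) -> is_Clim (LiN s u) (Li s u).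
Proof.
  intros Hs Hu H1. apply is_Clim_LiN. unfold Li. apply CSeries_correct.
  destruct (Nat.eq_dec s 1) as [E|Hne].
  - destruct (weighted_Li_converges u (fun _ => RtoC 1) s 1) as [l Hl]; auto.
    + intros _. rewrite Cmod_1. lra.
    + intros n. replace (1 - 1)%C with (RtoC 0) by ring. rewrite Cmod_0.
      left. apply Rinv_0_lt_compat, INR_S_pos.
    + exists l. revert Hl. apply is_Clim_ext. intros N. apply Csum_ext. intros n _. ring.
  (* For [s >= 2] the convergence is absolute, by 1 / x^2 <= 2 / (x (x + 1)), which telescopes. *)
  - apply Csum_Cauchy_Clim with (fun n => 2 / INR (S n) - 2 / INR (S (S n))).
    + intros n. rewrite Cmod_LiN_term, Hu, pow1 by lia.
      destruct s as [|s]; [lia|].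
      assert (H := INR_pow_ge s (S n) ltac:(lia) ltac:(lia)). assert (P := INR_S_pos n).
      rewrite (S_INR (S n)). set (x := INR (S n)) in *.
      assert (Hx : 1 <= x) by (apply (le_INR 1); lia).
      replace (2 / x - 2 / (x + 1)) with (2 / (x * (x + 1))) by (field; lra).
      simpl. apply Rle_trans with (1 / (x * x)).
      * unfold Rdiv. rewrite !Rmult_1_l. apply Rinv_le_contravar; nra.
      * apply Rle_div_l; [nra|].
        replace (2 / (x * (x + 1)) * (x * x)) with (2 * x / (x + 1)) by (field; lra).
        apply Rle_div_r; lra.
    + apply (ex_series_telescope (fun n => 2 / INR (S n))).
      replace 0 with (2 * 0) by ring.
      apply (is_lim_seq_scal_l (fun n => / INR (S n)) 2 0), is_lim_seq_inv_S.
Qed.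

Definition Li2N (a b : nat) (z1 z2 : C) (N : nat) : C :=
  Csum (fun q => LiN a z1 (q - 1) * (z2 ^ q / RtoC (INR q) ^ b))%C 1 N.

(** The inner partial sums converge, hence are bounded, and their n-th increment is at most 1 / (n +
    1); [weighted_Li_converges] does the rest. *)
Lemma Li2_circle (a b : nat) (z1 z2 : C) :
  (1 <= a)%nat -> (1 <= b)%nat -> Cmod z1 = 1 -> Cmod z2 = 1 -> z1 <> 1 -> z2 <> 1 ->
  is_Clim (Li2N a b z1 z2) (Li2 a b z1 z2).
Proof.
  intros Ha Hb H1 H2 N1 N2.
  destruct (Clim_bounded _ _ (Li_circle a z1 Ha H1 (fun _ => N1))) as [Mx HM].
  destruct (weighted_Li_converges z2 (LiN a z1) b Mx H2 N2 Hb HM) as [l Hl].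
  - intros n.
    replace (LiN a z1 (S n) - LiN a z1 n)%C with (z1 ^ S n / RtoC (INR (S n)) ^ a)%C
      by (unfold LiN; rewrite Csum_S by lia; ring).
    rewrite Cmod_LiN_term, H1, pow1 by lia.
    unfold Rdiv. rewrite Rmult_1_l. now apply inv_pow_S_le.
  - apply is_Clim_incr.
    apply is_Clim_ext with (Csum (fun n => LiN a z1 n * (z2 ^ S n / RtoC (INR (S n)) ^ b))%C 0).
    + intros N. unfold Li2N. rewrite <- Csum_shift. apply Csum_ext. intros n _.
      now replace (S n - 1)%nat with n by lia.
    + apply (CSeries_correct (fun n => LiN a z1 n * (z2 ^ S n / RtoC (INR (S n)) ^ b))%C).
      now exists l.
Qed.

Lemma is_Clim_Csum (f : nat -> nat -> C) (l : nat -> C) (m n : nat) :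
  (forall i, (m <= i <= n)%nat -> is_Clim (f i) (l i)) ->
  is_Clim (fun N => Csum (fun i => f i N) m n) (Csum l m n).
Proof.
  intros H. destruct (Compare_dec.le_lt_dec m n) as [Hmn|Hmn].
  2:{ rewrite Csum_empty by exact Hmn.
      apply is_Clim_ext with (fun _ => RtoC 0); [|apply is_Clim_const].
      intros N. now rewrite Csum_empty by exact Hmn. }
  induction n as [|n IH].
  - replace m with 0%nat in * by lia. rewrite Csum_one.
    apply is_Clim_ext with (f 0%nat); [|apply H; lia]. intros N. now rewrite Csum_one.
  - destruct (Nat.eq_dec m (S n)) as [->|Hne].
    + rewrite Csum_one. apply is_Clim_ext with (f (S n)); [|apply H; lia].
      intros N. now rewrite Csum_one.
    + rewrite Csum_S by lia.
      apply is_Clim_ext with (fun N => Csum (fun i => f i N) m n + f (S n) N)%C.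
      * intros N. now rewrite Csum_S by lia.
      * apply is_Clim_plus; [|apply H; lia]. apply IH; [intros; apply H; lia|lia].
Qed.

(** The right side is a geometric sum of ratio -x P / Q, and 1 minus this ratio is (P x + Q) / Q.
    With [n = k - 1] it produces the sums over [r] in the theorem. *)
Lemma partial_fraction (P Q x : C) (n : nat) :
  P <> 0 -> Q <> 0 -> (P * x + Q)%C <> 0 ->
  (1 / (P ^ n * (P * x + Q)) - (- x) ^ n / (Q ^ n * (P * x + Q))
   = Csum (fun r => (- x) ^ (r - 1) / (P ^ (S n - r) * Q ^ r)) 1 n)%C.
Proof.
  intros HP HQ HD. induction n as [|n IH].
  - rewrite Csum_empty by lia. change (P ^ 0)%C with (RtoC 1). change (Q ^ 0)%C with (RtoC 1).
    change ((- x) ^ 0)%C with (RtoC 1). field. exact HD.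
  - rewrite Csum_S by lia.
    rewrite (Csum_ext _ (fun r => / P * ((- x) ^ (r - 1) / (P ^ (S n - r) * Q ^ r)))%C).
    + rewrite Csum_mult_l, <- IH.
      replace (S n - 1)%nat with n by lia. replace (S (S n) - S n)%nat with 1%nat by lia.
      rewrite !Cpow_S. change (P ^ 0)%C with (RtoC 1).
      field. repeat split; try assumption; now apply Cpow_nz.
    + intros r Hr. replace (S (S n) - r)%nat with (S (S n - r)) by lia.
      rewrite Cpow_S. field. repeat split; try assumption; now apply Cpow_nz.
Qed.

Lemma slit_plane_neq_0 (x : C) : slit_plane x -> x <> 0.
Proof. intros Hx E. apply Hx. rewrite E. simpl. lra. Qed.

Lemma slit_plane_linear (x : C) (p q : R) :
  slit_plane x -> 0 < p -> 0 <= q -> slit_plane (RtoC p * x + RtoC q).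
Proof.
  intros Hx Hp Hq [H1 H2]. apply Hx. destruct x as [a b]. unfold Re, Im in *. simpl in *.
  split; nra.
Qed.

Lemma slit_plane_S (x : C) : slit_plane x -> slit_plane (x + 1).
Proof.
  intros Hx. assert (H := slit_plane_linear x 1 1 Hx ltac:(lra) ltac:(lra)).
  now rewrite Cmult_1_l in H.
Qed.

Lemma slit_plane_inv (x : C) : slit_plane x -> slit_plane (1 / x).
Proof.
  intros Hx [H1 H2]. apply Hx. assert (H0 := slit_plane_neq_0 x Hx).
  destruct x as [a b]. 
  assert (Hn : 0 < a * (a * 1) + b * (b * 1)).
  { destruct (Req_dec a 0) as [->|]; [|nra]. destruct (Req_dec b 0) as [->|]; [|nra].
    now destruct H0. }
  unfold Re, Im in *. simpl in *.
  set (n := a * (a * 1) + b * (b * 1)) in *.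
  assert (Hi : 0 < / n) by now apply Rinv_0_lt_compat.
  unfold Rdiv in *. assert (E1 : b * / n = 0) by lra. assert (E2 : a * / n <= 0) by lra.
  split; [|nra]. apply Rmult_integral in E1. destruct E1; [assumption|lra].
Qed.

Lemma slit_plane_shift_inv (x : C) : slit_plane x -> slit_plane ((x + 1) / x).
Proof.
  intros Hx. assert (H0 := slit_plane_neq_0 x Hx).
  replace ((x + 1) / x)%C with (1 / x + 1)%C by (field; exact H0).
  now apply slit_plane_S, slit_plane_inv.
Qed.

Lemma Fterm_denom_neq_0 (x : C) (p q : nat) :
  slit_plane x -> (RtoC (INR (S p)) * x + RtoC (INR q))%C <> 0.
Proof.
  intros Hx. apply slit_plane_neq_0, slit_plane_linear;
    [exact Hx|apply INR_S_pos|apply pos_INR].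
Qed.

(** The exponent is -1 when [k = 1]; one factor [y] turns it into a natural power, with which the
    finite identities can be computed. *)
Lemma Cpowz_minus_2 (k : nat) (y : C) :
  (1 <= k)%nat -> y <> 0 -> (y * Cpowz y (Z.of_nat k - 2) = y ^ (k - 1))%C.
Proof.
  intros Hk Hy. destruct k as [|[|[|k]]]; [lia| | |].
  - simpl. field. exact Hy.
  - simpl. reflexivity.
  - replace (Z.of_nat (S (S (S k))) - 2)%Z with (Zpos (Pos.of_succ_nat k)) by lia.
    unfold Cpowz. rewrite SuccNat2Pos.id_succ.
    now replace (S (S (S k)) - 1)%nat with (S (S k)) by lia.
Qed.

(** The terms with [q = 0] escape [partial_fraction]; they are the source of the single
    polylogarithms of weight [k]. *)
Lemma Fterm_0 (k : nat) (u v x : C) (p : nat) :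
  (1 <= k)%nat -> x <> 0 ->
  Fterm k u v x (S p) 0 = (1 / x * (u ^ S p / RtoC (INR (S p)) ^ k))%C.
Proof.
  intros Hk Hx. unfold Fterm. destruct k as [|k]; [lia|].
  replace (S k - 1)%nat with k by lia. rewrite (Cpow_S (RtoC (INR (S p)))).
  change (v ^ 0)%C with (RtoC 1). change (RtoC (INR 0)) with (RtoC 0).
  assert (H := RtoC_INR_S_neq_0 p). field.
  repeat split; try assumption. now apply Cpow_nz.
Qed.

(** Because p x + q = x (q / x + p), the subtracted term is minus (-x)^(k-2) times the term (q, p)
    of the function at 1/x. *)
Lemma Fterm_pair (k : nat) (u v x : C) (p q : nat) :
  (1 <= k)%nat -> slit_plane x ->
  (Fterm k u v x (S p) (S q)
   - (- x) ^ (k - 1) * (u ^ S p * v ^ S q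
       / (RtoC (INR (S q)) ^ (k - 1) * (RtoC (INR (S p)) * x + RtoC (INR (S q)))))
   = Csum (fun r => (- x) ^ (r - 1) * (u ^ S p / RtoC (INR (S p)) ^ (k - r)
                                       * (v ^ S q / RtoC (INR (S q)) ^ r))) 1 (k - 1))%C.
Proof.
  intros Hk Hx. assert (HP := RtoC_INR_S_neq_0 p). assert (HQ := RtoC_INR_S_neq_0 q).
  assert (HD := Fterm_denom_neq_0 x p (S q) Hx).
  rewrite (Csum_ext _ (fun r => u ^ S p * v ^ S q
    * ((- x) ^ (r - 1) / (RtoC (INR (S p)) ^ (S (k - 1) - r) * RtoC (INR (S q)) ^ r)))%C).
  2:{ intros r Hr. replace (S (k - 1) - r)%nat with (k - r)%nat by lia.
      field. split; now apply Cpow_nz. }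
  rewrite Csum_mult_l, <- partial_fraction by assumption.
  unfold Fterm. field. repeat split; try assumption; now apply Cpow_nz.
Qed.

(** The square is symmetric in p and q, so every term with [q >= 1] meets its mirror image and
    [Fterm_pair] applies; the resulting sum over pairs splits into a product of partial sums for
    each [r]. *)
Lemma Fsum_reciprocal_identity (k : nat) (u v x : C) (N : nat) :
  (1 <= k)%nat -> slit_plane x ->
  (Fsum k box_rows u v x N
   + Cpowz (- x) (Z.of_nat k - 2) * Fsum k box_rows v u (1 / x) N
   = 1 / x * LiN k u N - (- x) ^ (k - 1) * LiN k v N
     + Csum (fun r => (- x) ^ (r - 1) * (LiN (k - r) u N * LiN r v N)) 1 (k - 1))%C.
Proof.
  intros Hk Hx. assert (Hx0 := slit_plane_neq_0 x Hx).
  assert (Hy := Cpowz_minus_2 k (- x) Hk ltac:(intros E; apply Hx0;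
     replace x with (- - x)%C by ring; rewrite E; ring)).
  set (y := Cpowz (- x) (Z.of_nat k - 2)) in *.
  unfold Fsum, box_rows.
  rewrite (Csum_ext _ (fun p => 1 / x * (u ^ p / RtoC (INR p) ^ k)
                 + Csum (fun q => Fterm k u v x p q) 1 N)%C 1 N).
  2:{ intros p Hp. destruct p as [|p]; [lia|].
      rewrite Csum_first, Fterm_0 by (assumption || lia). reflexivity. }
  (* The factor [x] is 1 / (1/x); together with (-x)^(k-2) it gives the coefficient -(-x)^(k-1) of
     [LiN k v N]. *)
  rewrite (Csum_ext (fun p => Csum (fun q => Fterm k v u (1 / x) p q) 0 N)
    (fun p => x * (v ^ p / RtoC (INR p) ^ k)
                 + Csum (fun q => Fterm k v u (1 / x) p q) 1 N)%C 1 N).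
  2:{ intros p Hp. destruct p as [|p]; [lia|].
      assert (H1x := slit_plane_neq_0 _ (slit_plane_inv x Hx)).
      rewrite Csum_first, Fterm_0 by (assumption || lia). f_equal. f_equal.
      field. exact Hx0. }
  rewrite !Csum_plus, !Csum_mult_l.
  change (Csum (fun i => u ^ i / RtoC (INR i) ^ k)%C 1 N) with (LiN k u N).
  change (Csum (fun i => v ^ i / RtoC (INR i) ^ k)%C 1 N) with (LiN k v N).
  rewrite <- Hy.
  assert (E : (Csum (fun p => Csum (fun q => Fterm k u v x p q) 1 N) 1 N
     + y * Csum (fun p => Csum (fun q => Fterm k v u (1 / x) p q) 1 N) 1 N
     = Csum (fun r => (- x) ^ (r - 1) * (LiN (k - r) u N * LiN r v N)) 1 (k - 1))%C).
  2:{ rewrite <- E. ring. }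
  rewrite (Csum_swap (fun p q => Fterm k v u (1 / x) p q)).
  rewrite <- Csum_mult_l, <- Csum_plus.
  rewrite (Csum_ext _ (fun p => Csum (fun q => Csum (fun r =>
     (- x) ^ (r - 1) * (u ^ p / RtoC (INR p) ^ (k - r) * (v ^ q / RtoC (INR q) ^ r)))
       1 (k - 1)) 1 N)%C).
  2:{ intros p Hp. rewrite <- Csum_mult_l, <- Csum_plus. apply Csum_ext. intros q Hq.
      destruct p as [|p]; [lia|]. destruct q as [|q]; [lia|].
      rewrite <- Fterm_pair by assumption. rewrite <- Hy. unfold Cminus at 1. f_equal.
      unfold Fterm.
      assert (HD := Fterm_denom_neq_0 x p (S q) Hx). assert (HQ := RtoC_INR_S_neq_0 q).
      field. repeat split; try assumption; now apply Cpow_nz. }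
  rewrite (Csum_ext _ (fun p => Csum (fun r => Csum (fun q =>
     (- x) ^ (r - 1) * (u ^ p / RtoC (INR p) ^ (k - r) * (v ^ q / RtoC (INR q) ^ r)))
       1 N) 1 (k - 1))%C) by (intros; apply Csum_swap).
  rewrite Csum_swap. apply Csum_ext. intros r _.
  unfold LiN at 1. rewrite <- Csum_mult_r, <- Csum_mult_l. apply Csum_ext. intros p _.
  unfold LiN. rewrite <- !Csum_mult_l. reflexivity.
Qed.

Lemma Fsum_box_S (k : nat) (u v x : C) (N : nat) :
  Fsum k box_rows u v x (S N)
  = (Fsum k box_rows u v x N + Csum (fun p => Fterm k u v x p (S N)) 1 N
     + Csum (fun q => Fterm k u v x (S N) q) 0 (S N))%C.
Proof.
  unfold Fsum, box_rows. rewrite Csum_S by lia. f_equal.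
  rewrite <- Csum_plus. apply Csum_ext. intros p _. now rewrite Csum_S by lia.
Qed.

Lemma Fsum_tri_S (k : nat) (u v x : C) (N : nat) :
  Fsum k tri_rows u v x (S N)
  = (Fsum k tri_rows u v x N + Csum (fun p => Fterm k u v x p (S N - p)) 1 (S N))%C.
Proof.
  unfold Fsum, tri_rows. rewrite !Csum_S by lia.
  replace (S N - S N)%nat with 0%nat by lia. rewrite Csum_one.
  rewrite (Csum_ext _ (fun p => Csum (fun q => Fterm k u v x p q) 0 (N - p)
                                + Fterm k u v x p (S N - p))%C).
  - rewrite Csum_plus. ring.
  - intros p Hp. replace (S N - p)%nat with (S (N - p)) by lia. now rewrite Csum_S by lia.
Qed.

(** Induction on [N]. The square gains the row and column of index N + 1, each triangle an
    antidiagonal. The first antidiagonal cancels the new terms with p <= q = N + 1, including the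
    corner; the second pairs with the terms p = N + 1, 1 <= q <= N, through [Fterm_pair]. What is
    left are the terms p = N + 1, q = 0 and the end of the second antidiagonal. *)
Lemma Fsum_shift_identity (k : nat) (u v x : C) (N : nat) :
  (1 <= k)%nat -> slit_plane x ->
  (Fsum k box_rows u v x N - Fsum k tri_rows (u * v) v (x + 1) N
   + Cpowz (- x) (Z.of_nat k - 2) * Fsum k tri_rows (u * v) u ((x + 1) / x) N
   = 1 / x * LiN k u N - (- x) ^ (k - 1) / (x + 1) * LiN k (u * v) N
     + Csum (fun r => (- x) ^ (r - 1) * Li2N r (k - r) v u N) 1 (k - 1))%C.
Proof.
  intros Hk Hx. assert (Hx0 := slit_plane_neq_0 x Hx).
  assert (Hx1 := slit_plane_neq_0 _ (slit_plane_S x Hx)).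
  assert (Hy := Cpowz_minus_2 k (- x) Hk ltac:(intros E; apply Hx0;
     replace x with (- - x)%C by ring; rewrite E; ring)).
  set (y := Cpowz (- x) (Z.of_nat k - 2)) in *.
  induction N as [|N IH].
  { rewrite (Csum_ext _ (fun _ => RtoC 0 * 0)%C).
    - rewrite Csum_mult_l. unfold Fsum, LiN. rewrite !Csum_empty by lia. ring.
    - intros r _. unfold Li2N. rewrite Csum_empty by lia. ring. }
  rewrite Fsum_box_S, !Fsum_tri_S.
  set (G := fun q => (- ((- x) ^ (k - 1) * (u ^ S N * v ^ q
       / (RtoC (INR q) ^ (k - 1) * (RtoC (INR (S N)) * x + RtoC (INR q))))))%C).
  (* On the antidiagonal p (x + 1) + (N + 1 - p) = p x + (N + 1), and the powers combine to u^p
     v^(N+1). *)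
  rewrite (Csum_ext (fun p => Fterm k (u * v) v (x + 1) p (S N - p))
                    (fun p => Fterm k u v x p (S N))).
  2:{ intros p Hp. unfold Fterm. rewrite minus_INR, RtoC_minus by lia. f_equal.
      - rewrite Cpow_mult_l, <- Cmult_assoc, <- Cpow_add_r. do 2 f_equal. lia.
      - f_equal. ring. }
  (* Likewise q (x + 1) / x + (N + 1 - q) = ((N + 1) x + q) / x, and the factor x joins [y] to give
     -(-x)^(k-1). *)
  assert (E3 : (y * Csum (fun p => Fterm k (u * v) u ((x + 1) / x) p (S N - p)) 1 (S N)
               = Csum G 1 (S N))%C).
  { rewrite <- Csum_mult_l. apply Csum_ext. intros q Hq. unfold G. rewrite <- Hy.
    unfold Fterm. rewrite minus_INR, RtoC_minus by lia.
    rewrite Cpow_mult_l.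
    replace (u ^ q * v ^ q * u ^ (S N - q))%C with (u ^ S N * v ^ q)%C.
    2:{ replace (S N) with (q + (S N - q))%nat at 1 by lia. rewrite Cpow_add_r. ring. }
    destruct q as [|q]; [lia|].
    assert (HD := Fterm_denom_neq_0 x N (S q) Hx). assert (HQ := RtoC_INR_S_neq_0 q).
    field. repeat split; try assumption; now apply Cpow_nz. }
  rewrite Cmult_plus_distr_l, E3.
  rewrite (Csum_S (fun p => Fterm k u v x p (S N)) 1 N) by lia.
  rewrite (Csum_first (fun q => Fterm k u v x (S N) q) 0) by lia.
  rewrite (Csum_S (fun q => Fterm k u v x (S N) q) 1 N) by lia.
  rewrite (Csum_S G 1 N) by lia.
  (* Here q runs strictly below N + 1, so the sum is the term of outer index N + 1 in the double
     polylogarithm. *)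
  assert (EG : (Csum (fun q => Fterm k u v x (S N) q) 1 N + Csum G 1 N
     = Csum (fun r => (- x) ^ (r - 1) * (LiN r v N
            * (u ^ S N / RtoC (INR (S N)) ^ (k - r)))) 1 (k - 1))%C).
  { rewrite <- Csum_plus.
    rewrite (Csum_ext _ (fun q => Csum (fun r => (- x) ^ (r - 1)
        * (u ^ S N / RtoC (INR (S N)) ^ (k - r) * (v ^ q / RtoC (INR q) ^ r))) 1 (k - 1))%C).
    - rewrite Csum_swap. apply Csum_ext. intros r _. unfold LiN.
      rewrite <- Csum_mult_r, <- Csum_mult_l. apply Csum_ext. intros q _. ring.
    - intros q Hq. destruct q as [|q]; [lia|]. rewrite <- Fterm_pair by assumption.
      reflexivity. }
  assert (ER : Csum (fun r => (- x) ^ (r - 1) * Li2N r (k - r) v u (S N))%C 1 (k - 1)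
     = (Csum (fun r => (- x) ^ (r - 1) * Li2N r (k - r) v u N) 1 (k - 1)
        + (Csum (fun q => Fterm k u v x (S N) q) 1 N + Csum G 1 N))%C).
  { rewrite EG, <- Csum_plus. apply Csum_ext. intros r _. unfold Li2N.
    rewrite Csum_S by lia. replace (S N - 1)%nat with N by lia. ring. }
  rewrite ER.
  replace (LiN k u (S N)) with (LiN k u N + u ^ S N / RtoC (INR (S N)) ^ k)%C
    by (unfold LiN; now rewrite Csum_S by lia).
  replace (LiN k (u * v) (S N))
    with (LiN k (u * v) N + (u * v) ^ S N / RtoC (INR (S N)) ^ k)%C
    by (unfold LiN; now rewrite Csum_S by lia).
  rewrite Fterm_0 by assumption.
  (* At q = N + 1 the denominator is (N + 1)(x + 1): this is the origin of the factor 1 / (x +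
     1). *)
  assert (EL : G (S N) = (- ((- x) ^ (k - 1) / (x + 1)
                * ((u * v) ^ S N / RtoC (INR (S N)) ^ k)))%C).
  { unfold G. destruct k as [|k']; [lia|]. replace (S k' - 1)%nat with k' by lia.
    rewrite Cpow_mult_l, (Cpow_S (RtoC (INR (S N)))).
    assert (HN := RtoC_INR_S_neq_0 N). assert (HD := Fterm_denom_neq_0 x N (S N) Hx).
    field. repeat split; try assumption. now apply Cpow_nz. }
  rewrite EL.
  set (S1 := Csum (fun r => (- x) ^ (r - 1) * Li2N r (k - r) v u N)%C 1 (k - 1)) in *.
  set (F1 := Fsum k box_rows u v x N) in *.
  set (F2 := Fsum k tri_rows (u * v) v (x + 1) N) in *.
  set (F3 := Fsum k tri_rows (u * v) u ((x + 1) / x) N) in *.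
  replace S1 with (F1 - F2 + y * F3
    - (1 / x * LiN k u N - (- x) ^ (k - 1) / (x + 1) * LiN k (u * v) N))%C
    by (rewrite IH; ring).
  ring.
Qed.

(** * The functional equations, by passing to the limit in the finite identities *)

Lemma scrF_reciprocal (k : nat) (alpha beta : R) (x : C) :
  (1 <= k)%nat -> non_integer alpha -> non_integer beta -> slit_plane x ->
  (scrF k x alpha beta + Cpowz (- x) (Z.of_nat k - 2) * scrF k (1 / x) beta alpha
   = 1 / x * Li k (e alpha) - (- x) ^ (k - 1) * Li k (e beta)
     + Csum (fun r => (- x) ^ (r - 1) * (Li (k - r) (e alpha) * Li r (e beta)))
         1 (k - 1))%C.
Proof.
  intros Hk Ha Hb Hx.
  rewrite !scrF_value by auto using slit_plane_inv.
  assert (Ua := e_neq_1 _ Ha). assert (Ub := e_neq_1 _ Hb).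
  assert (Ma := Cmod_e alpha). assert (Mb := Cmod_e beta).
  eapply is_Clim_unique.
  - apply is_Clim_plus; [apply Fsum_box_Clim; auto|].
    apply is_Clim_mult_l, Fsum_box_Clim; auto using slit_plane_inv.
  - apply is_Clim_ext with (2 := is_Clim_plus _ _ _ _
      (is_Clim_minus _ _ _ _
        (is_Clim_mult_l (1 / x) _ _ (Li_circle k _ Hk Ma (fun _ => Ua)))
        (is_Clim_mult_l ((- x) ^ (k - 1)) _ _ (Li_circle k _ Hk Mb (fun _ => Ub))))
      (is_Clim_Csum (fun r N => (- x) ^ (r - 1) * (LiN (k - r) (e alpha) N * LiN r (e beta) N))%C
        _ 1 (k - 1) (fun r Hr => is_Clim_mult_l _ _ _ (is_Clim_mult _ _ _ _
           (Li_circle (k - r) (e alpha) ltac:(lia) Ma (fun _ => Ua))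
           (Li_circle r (e beta) ltac:(lia) Mb (fun _ => Ub)))))).
    intros N. symmetry. now apply Fsum_reciprocal_identity.
Qed.

(** The hypothesis on [alpha + beta] concerns [k = 1], where Li_0(z) = z / (1 - z) and Li_1 are both
    singular at 1. *)
Lemma scrF_shift (k : nat) (alpha beta : R) (x : C) :
  (1 <= k)%nat -> non_integer alpha -> non_integer beta ->
  (k = 1%nat -> non_integer (alpha + beta)) -> slit_plane x ->
  (scrF k x alpha beta - scrF k (x + 1) (alpha + beta) beta
     + Cpowz (- x) (Z.of_nat k - 2)
       * scrF k ((x + 1) / x) (alpha + beta) alpha
   = 1 / x * Li k (e alpha)
     - (- x) ^ (k - 1) / (x + 1) * Li k (e (alpha + beta))
     + Csum (fun r => (- x) ^ (r - 1) * Li2 r (k - r) (e beta) (e alpha))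
         1 (k - 1))%C.
Proof.
  intros Hk Ha Hb Hab Hx.
  rewrite !scrF_value by auto using slit_plane_S, slit_plane_shift_inv.
  assert (Ua := e_neq_1 _ Ha). assert (Ub := e_neq_1 _ Hb).
  assert (Ma := Cmod_e alpha). assert (Mb := Cmod_e beta). assert (Mab := Cmod_e (alpha + beta)).
  assert (Uab : k = 1%nat -> e (alpha + beta) <> 1) by (intros; now apply e_neq_1, Hab).
  assert (Eab := e_plus alpha beta).
  assert (Nab : forall w : R, e w <> 0).
  { intros w E. assert (M := Cmod_e w). rewrite E, Cmod_0 in M. lra. }
  (* The triangles need [u <> v] when [k = 1]; for the two shifted functions this is [e alpha <> 1]
     and [e beta <> 1]. *)
  assert (Nb : e (alpha + beta) <> e beta).
  { intros E. apply Ua. rewrite Eab in E.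
    replace (e alpha) with (e alpha * e beta / e beta)%C by (field; apply Nab).
    rewrite E. field. apply Nab. }
  assert (Na : e (alpha + beta) <> e alpha).
  { intros E. apply Ub. rewrite Eab in E.
    replace (e beta) with (e alpha * e beta / e alpha)%C by (field; apply Nab).
    rewrite E. field. apply Nab. }
  eapply is_Clim_unique.
  - apply is_Clim_plus; [apply is_Clim_minus|apply is_Clim_mult_l].
    + apply Fsum_box_Clim; auto.
    + apply Fsum_tri_Clim; auto using slit_plane_S.
    + apply Fsum_tri_Clim; auto using slit_plane_shift_inv.
  - apply is_Clim_ext with (2 := is_Clim_plus _ _ _ _
      (is_Clim_minus _ _ _ _
        (is_Clim_mult_l (1 / x) _ _ (Li_circle k _ Hk Ma (fun _ => Ua)))
        (is_Clim_mult_l ((- x) ^ (k - 1) / (x + 1)) _ _ (Li_circle k _ Hk Mab Uab)))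
      (is_Clim_Csum (fun r N => (- x) ^ (r - 1) * Li2N r (k - r) (e beta) (e alpha) N)%C
        _ 1 (k - 1) (fun r Hr => is_Clim_mult_l _ _ _
           (Li2_circle r (k - r) _ _ ltac:(lia) ltac:(lia) Mb Ma Ub Ua)))).
    intros N. rewrite Eab. symmetry. now apply Fsum_shift_identity.
Qed.

Lemma non_integer_opp (a : R) : non_integer a -> non_integer (- a).
Proof.
  intros H n E. apply (H (- n)%Z). rewrite opp_IZR, <- E. ring.
Qed.

Open Scope C_scope.

Theorem theorem3p1 (k : nat) (alpha beta : R) (x : C)
    (hk : (1 <= k)%nat)
    (halpha : non_integer alpha) (hbeta : non_integer beta)
    (hx : slit_plane x) :
  (scrF k x alpha beta
     + Cpowz (- x) (Z.of_nat k - 2) * scrF k (1 / x) beta alpha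
   = 1 / x * Li k (e alpha) - (- x) ^ (k - 1) * Li k (e beta)
     + Csum (fun r => (- x) ^ (r - 1) * (Li (k - r) (e alpha) * Li r (e beta)))
         1 (k - 1))
  /\
  ((k = 1%nat -> non_integer (alpha + beta)) ->
   scrF k x alpha beta - scrF k (x + 1) (alpha + beta) beta
     + Cpowz (- x) (Z.of_nat k - 2)
       * scrF k ((x + 1) / x) (alpha + beta) alpha
   = 1 / x * Li k (e alpha)
     - (- x) ^ (k - 1) / (x + 1) * Li k (e (alpha + beta))
     + Csum (fun r => (- x) ^ (r - 1) * Li2 r (k - r) (e beta) (e alpha))
         1 (k - 1))
  /\
  ((k = 1%nat -> non_integer (alpha + beta)) ->
   scrF k x alpha beta + scrF k x (- alpha) (- beta)
     - scrF k (x + 1) (alpha + beta) beta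
     - scrF k (x + 1) (- alpha - beta) (- beta)
     + Cpowz (- x) (Z.of_nat k - 2)
       * scrF k ((x + 1) / x) (alpha + beta) alpha
     + Cpowz (- x) (Z.of_nat k - 2)
       * scrF k ((x + 1) / x) (- alpha - beta) (- alpha)
   = 1 / x * (Li k (e alpha) + Li k (e (- alpha)))
     - (- x) ^ (k - 1) / (x + 1)
       * (Li k (e (alpha + beta)) + Li k (e (- alpha - beta)))
     + Csum (fun r => (- x) ^ (r - 1)
                      * (Li2 r (k - r) (e beta) (e alpha)
                         + Li2 r (k - r) (e (- beta)) (e (- alpha))))
         1 (k - 1)).
Proof.
  split; [|split].
  - now apply scrF_reciprocal.
  - intros Hab. now apply scrF_shift.
  - intros Hab.
    assert (Hab' : k = 1%nat -> non_integer (- alpha + - beta)).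
    { intros Hk1. rewrite <- Ropp_plus_distr. now apply non_integer_opp, Hab. }
    assert (E1 := scrF_shift k alpha beta x hk halpha hbeta Hab hx).
    assert (E2 := scrF_shift k (- alpha) (- beta) x hk (non_integer_opp _ halpha)
                    (non_integer_opp _ hbeta) Hab' hx).
    change (- alpha + - beta)%R with (- alpha - beta)%R in E2.
    rewrite (Csum_ext _ (fun r => (- x) ^ (r - 1) * Li2 r (k - r) (e beta) (e alpha)
      + (- x) ^ (r - 1) * Li2 r (k - r) (e (- beta)) (e (- alpha)))) by (intros; ring).
    rewrite Csum_plus, !Cmult_plus_distr_l.
    match goal with |- _ = ?a + ?b - (?c + ?d) + (?f + ?g) =>
      transitivity ((a - c + f) + (b - d + g)); [|ring] end.
    rewrite <- E1, <- E2. ring.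
Qed.
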